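(* Let $m\ge7$ be an integer, $4\le q<\infty$, $T>0$, $M>0$, and for each positive $\mu\neq1$ let $C_\mu=C(m,q,\mu,T,M)>0$ be the constant in the convergence-rate estimate recalled in the context. Let $\{\mu_k\}_{k\in\mathbb N}$ be any sequence of positive numbers with $\mu_k\ne1$ for all $k$ and $\mu_k\to1$ as $k\to\infty$. Then $$\frac1{C_{\mu_k}}=O(|1-\mu_k|)\quad\text{as }k\to\infty .$$
   Context: Rotating stratified Boussinesq equations on $\mathbb R^3\times(0,\infty)$, with constants $\Omega,N>0$ and unknowns $v$ ($\mathbb R^3$-valued), $\theta$, $p$ (scalar): $$\partial_t v+(v\cdot\nabla)v=-\Omega e_3\times v-\nabla p+N\theta e_3,\quad \partial_t\theta+(v\cdot\nabla)\theta=-Nv_3,\quad \nabla\cdot v=0,\quad (v,\theta)|_{t=0}=(v_0,\theta_0).$$ Write $u=(v,\theta)$, $u_0=(v_0,\theta_0)$, and $\mu=\Omega/N$. Projection: for $\mu>0$ and $\xi\in\mathbb R^3$, $\xi_\mu:=(-\xi_2,\xi_1,0,\mu\xi_3)^\top$, $b_\mu(\xi):=\xi_\mu/|\xi_\mu|$, and $\mathscr F(P_\mu w)(\xi)=\langle\mathscr Fw(\xi),b_\mu(\xi)\rangle_{\mathbb C^4}\,b_\mu(\xi)$. Quasi-geostrophic (QG) system for parameter $\mu$: with $\nabla_\mu:=(-\partial_2,\partial_1,0,\mu\partial_3)^\top$, $\Delta_\mu:=\partial_1^2+\partial_2^2+\mu^2\partial_3^2$, $\nabla_H=(\partial_1,\partial_2)^\top$,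 $\psi^\mu=\psi$ solves $$\partial_tq_{pv}+\mathbf v_H\cdot\nabla_Hq_{pv}=0,\quad q_{pv}=\Delta_\mu\psi,\quad \mathbf v_H=(-\partial_2\psi,\partial_1\psi)^\top,\quad \nabla_\mu\psi(\cdot,0)=P_\mu u_0 .$$ Convergence-rate estimate defining $C_\mu$: for each positive $\mu\neq1$ there exist $R=R(m,q,\mu,T,M)>0$ and $C_\mu=C(m,q,\mu,T,M)>0$ such that for every $u_0=(v_0,\theta_0)\in H^m(\mathbb R^3)$ with $\nabla\cdot v_0=0$ and $\|u_0\|_{H^m}=M$, whenever $\Omega/N=\mu$ and $\sqrt{\Omega^2+N^2}>R$, the Boussinesq equations have a unique classical solution $u\in C([0,T];H^m)\cap C^1([0,T];H^{m-1})$ with initial data $u_0$, and $$\|u-\nabla_\mu\psi^\mu\|_{L^q(0,T;W^{1,\infty})}^q\le \frac{C_\mu}{\sqrt{\Omega^2+N^2}} .$$ *)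

(* Defs.v *)
From HB Require Import structures.
From mathcomp Require Import all_boot all_order all_algebra.
From mathcomp Require Import all_classical all_reals all_analysis.
From mathcomp Require Import complex.

Set Implicit Arguments.
Unset Strict Implicit.
Unset Printing Implicit Defensive.

Import Order.TTheory GRing.Theory Num.Theory.
Import numFieldNormedType.Exports.

Local Open Scope classical_set_scope.
Local Open Scope ring_scope.

Section space.
Context {R : realType}.

(* The canonical norm of this product (and that of row vectors) is the maximum
   norm; Euclidean norms are written explicitly, see [enorm]. *)
Definition R3 : Type :=
  (measurableTypeR R * measurableTypeR R * measurableTypeR R)%type.

Definition product_lebesgue3 : set R3 -> \bar R :=
  ((lebesgue_measure \x lebesgue_measure) \x lebesgue_measure)%E.

Definition leb3 : {measure set R3 -> \bar R} := product_lebesgue3.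

Definition coordinate (x : R3) (i : 'I_3) : R := [:: x.1.1; x.1.2; x.2]`_i.

Definition unit_vec (i : 'I_3) : R3 :=
  ((i == 0)%:R, (i == 1)%:R, (i == 2)%:R).

Definition dot3 (x y : R3) : R := \sum_(i < 3) coordinate x i * coordinate y i.

Definition enorm n (w : 'rV[R]_n) : R := Num.sqrt (\sum_(i < n) w 0 i ^+ 2).

Definition component n (w : R3 -> 'rV[R]_n) (i : 'I_n) : R3 -> R :=
  fun x => w x 0 i.

End space.
Arguments R3 : clear implicits.

Section derivatives.
Context {R : realType}.

Definition partial {V : normedModType R} (i : 'I_3) (f : R3 R -> V) :
  R3 R -> V := fun x => 'D_(unit_vec i) f x.

Definition partials (s : seq 'I_3) (f : R3 R -> R) : R3 R -> R :=
  foldr partial f s.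

Definition smooth (f : R3 R -> R) : Prop :=
  forall s x, differentiable (partials s f) x.

Definition test_function (phi : R3 R -> R) : Prop :=
  smooth phi /\ exists r : R, forall x, r < `|x| -> phi x = 0.

Definition loc_integrable (f : R3 R -> R) : Prop :=
  measurable_fun setT f /\
  forall r : R, leb3.-integrable [set x | `|x| <= r] (EFin \o f).

Definition is_wderiv (s : seq 'I_3) (f g : R3 R -> R) : Prop :=
  [/\ loc_integrable f, loc_integrable g &
      forall phi, test_function phi ->
        \int[leb3]_x (f x * partials s phi x) =
        (-1) ^+ size s * \int[leb3]_x (g x * phi x)].

(* A representative of the weak derivative (unique almost everywhere);
   the zero function if there is none. *)
Definition wderiv (s : seq 'I_3) (f : R3 R -> R) : R3 R -> R :=
  xget (fun=> 0) [set g | is_wderiv s f g].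

End derivatives.

Section function_spaces.
Context {R : realType}.

Definition mindex (m : nat) : Type := {ffun 'I_3 -> 'I_m.+1}.

Definition mlength m (a : mindex m) : nat := (\sum_(i < 3) a i)%N.

Definition mseq m (a : mindex m) : seq 'I_3 :=
  flatten [seq nseq (a i) i | i <- enum 'I_3].

Definition in_H (m n : nat) (w : R3 R -> 'rV[R]_n) : Prop :=
  forall (i : 'I_n) (a : {ffun 'I_3 -> 'I_m.+1}), (mlength a <= m)%N ->
    exists2 g, is_wderiv (mseq a) (component w i) g & g \in Lfun leb3 2%:E.

Definition Hnorm (m n : nat) (w : R3 R -> 'rV[R]_n) : \bar R :=
  ((\sum_(i < n) \sum_(a : mindex m | (mlength a <= m)%N)
     'N[leb3]_2%:E[EFin \o wderiv (mseq a) (component w i)] `^ 2) `^ 2^-1)%E.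

Definition H_cont (m n : nat) (I : set R) (w : R -> R3 R -> 'rV[R]_n) : Prop :=
  (forall t, I t -> in_H m (w t)) /\
  (forall t, I t ->
     Hnorm m (fun x => w s x - w t x) @[s --> within I (nbhs t)] --> 0%E).

Definition H_C1 (m n : nat) (I : set R) (w : R -> R3 R -> 'rV[R]_n) : Prop :=
  (forall t, I t -> in_H m (w t)) /\
  exists2 w' : R -> R3 R -> 'rV[R]_n, H_cont m I w' &
    forall t, I t ->
      Hnorm m (fun x => (s - t)^-1 *: (w s x - w t x) - w' t x)
        @[s --> within I t^'] --> 0%E.

Definition W1oo_norm n (w : R3 R -> 'rV[R]_n) : \bar R :=
  ('N[leb3]_+oo[(fun x => (enorm (w x))%:E)] +
   \sum_(j < 3) 'N[leb3]_+oo[(fun x =>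
     (enorm (\row_(i < n) wderiv [:: j] (component w i) x))%:E)])%E.

Definition LqW1oo_norm n (q T : R) (w : R -> R3 R -> 'rV[R]_n) : \bar R :=
  ((\int[lebesgue_measure]_(t in `]0%R, T[) (W1oo_norm (w t) `^ q)) `^ q^-1)%E.

End function_spaces.

Section projection.
Context {R : realType}.

Definition cutoff_fourier (r : R) (f : R3 R -> R) (xi : R3 R) : R[i] :=
  Complex
    (\int[leb3]_(x in [set x | `|x| <= r]) (f x * cos (2 * pi * dot3 x xi)))
    (- \int[leb3]_(x in [set x | `|x| <= r]) (f x * sin (2 * pi * dot3 x xi))).

(* [g] is the Fourier transform of the square-integrable function [f], i.e.
   the limit in L^2 of the integrals of [f x * exp(-2 i pi x.xi)] over growing
   cubes. As [b_dir] below is homogeneous of degree 0, the projection does not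
   depend on the normalisation of the transform. *)
Definition is_fourier (f : R3 R -> R) (g : R3 R -> R[i]) : Prop :=
  [/\ f \in Lfun leb3 2%:E,
      measurable_fun setT (fun xi => complex.Re (g xi)),
      measurable_fun setT (fun xi => complex.Im (g xi)) &
      'N[leb3]_2%:E[(fun xi =>
          (complex.Re `|g xi - cutoff_fourier r f xi|)%:E)]%E
        @[r --> +oo] --> 0%E].

Definition herm n (z w : 'rV[R[i]]_n) : R[i] :=
  \sum_(i < n) z 0 i * (w 0 i)^*.

Definition xi_mu (mu : R) (xi : R3 R) : 'rV[R]_(3 + 1) :=
  \row_i [:: - coordinate xi 1; coordinate xi 0; 0; mu * coordinate xi 2]`_i.

Definition b_dir (mu : R) (xi : R3 R) : 'rV[R]_(3 + 1) :=
  (enorm (xi_mu mu xi))^-1 *: xi_mu mu xi.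

Definition is_projection (mu : R) (w Pw : R3 R -> 'rV[R]_(3 + 1)) : Prop :=
  exists g Pg : R3 R -> 'rV[R[i]]_(3 + 1),
    [/\ forall i, is_fourier (component w i) (fun xi => g xi 0 i),
        forall i, is_fourier (component Pw i) (fun xi => Pg xi 0 i) &
        {ae leb3, forall xi,
          let b := map_mx (real_complex R) (b_dir mu xi) in
          Pg xi = herm (g xi) b *: b}].

End projection.

Section equations.
Context {R : realType}.

Definition gradient (f : R3 R -> R) (x : R3 R) : 'rV[R]_3 :=
  \row_i partial i f x.

Definition divergence (w : R3 R -> 'rV[R]_3) (x : R3 R) : R :=
  \sum_(i < 3) partial i (component w i) x.

Definition advect {V : normedModType R} (a : 'rV[R]_3) (f : R3 R -> V)
    (x : R3 R) : V :=
  \sum_(i < 3) a 0 i *: partial i f x.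

Definition e3 : 'rV[R]_3 := delta_mx 0 2.

Definition e3_cross (a : 'rV[R]_3) : 'rV[R]_3 :=
  \row_i [:: - a 0 1; a 0 0; 0]`_i.

(* A state u = (v, theta) is a row vector with 3 + 1 entries. *)
Definition velocity (u : R3 R -> 'rV[R]_(3 + 1)) : R3 R -> 'rV[R]_3 :=
  fun x => lsubmx (u x).

Definition temperature (u : R3 R -> 'rV[R]_(3 + 1)) : R3 R -> R :=
  fun x => rsubmx (u x) 0 0.

Definition wdiv_free (w : R3 R -> 'rV[R]_3) : Prop :=
  {ae leb3, forall x, \sum_(i < 3) wderiv [:: i] (component w i) x = 0}.

Definition boussinesq_eq (Omega N : R) (u : R -> R3 R -> 'rV[R]_(3 + 1))
    (p : R -> R3 R -> R) (t : R) (x : R3 R) : Prop :=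
  let v s := velocity (u s) in
  let theta s := temperature (u s) in
  [/\ derive1 (fun s => v s x) t + advect (v t x) (v t) x =
        - (Omega *: e3_cross (v t x)) - gradient (p t) x + (N * theta t x) *: e3,
      derive1 (fun s => theta s x) t + advect (v t x) (theta t) x =
        - (N * v t x 0 2) &
      divergence (v t) x = 0].

Definition boussinesq_sol (m : nat) (Omega N T : R)
    (u0 : R3 R -> 'rV[R]_(3 + 1)) (u : R -> R3 R -> 'rV[R]_(3 + 1)) : Prop :=
  [/\ H_cont m `[0, T] u,
      H_C1 m.-1 `[0, T] u,
      forall t x, 0 <= t <= T -> differentiable (u t) x,
      {ae leb3, forall x, u 0 x = u0 x} &
      exists p : R -> R3 R -> R, forall t x, 0 < t < T ->
        [/\ derivable (fun s => u s x) t 1,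
            differentiable (p t) x &
            boussinesq_eq Omega N u p t x]].

Definition grad_mu (mu : R) (f : R3 R -> R) (x : R3 R) : 'rV[R]_(3 + 1) :=
  \row_i [:: - partial 1 f x; partial 0 f x; 0; mu * partial 2 f x]`_i.

Definition laplacian_mu (mu : R) (f : R3 R -> R) (x : R3 R) : R :=
  partial 0 (partial 0 f) x + partial 1 (partial 1 f) x +
  mu ^+ 2 * partial 2 (partial 2 f) x.

Definition qg_eq (mu : R) (psi : R -> R3 R -> R) (t : R) (x : R3 R) : Prop :=
  let q s := laplacian_mu mu (psi s) in
  derive1 (fun s => q s x) t +
    (- partial 1 (psi t) x * partial 0 (q t) x +
     partial 0 (psi t) x * partial 1 (q t) x) = 0.

(* [psi] itself is determined up to a function of time only; the solution
   class is the one of [grad_mu mu psi]. *)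
Definition qg_sol (m : nat) (mu : R) (u0 : R3 R -> 'rV[R]_(3 + 1))
    (psi : R -> R3 R -> R) : Prop :=
  [/\ H_cont m `[0, +oo[ (fun t => grad_mu mu (psi t)),
      H_C1 m.-1 `[0, +oo[ (fun t => grad_mu mu (psi t)),
      forall t x, 0 <= t ->
        [/\ differentiable (psi t) x,
            differentiable (grad_mu mu (psi t)) x &
            differentiable (laplacian_mu mu (psi t)) x],
      forall t x, 0 < t ->
        derivable (fun s => laplacian_mu mu (psi s) x) t 1 /\
        qg_eq mu psi t x &
      is_projection mu u0 (grad_mu mu (psi 0))].

Definition convergence_rate (m : nat) (q T M mu R0 C : R) : Prop :=
  forall u0 : R3 R -> 'rV[R]_(3 + 1),
    in_H m u0 -> wdiv_free (velocity u0) -> Hnorm m u0 = M%:E ->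
    exists2 psi, qg_sol m mu u0 psi &
      forall Omega N : R, 0 < Omega -> 0 < N -> Omega / N = mu ->
        R0 < Num.sqrt (Omega ^+ 2 + N ^+ 2) ->
        exists u,
          [/\ boussinesq_sol m Omega N T u0 u,
              forall u', boussinesq_sol m Omega N T u0 u' ->
                forall t, 0 <= t <= T -> {ae leb3, forall x, u' t x = u t x} &
              (LqW1oo_norm q T (fun t x => u t x - grad_mu mu (psi t) x)%R `^ q
                <= (C / Num.sqrt (Omega ^+ 2 + N ^+ 2))%:E)%E].

End equations.

(* Main.v *)
Require Import Defs.
From HB Require Import structures.
From mathcomp Require Import all_boot all_order all_algebra.
From mathcomp Require Import all_classical all_reals all_analysis.
From mathcomp Require Import measurable_realfun ess_sup_inf.
From mathcomp Require Import ring lra.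

Set Implicit Arguments.
Unset Strict Implicit.
Unset Printing Implicit Defensive.

Import Order.TTheory GRing.Theory Num.Theory.
Import numFieldNormedType.Exports.

Local Open Scope classical_set_scope.
Local Open Scope ring_scope.

(* The estimate is tested on one solution per frequency. Let [phi] be a tensor
   bump and let A = (d3 phi, 0, -d1 phi, d2 phi / mu) and
   B = (0, -d3 phi, d2 phi, d1 phi / mu). Both have divergence-free velocity part
   and are L^2-orthogonal to every [grad_mu mu psi]. Write alpha and beta for the
   pairings of the Boussinesq solution u with A and B. When Omega = mu N, the
   equations give
     alpha' = - N beta + N (mu - 1) <u, Y> + Q(u, A),
     beta'  =   N alpha + N (mu - 1) <u, Z> + Q(u, B)
   with Q quadratic and Y, Z again orthogonal to every [grad_mu mu psi]. So
   D(t) = cos(N t) alpha + sin(N t) beta varies at the slow rate N |mu - 1|, whereas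
   |D| <= K n and |D'| <= K (N |mu - 1| n + (n + sup |grad_mu mu psi|)^2), where
   n(t) is the W^{1,oo} distance between u and the quasi-geostrophic flow. The data
   is a multiple of A (for mu = 1), which makes D(0) bounded below by some d > 0.
   Averaging over [0, tau] with tau = 1 / (N |mu - 1|), and bounding the integrals
   of n through the integral of n^q, which is at most C / N, one lets N grow at
   fixed mu and is left with d <= K' C |mu - 1|, where K' is uniform for mu near 1.

   Sobolev bounds on cubes are obtained by duality: point values and increments are
   pairings with mollifiers whose second antiderivatives are under control. Applied
   to u, to its increments and to its time difference quotients, they justify
   differentiating the pairings and bound the pressure gradient, which has to be
   integrated by parts. *)

(** The linearised system carries waves of frequency sqrt(N^2 |xi_H|^2 + Omega^2 xi_3^2) / |xi|. For
    Omega = N this is the constant N: the waves do not disperse, and in the linear flow the part of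
    the data orthogonal to the quasi-geostrophic fields does not decay. For mu near 1 dispersion
    needs a time of order 1 / (N |mu - 1|), which is tau. Until then n is of order one on average,
    so the integral of n^q is at least of order tau; comparison with C / N gives the claim.

    Compactly supported fields replace the Fourier projection because nothing is known about the
    pressure at infinity. Orthogonality of Y and Z to the quasi-geostrophic fields is essential:
    over a time tau the slow term would otherwise contribute an amount of order one, which could not
    be absorbed by d. The threshold on the frequency and the quasi-geostrophic flow may depend on mu
    in any way, so no bound on them is uniform. The threshold is passed by taking N large, and the
    terms involving the flow carry a further factor tau, which tends to 0 as N grows at fixed mu.
    The constants that remain are chosen before mu. *)

Section smooth1.
Context {R : realType}.
Implicit Types (f g : R -> R) (p : {poly R}).

(** * Smooth functions of one real variable, flat functions and a smooth ramp *)

Definition smooth1 f := forall n x, derivable ((derive1n n f)) x 1.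

Lemma smooth1_derivable f x : smooth1 f -> derivable f x 1.
Proof. by move=> /(_ 0%N x). Qed.

Lemma smooth1_continuous f : smooth1 f -> continuous f.
Proof.
by move=> sf x; apply/differentiable_continuous/derivable1_diffP/smooth1_derivable.
Qed.

Lemma smooth1_derive1 f : smooth1 f -> smooth1 (derive1 f).
Proof. by move=> sf n x; rewrite -derive1Sn; exact: sf. Qed.

Lemma smooth1_derive1n f n : smooth1 f -> smooth1 (derive1n n f).
Proof.
by move=> sf; elim: n => [//|n IH]; rewrite derive1nS; exact: smooth1_derive1.
Qed.

Lemma smooth1_primitive f g : (forall x : R, is_derive x 1 f (g x)) ->
  smooth1 g -> smooth1 f.
Proof.
move=> fg sg [|n] x; first by have [] := fg x.
rewrite derive1Sn (_ : (derive1 f) = g); first exact: sg.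
by apply/funext => y; rewrite derive1E derive_val.
Qed.

Lemma derive1n_zero n : (derive1n n (fun=> 0 : R)) = fun=> 0.
Proof.
elim: n => [//|n IH]; rewrite derive1nS IH; apply/funext => x.
by rewrite derive1E derive_val.
Qed.

Lemma smooth1_cst (c : R) : smooth1 (fun=> c).
Proof.
apply: (@smooth1_primitive _ (fun=> 0)) => n x.
by rewrite derive1n_zero; exact: ex_derive.
Qed.

Lemma derive1nD f g n : smooth1 f -> smooth1 g ->
  (derive1n n (f \+ g)) = (derive1n n f) \+ (derive1n n g).
Proof.
move=> sf sg; elim: n => [//|n IH]; rewrite !derive1nS IH; apply/funext => x.
rewrite !derive1E/= [LHS](@deriveD _ _ _ (derive1n n f) (derive1n n g)) ?derive1E//.
Qed.

Lemma smooth1D f g : smooth1 f -> smooth1 g -> smooth1 (f \+ g).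
Proof. by move=> sf sg n x; rewrite derive1nD//; exact: derivableD. Qed.

Lemma derive1_mul f g : smooth1 f -> smooth1 g ->
  (derive1 (f \* g)) = ((derive1 f) \* g) \+ (f \* (derive1 g)).
Proof.
move=> sf sg; apply/funext => x.
rewrite !derive1E/= deriveM; [|exact: smooth1_derivable..].
by rewrite /GRing.scale/= !derive1E addrC mulrC.
Qed.

(** The derivative of a product is a sum of two products of smooth functions, so an induction on the
    order, over all pairs of factors at once, replaces Leibniz's formula. *)
Lemma derive1n_mul_derivable n f g : smooth1 f -> smooth1 g ->
  (forall m (x : R), (m <= n)%N -> derivable (derive1n m (f \* g)) x 1).
Proof.
elim: n f g => [|n IH] f g sf sg m x mn.
  by move: mn; rewrite leqn0 => /eqP ->; apply: derivableM; exact: smooth1_derivable.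
case: m mn => [_|m mn]; first by apply: derivableM; exact: smooth1_derivable.
rewrite derive1Sn derive1_mul//.
(* Smoothness of the two products is not yet available, so additivity of iterated derivatives is
   proved from derivability up to order [n] only. *)
have DD (h k : R -> R) j : (forall i (y : R), (i <= n)%N -> derivable (derive1n i h) y 1) ->
    (forall i (y : R), (i <= n)%N -> derivable (derive1n i k) y 1) -> (j <= n.+1)%N ->
    (derive1n j (h \+ k)) = (derive1n j h) \+ (derive1n j k).
  move=> dh dk; elim: j => [//|j IHj] jn; rewrite !derive1nS IHj ?(ltnW jn)//.
  apply/funext => y; rewrite !derive1E/= [LHS](@deriveD _ _ _ (derive1n j h) (derive1n j k)) ?derive1E//.
  + exact: dh.
  + exact: dk.
have dfg i (y : R) : (i <= n)%N -> derivable (derive1n i (derive1 f \* g)) y 1.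
  by apply: IH => //; exact: smooth1_derive1.
have dgf i (y : R) : (i <= n)%N -> derivable (derive1n i (f \* derive1 g)) y 1.
  by apply: IH => //; exact: smooth1_derive1.
rewrite DD//; last exact: leqW.
by apply: derivableD; [exact: dfg|exact: dgf].
Qed.

Lemma smooth1M f g : smooth1 f -> smooth1 g -> smooth1 (f \* g).
Proof. by move=> sf sg n x; exact: (@derive1n_mul_derivable n). Qed.

Lemma smooth1Z (c : R) f : smooth1 f -> smooth1 (fun x => c * f x).
Proof. by move=> sf; apply: (@smooth1M (fun=> c)) => //; exact: smooth1_cst. Qed.

Lemma derive1_affine f (c d x : R) : derivable f (c * x + d) 1 ->
  is_derive x 1 (fun y => f (c * y + d)) (c * (derive1 f) (c * x + d)).
Proof.
move=> df; rewrite mulrC derive1E.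
apply: (@is_derive1_comp _ f (fun y : R => c * y + d)); first exact: derivableP.
have : is_derive x 1 (c *: id + cst d : R -> R) (c *: 1 + 0) by exact: is_deriveD.
by rewrite addr0 /GRing.scale/= mulr1.
Qed.

Lemma derive1n_affine f (c d : R) n : smooth1 f ->
  (derive1n n (fun y => f (c * y + d))) = (fun y => c ^+ n * (derive1n n f) (c * y + d)).
Proof.
move=> sf; elim: n => [|n IH]; first by apply/funext => x; rewrite mul1r.
rewrite derive1nS IH; apply/funext => x.
rewrite derive1E exprSr -mulrA.
have := derive1_affine (sf n (c * x + d)) => ?.
rewrite (_ : (fun y => _) = c ^+ n \*: (fun y => (derive1n n f) (c * y + d)))//.
by rewrite deriveZ// /GRing.scale/= derive_val -derive1nS.
Qed.

Lemma smooth1_affine f (c d : R) : smooth1 f -> smooth1 (fun y => f (c * y + d)).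
Proof.
move=> sf n x; rewrite derive1n_affine//.
have := derive1_affine (sf n (c * x + d)) => ?.
exact: (@derivableZ _ _ _ (fun y => (derive1n n f) (c * y + d)) (c ^+ n)).
Qed.

(** The polynomial factor makes the functions p(1/t) exp(-1/t) a family closed under
    differentiation: [p] is replaced by X^2 (p - p'). Smoothness is then an iteration on [p]. *)
Definition flat p (t : R) : R :=
  if 0 < t then p.[t^-1] * expR (- t^-1) else 0.

Lemma poly_expR_bounded p : exists2 C, 0 < C &
  forall y, 0 <= y -> `|p.[y] * expR (- y)| <= C.
Proof.
have mono n : exists2 C, 0 < C & forall y : R, 0 <= y -> y ^+ n * expR (- y) <= C.
  exists (n.+1`!%:R + 1) => [|y y0]; first by rewrite ltr_wpDl.
  rewrite expRN ler_pdivrMr ?expR_gt0//.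
  case: n => [|n].
    by rewrite expr0; have := expR_ge1Dx y; have : (0:R) <= 1`!%:R by []; nra.
  have := expR_ge1Dxn n y0; set F := (n.+1)`!%:R => H.
  have F0 : 0 < F :> R by rewrite ltr0n fact_gt0.
  have FF : F <= (n.+2)`!%:R + 1 :> R.
    by rewrite -[F]addr0 lerD// ler_nat (factS n.+1) leq_pmull.
  apply: (@le_trans _ _ (F * expR y)); last by rewrite ler_wpM2r// expR_ge0.
  by rewrite mulrC -ler_pdivrMr//; lra.
have /choice[M HM] n : exists C, 0 < C /\ forall y : R, 0 <= y -> y ^+ n * expR (- y) <= C.
  by have [C0 ? ?] := mono n; exists C0.
exists (\sum_(i < size p) `|p`_i| * M i + 1).
  rewrite ltr_wpDl// sumr_ge0// => i _.
  by rewrite mulr_ge0// ltW//; case: (HM i).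
move=> y y0; rewrite horner_coef mulr_suml.
apply: (le_trans (ler_norm_sum _ _ _)).
rewrite -[leLHS]addr0 lerD// ler_sum// => i _.
rewrite -mulrA normrM ler_wpM2l// ger0_norm; first by apply (HM i).2.
by rewrite mulr_ge0 ?exprn_ge0// expR_ge0.
Qed.

Lemma flat_le p : exists2 C, 0 < C & forall t, `|flat p t| <= C * `|t|.
Proof.
have [C C0 HC] := poly_expR_bounded (p * 'X); exists C => // t.
rewrite /flat; case: ifPn => t0; last by rewrite normr0 mulr_ge0// ltW.
have := HC t^-1; rewrite invr_ge0 (ltW t0) => /(_ isT).
rewrite hornerM hornerX mulrAC normrM => H.
rewrite -ler_pdivrMr ?normr_gt0 ?gt_eqF//.
by rewrite -normfV.
Qed.

Lemma flat_derive p (t : R) : is_derive t 1 (flat p) (flat ('X^2 * (p - p^`())) t).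
Proof.
have [t0|t0|->] := ltgtP t 0.
- rewrite /flat (lt_gtF t0); apply: (@near_eq_is_derive _ _ _ (cst 0)); rewrite ?oner_neq0//.
  near=> s; rewrite ltNge (_ : s <= 0)//.
  by near: s; apply: filterS (lt_nbhsl t0) => x /= /ltW.
- apply: (@near_eq_is_derive _ _ _ ((fun t => p.[t^-1] * expR (- t^-1)) : R -> R)).
    by near=> s; rewrite /flat ifT//; near: s; exact: lt_nbhsr t0.
  rewrite /flat t0.
  have tn0 : t != 0 by rewrite gt_eqF.
  have dV : is_derive t 1 (fun s : R => s^-1) (- t ^- 2).
    have := @is_deriveV R id t 1 1 tn0 _; rewrite /GRing.scale/= mulr1.
    by apply; exact: is_derive_id.
  have d1 := @is_derive1_comp _ (horner p) (fun s : R => s^-1) t _ _ (is_derive_poly p _) dV.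
  have dN : is_derive t 1 (fun s : R => - s^-1) (t ^- 2).
    by have := @is_deriveN R R R (fun s : R => s^-1) t 1 _ dV; rewrite opprK.
  have d2 := @is_derive1_comp _ expR (fun s : R => - s^-1) t _ _ (is_derive_expR _) dN.
  have := @is_deriveM R R _ _ t 1 _ _ d1 d2; rewrite /GRing.scale/= => H.
  apply: is_derive_eq; rewrite !hornerE/= exprVn.
  ring.
- have -> : flat ('X^2 * (p - p^`())) 0 = 0 by rewrite /flat ltxx.
  (* At 0 the slope of [flat p] is itself a flat function, as dividing by t multiplies the
     polynomial by X; [flat_le] gives its continuity there. *)
  apply/is_derive1_caratheodory; exists (flat ('X * p)); split.
  + move=> z; rewrite {2}/flat ltxx !subr0 /flat; case: ifPn => z0; last by rewrite mul0r.
    by rewrite hornerM hornerX [RHS]mulrC !mulrA mulfV ?mul1r// gt_eqF.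
  + have [C C0 HC] := flat_le ('X * p).
    apply/cvgrPdist_le => e e0; near=> z.
    rewrite {1}/flat ltxx sub0r normrN (le_trans (HC z))// mulrC -ler_pdivlMr//.
    near: z; exists (e / C); first exact: divr_gt0.
    by move=> z /=; rewrite sub0r normrN => /ltW.
  + by rewrite /flat ltxx.
Unshelve. all: by end_near. Qed.

Lemma flat_smooth p : smooth1 (flat p).
Proof.
move=> n t; have -> : derive1n n (flat p) = flat (iter n (fun q => 'X^2 * (q - q^`())) p).
  elim: n => [//|n IH]; rewrite derive1nS IH; apply/funext => s.
  by have ? := flat_derive (iter n (fun q => 'X^2 * (q - q^`())) p) s; rewrite derive1E derive_val.
by have [] := flat_derive (iter n (fun q => 'X^2 * (q - q^`())) p) t.
Qed.

(** Integrating from -oo fixes the constant of integration, so the primitive vanishes to the left of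
    [a]. On []-oo, u]] the integrand lives in [[a, u]], whence integrability. *)
Lemma primitive_ge a f : continuous f -> (forall x, x <= a -> f x = 0) ->
  exists F : R -> R, (forall x : R, is_derive x 1 F (f x)) /\ (forall x, x <= a -> F x = 0).
Proof.
move=> cf f0.
have int u : lebesgue_measure.-integrable [set` `]-oo, u]] (EFin \o f).
  have [ua|au] := leP u a.
    apply: (eq_integrable _ (EFin \o cst 0)) => //.
      by move=> x; rewrite inE/= in_itv/= => xu; rewrite f0// (le_trans xu).
    exact: integrable0.
  have : lebesgue_measure.-integrable [set` `[a, u]] (EFin \o f).
    apply: continuous_compact_integrable; first exact: segment_compact.
    exact: continuous_subspaceT.
  move=> /integrable_mkcond -/(_ (measurable_itv _)) H.
  have := @integrableS _ (measurableTypeR R) R lebesgue_measure setT [set` `]-oo, u]] _ measurableT (measurable_itv _) (@subsetT _ _) H.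
  apply: eq_integrable => // x; rewrite inE/= in_itv/= => xu.
  rewrite patchE mem_setE in_itv/= xu andbT.
  by case: leP => // xa; rewrite f0// ltW.
exists (fun x => \int[lebesgue_measure]_(t in [set` `]-oo, x]]) f t); split.
  move=> x; have xx : x < x + 1 by rewrite ltrDl.
  have FT := continuous_FTC1 xx (int _).
  case: FT; [by rewrite ?ltNyr ?ltNye|exact: cf|move=> d1 d2].
  by apply: (DeriveDef d1); rewrite -derive1E.
move=> x xa; rewrite /Rintegral (_ : (\int[_]_(t in _) _)%E = 0%E)//.
by apply: integral0_eq => t; rewrite /= in_itv/= => tx; rewrite f0// (le_trans tx).
Qed.

(** A bump supported in [-1, 1], normalised and integrated twice, gives a smooth convex ramp. Each
    level has its use: K' is the step behind cutoffs and approximate indicators, rescalings of K''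
    are the mollifiers, and K, being 1-Lipschitz, compares mollifiers with different centres. *)
Lemma smooth_step : exists K : R -> R, [/\ smooth1 K,
  forall x, x <= - 1 -> K x = 0 /\ derive1 K x = 0,
  forall x, 0 <= derive1 K x <= 1,
  forall x, 1 <= x -> derive1 K x = 1 &
  forall x, 0 <= derive1n 2 K x].
Proof.
pose b := (fun x : R => flat 1 (1 * x + 1)) \* (fun x : R => flat 1 (-1 * x + 1)).
have fge0 x : 0 <= flat 1 x.
  by rewrite /flat; case: ifPn => // _; rewrite hornerC mul1r expR_ge0.
have b_ge0 x : 0 <= b x by rewrite /b/= mulr_ge0.
have bs : smooth1 b by apply: smooth1M; apply: (@smooth1_affine (flat 1)); exact: flat_smooth.
have bN x : x <= -1 -> b x = 0.
  by move=> x1; rewrite /b/= {1}/flat ifF ?mul0r//; apply/negbTE; rewrite -leNgt; lra.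
have bP x : 1 <= x -> b x = 0.
  by move=> x1; rewrite /b/= {2}/flat ifF ?mulr0//; apply/negbTE; rewrite -leNgt; lra.
have b0 : 0 < b 0.
  by rewrite /b/= /flat mulr0 add0r mulr0 add0r ltr01 hornerC mul1r mulr_gt0// expR_gt0.
have [S [dS S0]] := primitive_ge (smooth1_continuous bs) bN.
have Scont : continuous S by move=> x; apply/differentiable_continuous/derivable1_diffP; have [] := dS x.
have Smon x y : x <= y -> S x <= S y.
  move=> xy; apply: (@ger0_derive1_le_cc _ S x y) => //; rewrite ?in_itv/= ?lexx ?xy//.
  - by move=> z _; rewrite derive1E derive_val.
  - exact: continuous_subspaceT.
have Sc x : 1 <= x -> S x = S 1.
  move=> x1; apply/eqP; rewrite eq_le [X in _ && X]Smon// andbT.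
  apply: (@ler0_derive1_le_cc _ S 1 x) => //; rewrite ?in_itv/= ?lexx ?x1//.
  - by move=> z; rewrite in_itv/= => /andP[z1 _]; rewrite derive1E derive_val bP// ltW.
  - exact: continuous_subspaceT.
have S1 : 0 < S 1.
  rewrite lt_neqAle -{2}(S0 (-1)) ?lexx// Smon ?andbT; last lra.
  apply/eqP => S10.
  have Sz x : -1 <= x <= 1 -> S x = 0.
    by move=> /andP[x1 x2]; apply/eqP; rewrite eq_le {1}S10 Smon//= -(S0 (-1)) ?lexx// Smon.
  move: b0; have -> : b 0 = 0; last by rewrite ltxx.
  have := dS 0 => d0; rewrite -[b 0](@derive_val _ _ _ _ _ _ _ d0).
  rewrite (near_eq_derive (g := cst 0)) ?derive_cst//.
  near=> z; apply: Sz.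
  rewrite -ler_norml; near: z; exists 1 => //= z.
  by rewrite /= sub0r normrN => /ltW.
pose s x := (S 1)^-1 * S x.
have ss : smooth1 s.
  by apply: smooth1Z; exact: smooth1_primitive dS bs.
have s0 (x : R) : x <= -1 -> s x = 0 by move=> x1; rewrite /s (S0 _ x1) mulr0.
have [K [dK K0]] := primitive_ge (smooth1_continuous ss) s0.
have K' : derive1 K = s by apply/funext => x; rewrite derive1E derive_val.
have K2 : derive1n 2 K = derive1 s by rewrite derive1nS derive1n1 K'.
exists K; split.
- exact: smooth1_primitive dK ss.
- by move=> x x1; rewrite K' K0// s0.
- move=> x; rewrite K' mulr_ge0 ?invr_ge0 ?(ltW S1)//=; last first.
    have [xN|xN] := leP x (-1); first by rewrite S0.
    by rewrite -(S0 (-1)) ?lexx// Smon// ltW.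
  rewrite /s mulrC ler_pdivrMr// mul1r.
  by have [x1|x1] := leP x 1; [exact: Smon|rewrite Sc// ltW].
- by move=> x x1; rewrite K' /s Sc// mulVf// gt_eqF.
- move=> x; rewrite K2 derive1E (@deriveZ _ _ _ S (S 1)^-1); last by have [] := dS x.
  have := dS x => ?; rewrite derive_val.
  by rewrite /GRing.scale/= mulr_ge0// invr_ge0 ltW.
Unshelve. all: by end_near. Qed.

End smooth1.

(** * Lebesgue measure on [R3]: Borel measurability and translation invariance *)

Section measure_R3.
Context {R : realType}.

(** The sigma-algebra of [R3] is the product one, defined without the topology. An open set belongs
    to it as the countable union of the cubes with rational centre and radius 1/(n+1) that it
    contains. *)
Lemma continuous_measurable_R3 (f : R3 R -> R) : continuous f -> measurable_fun setT f.
Proof.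
move=> cf; apply: (measurability _ (RGenOInfty.measurableE R)).
move=> _ [_ [a ->] <-]; rewrite setTI.
have : open (f @^-1` `]a, +oo[).
  by apply: open_comp; [move=> x _; exact: cf|exact: interval_open].
move: (f @^-1` _) => U oU.
pose cube (a b c : rat) (n : nat) : set (R3 R) :=
  [set x | [/\ `|x.1.1 - ratr a| < n.+1%:R^-1, `|x.1.2 - ratr b| < n.+1%:R^-1
             & `|x.2 - ratr c| < n.+1%:R^-1]].
have mcube a1 a2 a3 n : measurable (cube a1 a2 a3 n).
  have -> : cube a1 a2 a3 n = ([set x | `|x - ratr a1| < n.+1%:R^-1] `*` [set x | `|x - ratr a2| < n.+1%:R^-1])
     `*` [set x | `|x - ratr a3| < n.+1%:R^-1].
    by apply/seteqP; split => [x []//|x [[]]].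
  have mi (q : R) : measurable ([set x | `|x - q| < n.+1%:R^-1] : set (measurableTypeR R)).
    rewrite (_ : [set _ | _] = [set` `]q - n.+1%:R^-1, q + n.+1%:R^-1[]) //.
    by apply/seteqP; split => x; rewrite /= in_itv/= ltr_distl.
  by apply: measurableX => //; exact: measurableX.
rewrite (_ : U = \bigcup_a \bigcup_b \bigcup_c \bigcup_n
    (if `[< cube a b c n `<=` U >] then cube a b c n else set0)); last first.
  apply/seteqP; split => [x Ux|x [q _ [b _ [c _ [n _]]]]]; last first.
    by case: asboolP => // + cx; exact.
  have /nbhs_ballP[e /= e0 eU] : nbhs x U by move: oU; rewrite openE; exact.
  have [n ne] : exists n, n.+1%:R^-1 < e / 2.
    have e20 : 0 < e / 2 by rewrite divr_gt0.
    near \oo => n; exists n; near: n; exact: near_infty_natSinv_lt (PosNum e20).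
  have n0 : 0 < n.+1%:R^-1 :> R by rewrite invr_gt0.
  have app (t : R) : exists q : rat, `|t - ratr q| < n.+1%:R^-1.
    have /rat_in_itvoo[q] : t - n.+1%:R^-1 < t + n.+1%:R^-1 by rewrite ltrD2l gtrN.
    by rewrite in_itv/= => tq; exists q; rewrite distrC ltr_distl.
  have [a1 ha1] := app x.1.1; have [a2 ha2] := app x.1.2; have [a3 ha3] := app x.2.
  exists a1 => //; exists a2 => //; exists a3 => //; exists n => //.
  case: asboolP => // -[] y [y1 y2 y3]; apply: eU.
  have tri (s t q : R) : `|s - q| < n.+1%:R^-1 -> `|t - q| < n.+1%:R^-1 -> `|s - t| < e.
    move=> h1 h2; rewrite (_ : s - t = (s - q) - (t - q)); last by ring.
    by rewrite (le_lt_trans (ler_normB _ _))// (splitr e) ltrD ?(lt_trans h1)// (lt_trans h2).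
  split; last exact: tri ha3 y3.
  by split; [exact: tri ha1 y1|exact: tri ha2 y2].
do 3 (apply: bigcupT_measurable_rat => ?).
by apply: bigcupT_measurable => n; case: asboolP.
Unshelve. all: by end_near. Qed.

Lemma lebesgue_measure_shift (c : R) (A : set (measurableTypeR R)) : measurable A ->
  lebesgue_measure ((fun x => x + c) @^-1` A) = lebesgue_measure A :> \bar R.
Proof.
move=> mA; pose phi (x : measurableTypeR R) : measurableTypeR R := x + c.
have mphi : measurable_fun setT phi by apply: measurable_funD.
apply/esym.
apply: (@lebesgue_measure_unique _ (measure_function_pushforward__canonical__measure_function_Measure lebesgue_measure mphi)) => //.
move=> _ [[a b] _ <-] /=; rewrite /pushforward.
have -> : phi @^-1` `]a, b] = `]a - c, b - c]%classic.
  by apply/seteqP; split => x; rewrite /phi/= !in_itv/= ltrBlDr lerBrDr.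
rewrite !lebesgue_measure_itv/= !lte_fin ltrD2r -!EFinB.
by case: ifP => // _; congr EFin; ring.
Qed.

Section product.
Context d1 d2 (T1 : measurableType d1) (T2 : measurableType d2).
Context (m1 : {sigma_finite_measure set T1 -> \bar R})
  (m2 : {sigma_finite_measure set T2 -> \bar R}).
Context (phi1 : T1 -> T1) (phi2 : T2 -> T2).
Context (mphi1 : measurable_fun setT phi1) (mphi2 : measurable_fun setT phi2).
Context (pres1 : forall A, measurable A -> m1 (phi1 @^-1` A) = m1 A).
Context (pres2 : forall A, measurable A -> m2 (phi2 @^-1` A) = m2 A).

Lemma measurable_product_map : measurable_fun setT (fun p : T1 * T2 => (phi1 p.1, phi2 p.2)).
Proof.
by apply: measurable_fun_pair; apply: measurableT_comp.
Qed.

Lemma product_measure_preserving A : measurable A ->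
  (m1 \x m2)%E ((fun p => (phi1 p.1, phi2 p.2)) @^-1` A) = (m1 \x m2)%E A.
Proof.
move=> mA; apply/esym.
apply: (@product_measure_unique _ _ _ _ _ m1 m2 (measure_function_pushforward__canonical__measure_function_Measure (m1 \x m2)%E measurable_product_map)) => //.
move=> B C mB mC; rewrite /= /pushforward.
rewrite (_ : _ @^-1` _ = (phi1 @^-1` B) `*` (phi2 @^-1` C)); last first.
  by apply/seteqP; split => x [].
have mp1 := mphi1 measurableT mB; have mp2 := mphi2 measurableT mC.
rewrite !setTI in mp1 mp2.
by rewrite product_measure1E// -(pres1 mB) -(pres2 mC).
Qed.

End product.

Lemma normR3 (x : R3 R) : `|x| = Num.max (Num.max `|x.1.1| `|x.1.2|) `|x.2|.
Proof. by []. Qed.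

Lemma normR3_le (x : R3 R) r : (`|x| <= r) = [&& `|x.1.1| <= r, `|x.1.2| <= r & `|x.2| <= r].
Proof. by rewrite normR3 !ge_max andbA. Qed.

Lemma cubeE (r : R) : [set x : R3 R | `|x| <= r] =
  ([set x | `|x| <= r] `*` [set x | `|x| <= r]) `*` [set x | `|x| <= r].
Proof.
apply/seteqP; split => x /=; rewrite normR3_le; first by case/and3P.
by move=> [[-> ->] ->].
Qed.

Lemma measurable_cube (r : R) : measurable [set x : R3 R | `|x| <= r].
Proof.
have mi : measurable ([set x | `|x| <= r] : set (measurableTypeR R)).
  rewrite (_ : [set _ | _] = [set` `[-r, r]]) //.
  by apply/seteqP; split => x; rewrite /= in_itv/= ler_norml.
rewrite (_ : [set _ | _] = ([set x | `|x| <= r] `*` [set x | `|x| <= r]) `*` [set x | `|x| <= r]).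
  by apply: measurableX => //; exact: measurableX.
apply/seteqP; split => x /=; rewrite normR3_le; first by case/and3P.
by move=> [[-> ->] ->].
Qed.

Lemma leb3_cube_lty (r : R) : (leb3 [set x : R3 R | (`|x| <= r)%R] < +oo)%E.
Proof.
have mi : measurable ([set x | `|x| <= r] : set (measurableTypeR R)).
  rewrite (_ : [set _ | _] = [set` `[-r, r]]) //.
  by apply/seteqP; split => x; rewrite /= in_itv/= ler_norml.
have li : (lebesgue_measure ([set x | (`|x| <= r)%R] : set (measurableTypeR R)) < +oo)%E.
  rewrite (_ : [set _ | _] = [set` `[-r, r]]).
    by rewrite lebesgue_measure_itv/=; case: ifPn; rewrite ?ltry.
  by apply/seteqP; split => x; rewrite /= in_itv/= ler_norml.
rewrite (_ : [set _ | _] = ([set x | `|x| <= r] `*` [set x | `|x| <= r]) `*` [set x | `|x| <= r]).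
  have li2 : ((lebesgue_measure \x lebesgue_measure)%E ([set x | (`|x| <= r)%R] `*` [set x | (`|x| <= r)%R] :
      set (measurableTypeR R * measurableTypeR R)) < +oo)%E.
    by rewrite product_measure1E// lte_mul_pinfty// ge0_fin_numE.
  rewrite /leb3/= /product_lebesgue3 product_measure1E//; last exact: measurableX.
  by rewrite lte_mul_pinfty// ge0_fin_numE.
apply/seteqP; split => x /=; rewrite normR3_le; first by case/and3P.
by move=> [[-> ->] ->].
Qed.

(** The measure and its translate agree on measurable rectangles, a generating family stable under
    intersection that contains an exhausting sequence of cubes of finite measure. *)
Lemma leb3_shift (h : R3 R) (A : set (R3 R)) : measurable A ->
  leb3 ((fun x => x + h) @^-1` A) = leb3 A.
Proof.
move=> mA.
have m1 (c : R) : measurable_fun setT ((fun x => x + c) : measurableTypeR R -> measurableTypeR R).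
  by apply: measurable_funD.
have mi n : measurable ([set x | `|x| <= n%:R] : set (measurableTypeR R)).
  rewrite (_ : [set _ | _] = [set` `[-n%:R, n%:R]]) //.
  by apply/seteqP; split => x; rewrite /= in_itv/= ler_norml.
have mphi : measurable_fun setT ((fun x => x + h) : R3 R -> R3 R).
  exact: (measurable_product_map (measurable_product_map (m1 h.1.1) (m1 h.1.2)) (m1 h.2)).
have pres12 (B : set (measurableTypeR R * measurableTypeR R)) : measurable B ->
    (lebesgue_measure \x lebesgue_measure)%E
      ((fun p : measurableTypeR R * measurableTypeR R =>
        ((p.1 + h.1.1 : measurableTypeR R), (p.2 + h.1.2 : measurableTypeR R))) @^-1` B) =
    (lebesgue_measure \x lebesgue_measure)%E B :> \bar R.
  move=> mB.
  exact: (product_measure_preserving (m1 _) (m1 _) (@lebesgue_measure_shift _) (@lebesgue_measure_shift _) mB).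
apply/esym.
apply: (measure_unique [set A `*` B | A in measurable & B in measurable]
  (fun n => [set x : R3 R | `|x| <= n%:R]) _ _ _ _ leb3
  (measure_function_pushforward__canonical__measure_function_Measure leb3 mphi)) => //.
- exact: measurable_prod_measurableType.
- move=> _ _ [A1 mA1 [A2 mA2 <-]] [B1 mB1 [B2 mB2 <-]].
  by rewrite -setXI; exists (A1 `&` B1); [exact: measurableI|exists (A2 `&` B2) => //; exact: measurableI].
- move=> n; rewrite cubeE; exists ([set x | `|x| <= n%:R] `*` [set x | `|x| <= n%:R]); first exact: measurableX.
  by exists [set x | `|x| <= n%:R].
- apply/seteqP; split => // x _; exists (Num.bound `|x|) => //=.
  by rewrite ltW// archi_boundP.
- move=> _ [B mB [C mC <-]]; rewrite /= /pushforward.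
  have mB' : measurable ((fun p : measurableTypeR R * measurableTypeR R =>
        ((p.1 + h.1.1 : measurableTypeR R), (p.2 + h.1.2 : measurableTypeR R))) @^-1` B).
    by have := measurable_product_map (m1 h.1.1) (m1 h.1.2) measurableT mB; rewrite setTI.
  have mC' : measurable ((fun x : measurableTypeR R => (x + h.2 : measurableTypeR R)) @^-1` C).
    by have := m1 h.2 measurableT _ mC; rewrite setTI.
  transitivity (product_lebesgue3 (((fun p : measurableTypeR R * measurableTypeR R =>
        ((p.1 + h.1.1 : measurableTypeR R), (p.2 + h.1.2 : measurableTypeR R))) @^-1` B) `*`
     ((fun x : measurableTypeR R => (x + h.2 : measurableTypeR R)) @^-1` C))).
    rewrite /product_lebesgue3 !product_measure1E//.
    congr (_ * _)%E; first exact: (esym (pres12 _ mB)).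
    exact: (esym (@lebesgue_measure_shift h.2 _ mC)).
  by congr product_lebesgue3; apply/seteqP; split => -[[? ?] ?] [].
- by move=> n; exact: leb3_cube_lty.
Qed.

Lemma integral_shift (h : R3 R) (f : R3 R -> \bar R) :
  leb3.-integrable setT f -> (\int[leb3]_x f (x + h)%R = \int[leb3]_x f x)%E.
Proof.
move=> intf.
have m1 (c : R) : measurable_fun setT ((fun x => x + c) : measurableTypeR R -> measurableTypeR R).
  by apply: measurable_funD.
have mphi : measurable_fun setT ((fun x => x + h) : R3 R -> R3 R).
  exact: (measurable_product_map (measurable_product_map (m1 h.1.1) (m1 h.1.2)) (m1 h.2)).
pose phi' (x : R3 R) : R3 R := x + h.
have mf := measurable_int _ intf.
have intfh : leb3.-integrable setT (f \o phi').
  apply/integrableP; split; first exact: measurableT_comp.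
  rewrite -(@ge0_integral_pushforward _ _ _ _ _ _ mphi leb3 setT (fun x => `|f x|%E))//; last exact: measurableT_comp.
  rewrite (@eq_measure_integral _ _ _ setT leb3 (measure_function_pushforward__canonical__measure_function_Measure leb3 mphi)); first by case/integrableP: intf.
  by move=> A mA _; rewrite /pushforward; exact: leb3_shift.
transitivity (\int[pushforward leb3 phi']_y f y)%E.
  by symmetry; exact: (integral_pushforward mphi mf intfh measurableT).
apply: (@eq_measure_integral _ _ _ setT leb3 (measure_function_pushforward__canonical__measure_function_Measure leb3 mphi)) => A mA _.
exact: leb3_shift.
Qed.

End measure_R3.

(** * The fundamental lemma of the calculus of variations, tested on tensor products *)

Section vanishing_integrals.
Context {R : realType}.

(** The sets [A] with vanishing integral form a Dynkin system. Here [phi] is the coordinate being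
    treated and [E] carries the constraints on the others. *)
Lemma vanish_generated d1 d2 (T : measurableType d1) (U : measurableType d2)
    (mu : {measure set T -> \bar R}) (g : T -> R) (phi : T -> U) (E : set T)
    (G : set (set U)) :
  measurable_fun setT phi -> measurable E -> mu.-integrable setT (EFin \o g) ->
  @measurable _ U = <<s G >> -> setI_closed G ->
  (\int[mu]_(x in E) (g x)%:E = 0)%E ->
  (forall A, G A -> (\int[mu]_(x in (phi @^-1` A) `&` E) (g x)%:E = 0)%E) ->
  forall A, measurable A -> (\int[mu]_(x in (phi @^-1` A) `&` E) (g x)%:E = 0)%E.
Proof.
move=> mphi mE ig GE GI E0 G0 A mA.
have mpre B : measurable B -> measurable (phi @^-1` B `&` E).
  by move=> mB; apply: measurableI => //; rewrite -[X in measurable X]setTI; exact: mphi.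
have igE B : measurable B -> mu.-integrable (phi @^-1` B `&` E) (EFin \o g).
  by move=> mB; apply: (integrableS measurableT) => //; exact: mpre.
apply: (dynkin_induction (P := fun A => (\int[mu]_(x in (phi @^-1` A) `&` E) (g x)%:E = 0)%E) GE GI) => //.
- by rewrite preimage_setT setTI.
- move=> S mS S0.
  have mCS : measurable (~` S) by exact: measurableC.
  have EE : E = (phi @^-1` S `&` E) `|` (phi @^-1` (~` S) `&` E).
    by rewrite -setIUl -preimage_setU setUv preimage_setT setTI.
  move: E0; rewrite {1}EE integral_setU_EFin; last 4 first.
  - exact: mpre.
  - exact: mpre.
  - by rewrite -EE; apply: measurable_funTS; case/integrableP: ig => /measurable_EFinP.
  - apply/disj_setPS => x [[/= ? _] [/= ? _]] //.
  by rewrite S0 add0e.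
- move=> F mF tF F0.
  rewrite preimage_bigcup setI_bigcupl integral_bigcup.
  + by apply: eseries0 => i _ _; exact: F0.
  + apply/trivIsetP => i j _ _ ij; rewrite setIACA -preimage_setI.
    by move/trivIsetP : tF => /(_ _ _ _ _ ij) ->//; rewrite preimage_set0 set0I.
  + by move=> k; exact: mpre.
  + by rewrite -setI_bigcupl -preimage_bigcup; apply: igE; exact: bigcupT_measurable.
- by rewrite -GE.
Qed.

(** The half-open intervals do not contain the whole line, so the vanishing over [E] itself is read
    off from one generator [U0] outside which [g] is zero. *)
Lemma vanish_generated_proj d1 d2 (T : measurableType d1) (U : measurableType d2)
    (mu : {measure set T -> \bar R}) (g : T -> R) (phi : T -> U) (E : set T)
    (G : set (set U)) (U0 : set U) :
  measurable_fun setT phi -> measurable E -> mu.-integrable setT (EFin \o g) ->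
  @measurable _ U = <<s G >> -> setI_closed G ->
  G U0 -> (forall x, ~ U0 (phi x) -> g x = 0) ->
  (forall A, G A -> (\int[mu]_(x in (phi @^-1` A) `&` E) (g x)%:E = 0)%E) ->
  forall A, measurable A -> (\int[mu]_(x in (phi @^-1` A) `&` E) (g x)%:E = 0)%E.
Proof.
move=> mphi mE ig GE GI GU gU G0; apply: (vanish_generated mphi mE ig GE GI _ G0).
rewrite -(G0 _ GU) integral_mkcond [RHS]integral_mkcond; apply: eq_integral => x _.
rewrite !patchE; have [|/negP] := boolP (x \in phi @^-1` U0 `&` E).
  by rewrite inE => -[_ xE]; rewrite mem_set.
rewrite inE /= => h; case: ifPn => //; rewrite inE => xE.
by rewrite gU// => ?; apply: h.
Qed.

Definition tensor (f g h : R -> R) (x : R3 R) : R := f x.1.1 * g x.1.2 * h x.2.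

Definition ctest (f : R -> R) := smooth1 f /\ exists r : R, forall t, r < `|t| -> f t = 0.

Lemma smooth_indic (a b : R) : exists f_ : nat -> R -> R,
  [/\ forall n, ctest (f_ n), forall n t, 0 <= f_ n t <= \1_`]a, (b + 3)]%classic t &
   forall t, f_ n t @[n --> \oo] --> (\1_`]a, b]%classic t : R)].
Proof.
have [K [sK K0 K01 K1 K2]] := @smooth_step R; pose s := derive1 K.
have ss : smooth1 s by exact: smooth1_derive1.
have sN t : t <= -1 -> s t = 0 by move=> /K0[].
(* With N = n+1, the first factor vanishes for t <= a and is 1 from a + 2/N on; the second is 1 up
   to b + 1/N and vanishes from b + 3/N on. This gives the half-open limit, and the 3 in the
   dominating interval. *)
pose f_ n (t : R) := s (n.+1%:R * t + (- n.+1%:R * a - 1)) * s (- n.+1%:R * t + (n.+1%:R * b + 2)).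
have n0 n : 0 < n.+1%:R :> R by rewrite ltr0n.
have fa n t : t <= a -> f_ n t = 0.
  by move=> ta; rewrite /f_ sN ?mul0r//; have := n0 n; move: n.+1%:R => N0 ?; nra.
have fb n t : b + 3 <= t -> f_ n t = 0.
  move=> tb; rewrite /f_ mulrC sN ?mul0r//; have : 1 <= n.+1%:R :> R by rewrite ler1n.
  by move: n.+1%:R => N0 ?; nra.
have f01 n t : 0 <= f_ n t <= 1.
  have /andP[x0 x1] := K01 (n.+1%:R * t + (- n.+1%:R * a - 1)).
  have /andP[y0 y1] := K01 (- n.+1%:R * t + (n.+1%:R * b + 2)).
  by rewrite mulr_ge0//= mulr_ile1.
exists f_; split.
- move=> n; split.
    by apply: (@smooth1M _ (fun t => s (n.+1%:R * t + (- n.+1%:R * a - 1))) (fun t => s (- n.+1%:R * t + (n.+1%:R * b + 2)))); exact: smooth1_affine.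
  exists (`|a| + `|b + 3|) => t ht.
  have [ta|ta] := leP t a; first exact: fa.
  have [tb|tb] := leP (b + 3) t; first exact: fb.
  exfalso; move: ht; apply/negP; rewrite -leNgt.
  have := ler_norm a; have := ler_norm (b + 3); have := ler_norm (- a).
  have := ler_norm (- (b + 3)); rewrite !normrN => *.
  by rewrite ler_norml; lra.
- move=> n t; have /andP[-> ft1] := f01 n t; rewrite /= indicE mem_setE in_itv/=.
  have [ta|ta] := ltP a t; last by rewrite fa//.
  by have [tb|tb] := leP t (b + 3); rewrite /= ?ft1// fb// ltW.
- move=> t; rewrite indicE mem_setE in_itv/=.
  have [ta|ta] := ltP a t; last by under eq_cvg do rewrite fa//; exact: cvg_cst.
  have [tb|tb] := leP t b; last first.
    rewrite /=; apply: cvg_near_cst.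
    have bt : 0 < (t - b) / 3 by lra.
    near=> n; rewrite /f_ mulrC sN ?mul0r//.
    have : n.+1%:R^-1 < (t - b) / 3 by near: n; exact: near_infty_natSinv_lt (PosNum bt).
    rewrite -[X in X < _]mul1r ltr_pdivrMr//.
    by move: n.+1%:R => N0 ?; lra.
  rewrite /=; apply: cvg_near_cst.
  have bt : 0 < (t - a) / 2 by lra.
  near=> n; rewrite /f_ /s !K1 ?mul1r//.
    have := n0 n; move: n.+1%:R => N0 ?; nra.
  have : n.+1%:R^-1 < (t - a) / 2 by near: n; exact: near_infty_natSinv_lt (PosNum bt).
  rewrite -[X in X < _]mul1r ltr_pdivrMr//.
  by move: n.+1%:R => N0 ?; lra.
Unshelve. all: by end_near. Qed.

Lemma ctest_continuous f : ctest f -> continuous f.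
Proof. by move=> [sf _]; exact: smooth1_continuous. Qed.

Lemma continuous_coord1 : continuous (fun y : R3 R => y.1.1 : R).
Proof.
move=> y; apply: (@continuous_comp _ _ _ (fst : R3 R -> _) fst); first exact: cvg_fst.
exact: cvg_fst.
Qed.

Lemma continuous_coord2 : continuous (fun y : R3 R => y.1.2 : R).
Proof.
move=> y; apply: (@continuous_comp _ _ _ (fst : R3 R -> _) snd); first exact: cvg_fst.
exact: cvg_snd.
Qed.

Lemma continuous_coord3 : continuous (fun y : R3 R => y.2 : R).
Proof. by move=> y; exact: cvg_snd. Qed.

Lemma tensor_continuous (f g h : R -> R) : continuous f -> continuous g -> continuous h ->
  continuous (tensor f g h).
Proof.
move=> cf cg ch x; apply: cvgM; [apply: cvgM|].
- by apply: (@continuous_comp _ _ _ (fun y : R3 R => y.1.1 : R) f); [exact: continuous_coord1|exact: cf].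
- by apply: (@continuous_comp _ _ _ (fun y : R3 R => y.1.2 : R) g); [exact: continuous_coord2|exact: cg].
- by apply: (@continuous_comp _ _ _ (fun y : R3 R => y.2 : R) h); [exact: continuous_coord3|exact: ch].
Qed.

Lemma smooth1_bounded f : ctest f -> exists2 M, 0 < M & forall t, `|f t| <= M.
Proof.
move=> [sf [r fr]]; have cf := smooth1_continuous sf.
have [//|M [_ HM]] := @compact_bounded _ _ (f @` [set` `[-r, r]]) .
  apply: continuous_compact; last exact: segment_compact.
  exact: continuous_subspaceT.
exists (`|M| + 1) => [|t]; first by rewrite ltr_wpDl.
have [tr|tr] := leP `|t| r; last by rewrite fr// normr0 addr_ge0.
apply: HM; last by exists t => //=; rewrite in_itv/= -ler_norml.
by rewrite (le_lt_trans (ler_norm M))// ltrDl.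
Qed.

Lemma tensor_bounded f g h : ctest f -> ctest g -> ctest h ->
  exists2 M, 0 < M & forall x, `|tensor f g h x| <= M.
Proof.
move=> /smooth1_bounded[M1 M10 H1] /smooth1_bounded[M2 M20 H2] /smooth1_bounded[M3 M30 H3].
exists (M1 * M2 * M3); first by rewrite !mulr_gt0.
by move=> x; rewrite !normrM; rewrite !ler_pM// mulr_ge0.
Qed.

Lemma tensor_support f g h : ctest f -> ctest g -> ctest h ->
  exists2 r, 0 < r & forall x, r < `|x| -> tensor f g h x = 0.
Proof.
move=> [_ [r1 H1]] [_ [r2 H2]] [_ [r3 H3]].
exists (`|r1| + `|r2| + `|r3| + 1); first by rewrite ltr_wpDl// !addr_ge0.
move=> x; rewrite normR3 !lt_max -orbA /tensor => /or3P[] hx.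
- rewrite H1 ?mul0r// (le_lt_trans _ hx)//; have := ler_norm r1; have := normr_ge0 r2; have := normr_ge0 r3; lra.
- rewrite H2 ?(mulr0, mul0r)// (le_lt_trans _ hx)//; have := ler_norm r2; have := normr_ge0 r1; have := normr_ge0 r3; lra.
- rewrite H3 ?mulr0// (le_lt_trans _ hx)//; have := ler_norm r3; have := normr_ge0 r2; have := normr_ge0 r1; lra.
Qed.

Lemma mem_cube r (x : R3 R) : (x \in [set y : R3 R | `|y| <= r]) = (`|x| <= r).
Proof. by apply/idP/idP; rewrite inE. Qed.

Lemma loc_integrable_mul (f phi : R3 R -> R) (r M : R) : loc_integrable f ->
  measurable_fun setT phi -> (forall x, `|phi x| <= M) ->
  (forall x, r < `|x| -> phi x = 0) ->
  leb3.-integrable setT (EFin \o (f \* phi)).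
Proof.
move=> [mf fi] mphi phiM phir.
have M0 : 0 <= M by exact: le_trans (normr_ge0 _) (phiM 0).
have := fi r => /(integrable_mkcond _ (measurable_cube r)) H.
have {}H : leb3.-integrable setT (fun x => (M%:E * ((EFin \o f) \_ [set x | (`|x| <= r)%R]) x)%E).
  exact: integrableZl.
apply: (le_integrable measurableT _ _ H).
  by apply/measurable_EFinP; exact: measurable_funM.
move=> x _; rewrite /= patchE mem_cube.
have [xr|xr] := leP `|x| r; last by rewrite phir// mulr0 normr0; exact: abse_ge0.
change (`|f x * phi x|%:E <= `|M%:E * (f x)%:E|)%E.
by rewrite -EFinM lee_fin/= normrM [leRHS]normrM mulrC ler_wpM2r// (ger0_norm M0).
Qed.

Definition box (a b : R * R * R) : set (R3 R) :=
  (([set` `]a.1.1, b.1.1]] : set (measurableTypeR R)) `*` ([set` `]a.1.2, b.1.2]] : set (measurableTypeR R)))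
    `*` ([set` `]a.2, b.2]] : set (measurableTypeR R)).

Lemma indic_setX T1 T2 (A : set T1) (B : set T2) x : \1_(A `*` B) x = \1_A x.1 * \1_B x.2 :> R.
Proof. by rewrite !indicE in_setX; case: (_ \in A); case: (_ \in B); rewrite /= ?mulr1 ?mul1r ?mulr0 ?mul0r. Qed.

Lemma integral_box_eq0 (f : R3 R -> R) : loc_integrable f ->
  (forall g h k, ctest g -> ctest h -> ctest k -> \int[leb3]_x (f x * tensor g h k x) = 0) ->
  forall a b, (\int[leb3]_(x in box a b) (f x)%:E = 0)%E.
Proof.
move=> lf f0 a b.
have [f1 [t1 b1 c1]] := smooth_indic a.1.1 b.1.1.
have [f2 [t2 b2 c2]] := smooth_indic a.1.2 b.1.2.
have [f3 [t3 b3 c3]] := smooth_indic a.2 b.2.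
pose r := `|a| + `|b| + 3.
have suppn (c d t : R) : `|c| <= `|a| -> `|d| <= `|b| -> r < `|t| -> \1_`]c, (d + 3)]%classic t = 0 :> R.
  move=> ca db rt; rewrite indicE mem_setE in_itv/=; case: ltP => //= ct; case: leP => // td.
  exfalso; move: rt; apply/negP; rewrite -leNgt ler_norml /r.
  move: ca db; rewrite !ler_norml => /andP[? ?] /andP[? ?]; have := normr_ge0 a; have := normr_ge0 b; lra.
have [A1 A2 A3] : [/\ `|a.1.1| <= `|a|, `|a.1.2| <= `|a| & `|a.2| <= `|a| ].
  by have := lexx `|a : R3 R|; rewrite {1}normR3_le => /and3P[].
have [B1 B2 B3] : [/\ `|b.1.1| <= `|b|, `|b.1.2| <= `|b| & `|b.2| <= `|b| ].
  by have := lexx `|b : R3 R|; rewrite {1}normR3_le => /and3P[].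
have ge01 (c d t y : R) : 0 <= y <= \1_`]c, d]%classic t -> `|y| <= 1.
  by move=> /andP[y0 y1]; rewrite ger0_norm// (le_trans y1)// indicE; case: (_ \in _).
have z01 (c d t y : R) : \1_`]c, d]%classic t = 0 :> R -> 0 <= y <= \1_`]c, d]%classic t -> y = 0.
  by move=> -> /le_anti.
pose g_ n := tensor (f1 n) (f2 n) (f3 n).
have cg n : continuous (g_ n) by apply: tensor_continuous; exact: ctest_continuous.
have mg n : measurable_fun setT (g_ n) by exact: continuous_measurable_R3.
have g1 n x : `|g_ n x| <= 1.
  rewrite !normrM -[leRHS]mulr1 -[X in _ <= X * _]mulr1 !ler_pM ?mulr_ge0//; exact: ge01.
have gr n x : r < `|x| -> g_ n x = 0.
  rewrite normR3 !lt_max -orbA /g_ /tensor => /or3P[] hx.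
  - by rewrite (z01 _ _ _ _ _ (b1 n x.1.1)) ?mul0r// suppn.
  - by rewrite (z01 _ _ _ _ _ (b2 n x.1.2)) ?mulr0 ?mul0r// suppn.
  - by rewrite (z01 _ _ _ _ _ (b3 n x.2)) ?mulr0// suppn.
have cvg x : g_ n x @[n --> \oo] --> (\1_(box a b) x : R).
  by rewrite /box 2!indic_setX; apply: cvgM => //; exact: cvgM.
have mbox : measurable (box a b) by apply: measurableX => //; exact: measurableX.
have [mf _] := lf.
have idom : leb3.-integrable setT (EFin \o (f \* (\1_[set x | (`|x| <= r)%R] : R3 R -> R))).
  apply: (@loc_integrable_mul _ _ r 1) => //.
  - by apply: measurable_indic; exact: measurable_cube.
  - by move=> x; rewrite indicE; case: (_ \in _); rewrite ?normr1 ?normr0.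
  - by move=> x xr; rewrite indicE mem_cube leNgt xr.
have [] := @dominated_convergence _ _ _ leb3 setT measurableT (fun n x => (f x * g_ n x)%:E)
  (fun x => (f x * \1_(box a b) x)%:E) (fun x => `|(f x * \1_[set x | (`|x| <= r)%R] x)%:E|%E).
- by move=> n; apply/measurable_EFinP; apply: measurable_funM => //; exact: mg.
- by apply/measurable_EFinP; apply: measurable_funM => //; exact: measurable_indic.
- by apply: aeW => x _; apply: cvg_EFin; [exact: nearW|apply: cvgM; [exact: cvg_cst|exact: cvg]].
- exact: integrable_abse.
- apply: aeW => x n _; rewrite /= lee_fin (normrM (f x)) [leRHS](normrM (f x)) ler_wpM2l//.
  rewrite [in leRHS]indicE mem_cube; have [xr|xr] := leP `|x| r; last by rewrite gr// normr0.
  by rewrite normr1.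
move=> _ _; rewrite (_ : (fun n => _) = cst 0%E); last first.
  apply/funext => n /=.
  have := f0 _ _ _ (t1 n) (t2 n) (t3 n); rewrite /Rintegral => /eqP.
  rewrite fine_eq0; first by move/eqP.
  apply: integrable_fin_num => //.
  exact: (loc_integrable_mul lf (mg n) (g1 n) (gr n)).
move=> h; transitivity (\int[leb3]_x (f x * \1_(box a b) x)%:E)%E; last first.
  by rewrite -(cvg_lim (@ereal_hausdorff R) h); exact: lim_cst.
rewrite integral_mkcond; apply: eq_integral => x _.
by rewrite patchE /= indicE; case: (x \in _); rewrite ?mulr1 ?mulr0.
Qed.

Lemma ocitv_setI : setI_closed (@ocitv R).
Proof. exact: ocitvI. Qed.

Lemma loc_integrable_cube (f : R3 R -> R) r : loc_integrable f ->
  leb3.-integrable setT (EFin \o (f \* (\1_[set x | (`|x| <= r)%R] : R3 R -> R))).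
Proof.
move=> lf; apply: (@loc_integrable_mul _ _ r 1) => //.
- by apply: measurable_indic; exact: measurable_cube.
- by move=> x; rewrite indicE; case: (_ \in _); rewrite ?normr1 ?normr0.
- by move=> x xr; rewrite indicE mem_cube leNgt xr.
Qed.

(** Restricting [f] to a half-open cube makes it integrable and keeps intersections with boxes of
    the same shape. Starting from boxes, the intervals are replaced by measurable sets one
    coordinate at a time ([S1] to [S3]); two more Dynkin arguments pass from rectangles to all
    measurable sets of the products. *)
Lemma vanish_ae (f : R3 R -> R) : loc_integrable f ->
  (forall g h k, ctest g -> ctest h -> ctest k -> \int[leb3]_x (f x * tensor g h k x) = 0) ->
  {ae leb3, forall x, f x = 0}.
Proof.
move=> lf f0.
have mR (x y : R) : measurable ([set` `]x, y]] : set (measurableTypeR R)) by [].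
suff H n : {ae leb3, forall x, `|x| < n%:R -> f x = 0}.
  have /ae_foralln : forall n, {ae leb3, forall x, `|x| < n%:R -> f x = 0} := H.
  apply: filterS => x /(_ (Num.bound `|x|)); apply.
  by rewrite archi_boundP.
pose Q := box (- n%:R, - n%:R, - n%:R) (n%:R, n%:R, n%:R) : set (R3 R).
have mQ : measurable Q by apply: measurableX => //; exact: measurableX.
pose g : R3 R -> R := f \* \1_Q.
have ig : leb3.-integrable setT (EFin \o g).
  apply: (@loc_integrable_mul _ _ n%:R 1) => //.
  - by move=> x; rewrite indicE; case: (_ \in _); rewrite ?normr1 ?normr0.
  - move=> x xr; rewrite indicE memNset// => -[[]] /=.
    rewrite !in_itv/= => /andP[a1 a2] /andP[b1 b2] /andP[c1 c2].
    by move: xr; apply/negP; rewrite -leNgt normR3_le !ler_norml a2 b2 c2 !ltW.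
have ocI (a b c d : R) : `]a, b]%classic `&` `]c, d]%classic = `]Num.max a c, Num.min b d]%classic :> set R.
  by apply/seteqP; split => x /=; rewrite !in_itv/= gt_max le_min; [move=> [/andP[-> ->] /andP[-> ->]]|move=> /andP[/andP[-> ->] /andP[-> ->]]].
have gbox a b : (\int[leb3]_(x in box a b) (g x)%:E = 0)%E.
  pose a' : R * R * R := (Num.max a.1.1 (- n%:R), Num.max a.1.2 (- n%:R), Num.max a.2 (- n%:R)).
  pose b' : R * R * R := (Num.min b.1.1 n%:R, Num.min b.1.2 n%:R, Num.min b.2 n%:R).
  rewrite -(integral_box_eq0 lf f0 a' b') integral_mkcond [RHS]integral_mkcond.
  apply: eq_integral => x _; rewrite !patchE /g /= indicE.
  have -> : box a' b' = box a b `&` Q.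
    by rewrite /box -!setXI !ocI.
  have -> : (x \in box a b `&` Q) = (x \in box a b) && (x \in Q).
    by apply/idP/andP; rewrite !inE.
  case: (x \in box a b) => /=; last by [].
  by case: (x \in Q); rewrite /= ?mulr1 ?mulr0.
have m11 : measurable_fun setT (fun x : R3 R => x.1.1 : measurableTypeR R).
  by apply: measurableT_comp => //; exact: measurable_fst.
have m12 : measurable_fun setT (fun x : R3 R => x.1.2 : measurableTypeR R).
  by apply: measurableT_comp; [exact: measurable_snd|exact: measurable_fst].
have m2 : measurable_fun setT (fun x : R3 R => x.2 : measurableTypeR R) by exact: measurable_snd.
have m1 : measurable_fun setT (fun x : R3 R => x.1 : measurableTypeR R * measurableTypeR R) by exact: measurable_fst.
have mpre (A : set (measurableTypeR R)) (phi : R3 R -> measurableTypeR R) : measurable_fun setT phi -> measurable A -> measurable (phi @^-1` A).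
  by move=> mphi mA; rewrite -[X in measurable X]setTI; exact: mphi.
have gQ1 x : ~ `]- n%:R, n%:R]%classic x.1.1 -> g x = 0.
  by move=> h; rewrite /g /= indicE memNset ?mulr0// => -[[]].
have gQ2 x : ~ `]- n%:R, n%:R]%classic x.1.2 -> g x = 0.
  by move=> h; rewrite /g /= indicE memNset ?mulr0// => -[[]].
have gQ3 x : ~ `]- n%:R, n%:R]%classic x.2 -> g x = 0.
  by move=> h; rewrite /g /= indicE memNset ?mulr0// => -[[]].
have oc (x y : R) : ocitv `]x, y]%classic by exists (x, y).
have S1 (b2 b3 c2 c3 : R) (A : set (measurableTypeR R)) : measurable A ->
    (\int[leb3]_(x in (fun x : R3 R => x.1.1 : measurableTypeR R) @^-1` A `&`
       ((fun x : R3 R => x.1.2 : measurableTypeR R) @^-1` `]b2, c2]%classic `&` (fun x : R3 R => x.2 : measurableTypeR R) @^-1` `]b3, c3]%classic)) (g x)%:E = 0)%E.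
  apply: (vanish_generated_proj m11 _ ig _ ocitv_setI (oc _ _) gQ1) => //.
    by apply: measurableI; exact: mpre.
  move=> _ [[x y] _ <-] /=; rewrite -[RHS](gbox (x, b2, b3) (y, c2, c3)); congr integral.
  by apply/seteqP; split => z; [move=> [? []]|move=> [[]]].
have S2 (b3 c3 : R) (A B : set (measurableTypeR R)) : measurable A -> measurable B ->
    (\int[leb3]_(x in (fun x : R3 R => x.1.2 : measurableTypeR R) @^-1` B `&`
       ((fun x : R3 R => x.1.1 : measurableTypeR R) @^-1` A `&` (fun x : R3 R => x.2 : measurableTypeR R) @^-1` `]b3, c3]%classic)) (g x)%:E = 0)%E.
  move=> mA; apply: (vanish_generated_proj m12 _ ig _ ocitv_setI (oc _ _) gQ2) => //.
    by apply: measurableI; exact: mpre.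
  by move=> _ [[x y] _ <-] /=; rewrite setICA; exact: S1.
have S3 (A B C : set (measurableTypeR R)) : measurable A -> measurable B -> measurable C ->
    (\int[leb3]_(x in (fun x : R3 R => x.2 : measurableTypeR R) @^-1` C `&`
       ((fun x : R3 R => x.1.1 : measurableTypeR R) @^-1` A `&` (fun x : R3 R => x.1.2 : measurableTypeR R) @^-1` B)) (g x)%:E = 0)%E.
  move=> mA mB; apply: (vanish_generated_proj m2 _ ig _ ocitv_setI (oc _ _) gQ3) => //.
    by apply: measurableI; exact: mpre.
  move=> _ [[x y] _ <-] /=.
  rewrite -[RHS](S2 x y _ _ mA mB); congr integral.
  by apply/seteqP; split => z [? []].
have rectI d1 d2 (T : measurableType d1) (U : measurableType d2) :
    setI_closed [set A `*` B | A in (measurable : set (set T)) & B in (measurable : set (set U))].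
  move=> _ _ [A1 mA1 [A2 mA2 <-]] [B1 mB1 [B2 mB2 <-]].
  by rewrite -setXI; exists (A1 `&` B1); [exact: measurableI|exists (A2 `&` B2) => //; exact: measurableI].
have S4 (A : set (measurableTypeR R * measurableTypeR R)) (C : set (measurableTypeR R)) : measurable A -> measurable C ->
    (\int[leb3]_(x in (fun x : R3 R => x.1 : measurableTypeR R * measurableTypeR R) @^-1` A `&`
       ((fun x : R3 R => x.2 : measurableTypeR R) @^-1` C)) (g x)%:E = 0)%E.
  move=> + mC; apply: (vanish_generated m1 _ ig _ (@rectI _ _ _ _)).
  - exact: mpre.
  - exact: measurable_prod_measurableType.
  - by have := S3 _ _ _ measurableT measurableT mC; rewrite !preimage_setT !setIT.
  - move=> _ [A1 mA1 [A2 mA2 <-]]; rewrite -[RHS](S3 _ _ _ mA1 mA2 mC); congr integral.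
    by apply/seteqP; split => z; [move=> [[]]|move=> [? []]].
have S5 (A : set (R3 R)) : measurable A -> (\int[leb3]_(x in A) (g x)%:E = 0)%E.
  move=> mA; have := @vanish_generated _ _ _ _ leb3 g (fun x : R3 R => x) setT _ _ measurableT ig _ (@rectI _ _ _ _) _ _ A mA.
  rewrite setIT; apply.
  - exact: measurable_id.
  - exact: measurable_prod_measurableType.
  - by have := S4 _ _ measurableT measurableT; rewrite !preimage_setT !setIT.
  - move=> _ [A1 mA1 [A2 mA2 <-]]; have := S4 _ _ mA1 mA2.
    by rewrite setIT.
have : ae_eq leb3 setT (EFin \o g) (cst 0%E).
  apply: (integral_ae_eq measurableT ig) => // E _ mE.
  by rewrite S5// integral_cst// mul0e.
apply: filterS => x /(_ Logic.I) /= [] + xn.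
rewrite /g /= indicE mem_set ?mulr1//.
move: xn; rewrite normR3 !gt_max -andbA !ltr_norml => /and3P[/andP[? ?] /andP[? ?] /andP[? ?]].
by split; [split|]; rewrite /= in_itv/=; apply/andP; split => //; exact: ltW.
Qed.

End vanishing_integrals.

(** * Derivatives of tensor products, and uniqueness of weak derivatives *)

Section tensor_calculus.
Context {R : realType}.
Implicit Types (f g h : R -> R) (x v : R3 R).

Lemma is_diff_fst (U V : normedModType R) (x : U * V) : is_diff x (fst : U * V -> U) fst.
Proof.
apply: DiffDef; first by apply: linear_differentiable => z; exact: cvg_fst.
by rewrite diff_lin// => z; exact: cvg_fst.
Qed.

Lemma is_diff_snd (U V : normedModType R) (x : U * V) : is_diff x (snd : U * V -> V) snd.
Proof.
apply: DiffDef; first by apply: linear_differentiable => z; exact: cvg_snd.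
by rewrite diff_lin// => z; exact: cvg_snd.
Qed.

Lemma is_diff_real f (t : R) : derivable f t 1 -> is_diff t f (fun s : R => s * derive1 f t).
Proof.
move=> df; apply: DiffDef; first exact/derivable1_diffP.
by rewrite deriv1E.
Qed.

Lemma is_diff_coord1 f x : derivable f x.1.1 1 ->
  is_diff x (fun y : R3 R => f y.1.1) (fun v => v.1.1 * derive1 f x.1.1).
Proof.
move=> /is_diff_real df.
have d1 := is_diff_fst x; have d2 := is_diff_fst x.1.
have d3 := @is_diff_comp _ _ _ _ _ _ _ _ x d1 d2.
exact: (@is_diff_comp _ _ _ _ _ _ _ _ x d3 df).
Qed.

Lemma is_diff_coord2 f x : derivable f x.1.2 1 ->
  is_diff x (fun y : R3 R => f y.1.2) (fun v => v.1.2 * derive1 f x.1.2).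
Proof.
move=> /is_diff_real df.
have d1 := is_diff_fst x; have d2 := is_diff_snd x.1.
have d3 := @is_diff_comp _ _ _ _ _ _ _ _ x d1 d2.
exact: (@is_diff_comp _ _ _ _ _ _ _ _ x d3 df).
Qed.

Lemma is_diff_coord3 f x : derivable f x.2 1 ->
  is_diff x (fun y : R3 R => f y.2) (fun v => v.2 * derive1 f x.2).
Proof.
move=> /is_diff_real df.
have d1 := is_diff_snd x.
exact: (@is_diff_comp _ _ _ _ _ _ _ _ x d1 df).
Qed.

Lemma is_diff_tensor f g h x : derivable f x.1.1 1 -> derivable g x.1.2 1 -> derivable h x.2 1 ->
  is_diff x (tensor f g h) (fun v =>
    v.1.1 * derive1 f x.1.1 * g x.1.2 * h x.2 + v.1.2 * (f x.1.1 * derive1 g x.1.2 * h x.2)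
    + v.2 * (f x.1.1 * g x.1.2 * derive1 h x.2)).
Proof.
move=> df dg dh.
have d1 := is_diff_coord1 df; have d2 := is_diff_coord2 dg; have d3 := is_diff_coord3 dh.
have d12 := is_diffM d1 d2; have d123 := is_diffM d12 d3.
apply: (is_diff_eq d123); apply/funext => v.
rewrite !fctE /GRing.scale/=; ring.
Qed.

Lemma tensor_differentiable f g h x : smooth1 f -> smooth1 g -> smooth1 h ->
  differentiable (tensor f g h) x.
Proof.
move=> sf sg sh.
by have [] := is_diff_tensor (smooth1_derivable sf : derivable f x.1.1 1) (smooth1_derivable sg : derivable g x.1.2 1) (smooth1_derivable sh : derivable h x.2 1).
Qed.

Lemma partial_tensor (i : 'I_3) f g h : smooth1 f -> smooth1 g -> smooth1 h ->
  partial i (tensor f g h) = tensor (derive1n (i == 0) f) (derive1n (i == 1) g) (derive1n (i == 2) h).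
Proof.
move=> sf sg sh; apply/funext => x.
have d := is_diff_tensor (smooth1_derivable sf : derivable f x.1.1 1) (smooth1_derivable sg : derivable g x.1.2 1) (smooth1_derivable sh : derivable h x.2 1).
rewrite /partial deriveE; last by case: d.
rewrite diff_val /tensor /unit_vec /=.
case: i => [[|[|[|//]]] ?] /=; rewrite ?derive1n1 /=; ring.
Qed.

Lemma partials_tensor s f g h : smooth1 f -> smooth1 g -> smooth1 h ->
  partials s (tensor f g h) = tensor (derive1n (count_mem (0 : 'I_3) s) f)
    (derive1n (count_mem (1 : 'I_3) s) g) (derive1n (count_mem (2 : 'I_3) s) h).
Proof.
move=> sf sg sh; elim: s => [//|i s IH] /=.
rewrite -/(partials s _) IH partial_tensor; [|exact: smooth1_derive1n..].
have dd b n (k : R -> R) : derive1n (nat_of_bool b) (derive1n n k) = derive1n (b + n) k.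
  by case: b => //=; rewrite add1n derive1nS.
by rewrite !dd.
Qed.

Lemma ctest_derive1 f : ctest f -> ctest (derive1 f).
Proof.
move=> [sf [r fr]]; split; first exact: smooth1_derive1.
exists r => t rt; rewrite derive1E (near_eq_derive (g := cst 0)) ?derive_cst//.
near=> z; rewrite fr//; near: z.
have : open [set z : R | r < `|z|].
  rewrite (_ : [set _ | _] = (fun z : R => `|z|) @^-1` [set` `]r, +oo[]); last first.
    by apply/seteqP; split => z; rewrite /= in_itv/= andbT.
  apply: open_comp; last exact: interval_open.
  by move=> z _; exact: norm_continuous.
by rewrite openE; apply.
Unshelve. all: by end_near. Qed.

Lemma ctest_derive1n n f : ctest f -> ctest (derive1n n f).
Proof. by move=> tf; elim: n => [//|n IH]; rewrite derive1nS; exact: ctest_derive1. Qed.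

Lemma test_tensor f g h : ctest f -> ctest g -> ctest h -> test_function (tensor f g h).
Proof.
move=> tf tg th; split.
  move=> s x; rewrite partials_tensor; [|by case: tf|by case: tg|by case: th].
  by apply: tensor_differentiable; apply: smooth1_derive1n; [case: tf|case: tg|case: th].
by have [r _ H] := tensor_support tf tg th; exists r.
Qed.

Lemma is_wderiv_unique s (f g1 g2 : R3 R -> R) : is_wderiv s f g1 -> is_wderiv s f g2 ->
  {ae leb3, forall x, g1 x = g2 x}.
Proof.
move=> [lf [mg1 lg1] H1] [_ [mg2 lg2] H2].
suff : {ae leb3, forall x, g1 x - g2 x = 0}.
  by apply: filterS => x /eqP; rewrite subr_eq0 => /eqP.
apply: (@vanish_ae _ (g1 \- g2)).
  split; first exact: measurable_funB.
  move=> r; have := integrableB (measurable_cube r) (lg1 r) (lg2 r).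
  by apply: eq_integrable => //; exact: measurable_cube.
move=> k1 k2 k3 t1 t2 t3.
have tst := test_tensor t1 t2 t3.
have := H1 _ tst; rewrite (H2 _ tst) => /(congr1 (fun z => (-1) ^+ size s * z)).
rewrite !mulrA -expr2 sqrr_sign !mul1r => E.
have [M M0 HM] := tensor_bounded t1 t2 t3; have [r _ Hr] := tensor_support t1 t2 t3.
have mt : measurable_fun setT (tensor k1 k2 k3).
  by apply: continuous_measurable_R3; apply: tensor_continuous; exact: ctest_continuous.
have i1 := loc_integrable_mul (conj mg1 lg1) mt HM Hr.
have i2 := loc_integrable_mul (conj mg2 lg2) mt HM Hr.
rewrite -[RHS](subrr (\int[leb3]_x (g2 x * tensor k1 k2 k3 x))) {1}E -RintegralB//.
by apply: eq_Rintegral => x _ /=; rewrite mulrBl.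
Qed.

End tensor_calculus.

(** * The integral of a compactly supported partial derivative *)

Section integration_by_parts.
Context {R : realType}.

Lemma loc_integrable_bounded (f : R3 R -> R) M : measurable_fun setT f ->
  (forall x, `|f x| <= M) -> loc_integrable f.
Proof.
move=> mf fM; split => // r.
apply: (@le_integrable _ _ _ leb3 _ (measurable_cube r) _ (cst M%:E)).
- by apply: measurable_funTS; exact/measurable_EFinP.
- by move=> x _ /=; rewrite lee_fin (le_trans (fM x))// ler_norm.
apply/integrableP; split; first exact: measurable_cst.
rewrite /= integral_cst/=; last exact: measurable_cube.
by rewrite lte_mul_pinfty// leb3_cube_lty.
Qed.

Lemma loc_integrable_cst (c : R) : loc_integrable (cst c : R3 R -> R).
Proof. exact: (@loc_integrable_bounded _ `|c|). Qed.

Lemma norm_unit_vec (j : 'I_3) : `|unit_vec j : R3 R| = 1.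
Proof.
rewrite normR3 /unit_vec/=; case: j => [[|[|[|//]]] ?]/=.
- by rewrite normr1 normr0 !(max_l ler01).
- by rewrite normr1 normr0 (max_r ler01) (max_l ler01).
- by rewrite normr1 normr0 maxxx (max_r ler01).
Qed.

Lemma line_is_derive (g : R3 R -> R) (x v : R3 R) : (forall y, derivable g y v) ->
  forall t : R, is_derive t 1 (fun s : R => g (s *: v + x)) ('D_v g (t *: v + x)).
Proof.
move=> dg t; have := dg (t *: v + x).
have E : (fun h : R => h^-1 *: ((g \o shift (t *: v + x)) (h *: v) - g (t *: v + x))) =
  (fun h : R => h^-1 *: (((fun s : R => g (s *: v + x)) \o shift t) (h *: (1 : R)) - g (t *: v + x))).
  apply/funext => h /=; congr (_ *: (g _ - _)).
  by rewrite /shift/= addrA -scalerDl /GRing.scale/= mulr1.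
by rewrite /derivable /derive E => d; apply: DeriveDef.
Qed.

Lemma lipschitz_line (g : R3 R -> R) (v : R3 R) (M : R) : (forall y, derivable g y v) ->
  (forall y, `|'D_v g y| <= M) -> forall x (t : R), `|g (t *: v + x) - g x| <= M * `|t|.
Proof.
move=> dg gM x t; have dl := line_is_derive x dg.
have M0 : 0 <= M := le_trans (normr_ge0 _) (gM 0).
have cl : continuous (fun s : R => g (s *: v + x)).
  by move=> s; apply/differentiable_continuous/derivable1_diffP; have [] := dl s.
wlog t0 : t / 0 < t.
  move=> H; case: (ltgtP t 0) => [tn|tp|->]; last 2 first.
  - exact: H.
  - by rewrite scale0r add0r subrr normr0 mulr_ge0.
  have [c _ E] := MVT tn (fun s _ => dl s) (@continuous_subspaceT _ _ _ _ cl).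
  rewrite scale0r add0r in E; rewrite distrC E sub0r mulrN normrN normrM.
  by rewrite ler_wpM2r.
have [c _ E] := MVT t0 (fun s _ => dl s) (@continuous_subspaceT _ _ _ _ cl).
by rewrite scale0r add0r in E; rewrite E subr0 normrM ler_wpM2r.
Qed.

(** The derivative is merely bounded, not continuous, as will be the case with the pressure.
    Difference quotients have integral zero by translation invariance and are bounded by [M] by the
    mean value theorem, so dominated convergence applies. *)
Lemma integral_partial_eq0 (i : 'I_3) (g : R3 R -> R) (r M : R) :
  continuous g -> (forall x, derivable g x (unit_vec i)) ->
  (forall x, r < `|x| -> g x = 0) -> (forall x, `|partial i g x| <= M) ->
  leb3.-integrable setT (EFin \o partial i g) /\ \int[leb3]_x partial i g x = 0.
Proof.
move=> cg dg gr gM; have ne := norm_unit_vec i.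
set e := unit_vec i in dg ne *.
have M0 : 0 <= M := le_trans (normr_ge0 _) (gM 0).
have mg := continuous_measurable_R3 cg.
pose hn (n : nat) : R := n.+1%:R^-1.
have hn0 n : 0 < hn n by rewrite invr_gt0.
have hn1 n : hn n <= 1 by rewrite invf_le1// ler1n.
have cshift (n : nat) : continuous (fun x : R3 R => g (x + hn n *: e)).
  move=> x; apply: (@continuous_comp _ _ _ (fun x : R3 R => x + hn n *: e) g); last exact: cg.
  by apply: cvgD; [exact: cvg_id|exact: cvg_cst].
pose D n x := (hn n)^-1 * (g (x + hn n *: e) - g x).
have cD n : continuous (D n).
  move=> x; apply: cvgM; first exact: cvg_cst.
  by apply: cvgB; [exact: cshift|exact: cg].
have mD n := continuous_measurable_R3 (cD n).
have DM n x : `|D n x| <= M.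
  rewrite /D normrM gtr0_norm ?invr_gt0// ler_pdivrMl// [leRHS]mulrC.
  by rewrite [x + _]addrC; have := lipschitz_line dg gM x (hn n); rewrite (gtr0_norm (hn0 n)).
have Dr n x : r + 1 < `|x| -> D n x = 0.
  move=> rx; rewrite /D !gr ?subrr ?mulr0//; first by rewrite (lt_trans _ rx)// ltrDl.
  rewrite -(ltrD2r 1) (lt_le_trans rx)// -[X in `|X|](addrK (hn n *: e)).
  rewrite (le_trans (ler_normB _ _))// lerD2l normrZ gtr0_norm//.
  by rewrite ne mulr1.
have cv x : D n x @[n --> \oo] --> partial i g x.
  have := dg x; rewrite /derivable => /cvg_ex[l Hl].
  have El : partial i g x = l by apply: cvg_lim.
  rewrite El; have h0 : hn n @[n --> \oo] --> (0 : R)^'.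
    move=> A; rewrite /dnbhs /within /= => nA.
    have H : \forall n \near \oo, (hn n != 0 -> A (hn n)) := (@cvg_harmonic R) _ nA.
    by apply: filterS H => n; apply; rewrite gt_eqF.
  have := cvg_comp _ _ h0 Hl; apply: cvg_trans; apply: near_eq_cvg; apply: nearW => n /=.
  by rewrite /D [_ *: e + x]addrC.
have idom : leb3.-integrable setT (EFin \o (cst M \* (\1_[set x | (`|x| <= r + 1)%R] : R3 R -> R))).
  by apply: loc_integrable_cube; exact: loc_integrable_cst.
have iD n : leb3.-integrable setT (EFin \o D n).
  apply: (le_integrable measurableT _ _ idom); first exact/measurable_EFinP.
  move=> x _ /=; rewrite lee_fin indicE mem_cube.
  have [xr|xr] := leP `|x| (r + 1); last by rewrite Dr// normr0.
  by rewrite mulr1 (ger0_norm M0).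
(* Moving a point of the cube by 2|r| + 1 along the axis leaves the support, so the Lipschitz bound
   also bounds [g] itself. *)
have gB x : `|g x| <= M * (`|r| *+ 2 + 1).
  have [rx|xr] := ltP r `|x|.
    by rewrite gr// normr0 mulr_ge0// addr_ge0// mulrn_wge0.
  have t0 : 0 < `|r| *+ 2 + 1 by rewrite ltr_wpDl// mulrn_wge0.
  have := lipschitz_line dg gM x (`|r| *+ 2 + 1).
  rewrite (gtr0_norm t0) gr ?sub0r ?normrN//.
  have := ler_normB (((`|r| *+ 2 + 1) *: e) + x) x.
  rewrite addrK normrZ ne mulr1 (gtr0_norm t0) => ?.
  have := ler_norm r; have := normr_ge0 r; rewrite mulr2n in t0 *; lra.
have icst : loc_integrable (cst 1 : R3 R -> R) by exact: loc_integrable_cst.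
have ig : leb3.-integrable setT (EFin \o g).
  have := loc_integrable_mul icst mg gB gr.
  by apply: eq_integrable => // x _ /=; rewrite mul1r.
have igs n : leb3.-integrable setT (EFin \o (fun x => g (x + hn n *: e))).
  have := @loc_integrable_mul _ _ _ (r + 1) _ icst (continuous_measurable_R3 (cshift n)) (fun x => gB _).
  move=> /(_ _)/wrap[]; last first.
    by apply: eq_integrable => // x _ /=; rewrite mul1r.
  move=> x rx; apply: gr; rewrite -(ltrD2r 1) (lt_le_trans rx)// -[X in `|X|](addrK (hn n *: e)).
  by rewrite (le_trans (ler_normB _ _))// lerD2l normrZ gtr0_norm// ne mulr1.
have D0 n : (\int[leb3]_x (D n x)%:E = 0)%E.
  rewrite /D; under eq_integral do rewrite EFinM EFinB.
  rewrite integralZl//; last exact: (integrableB measurableT (igs n) ig).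
  rewrite integralB//; last by first [exact: (igs n)|exact: ig].
  have := integral_shift (hn n *: e) ig => /= ->.
  by rewrite subee ?mule0//; apply: integrable_fin_num.
have [] := @dominated_convergence _ _ _ leb3 setT measurableT (fun n x => (D n x)%:E)
  (fun x => (partial i g x)%:E) (fun x => (M * \1_[set x | (`|x| <= r + 1)%R] x)%:E).
- by move=> n; exact/measurable_EFinP.
- by apply/measurable_EFinP; apply: measurable_fun_cvg => [n|x _]; [exact: mD|exact: cv].
- by apply: aeW => x _; apply: cvg_EFin; [exact: nearW|exact: cv].
- exact: idom.
- apply: aeW => x n _ /=; rewrite lee_fin indicE mem_cube.
  have [xr|xr] := leP `|x| (r + 1); last by rewrite Dr// normr0 mulr0.
  by rewrite mulr1.
move=> ip _ h; split; first exact: ip.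
rewrite /Rintegral (_ : (\int[_]_x _)%E = 0%E)//.
rewrite -(cvg_lim (@ereal_hausdorff R) h); under eq_fun do rewrite D0.
exact: lim_cst.
Qed.

End integration_by_parts.

(** * Cutoffs and mollifiers with controlled antiderivatives *)

Section kernels.
Context {R : realType}.
Implicit Types (f g h : R -> R).

(* Integrating a function with weak derivatives of order at most 2 in L^2 against
   [T] costs at most [b] times their norms, as the derivatives can be moved off
   the [u k]. *)
Definition decomp (rho b : R) (T : R -> R) := exists u : nat -> R -> R,
  [/\ forall k, smooth1 (u k), forall k t, rho < `|t| -> u k t = 0,
      forall k t, `|u k t| <= b &
      forall t, T t = \sum_(k < 3) derive1n k (u k) t].

Definition step_kernel (K : R -> R) := [/\ smooth1 K,
  forall x, x <= - 1 -> K x = 0 /\ derive1 K x = 0,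
  forall x, 0 <= derive1 K x <= 1,
  forall x, 1 <= x -> derive1 K x = 1 &
  forall x, 0 <= derive1n 2 K x].

Lemma derive1_supp f r : (forall t, r < `|t| -> f t = 0) ->
  forall t, r < `|t| -> derive1 f t = 0.
Proof.
move=> fr t rt; rewrite derive1E (near_eq_derive (g := (cst 0 : R -> R))) ?derive_cst//.
near=> z; rewrite fr//; near: z.
have : open [set z : R | r < `|z|].
  rewrite (_ : [set _ | _] = (fun z : R => `|z|) @^-1` [set` `]r, +oo[]); last first.
    by apply/seteqP; split => z; rewrite /= in_itv/= andbT.
  apply: open_comp; last exact: interval_open.
  by move=> z _; exact: norm_continuous.
by rewrite openE; apply.
Unshelve. all: by end_near. Qed.

Lemma step_kernel_bump0 K : step_kernel K -> forall t, 1 < `|t| -> derive1n 2 K t = 0.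
Proof.
move=> [sK K0 _ K1 _] t; rewrite real_ltr_normr ?num_real// derive1nS derive1n1 derive1E => /orP[t1|t1].
  rewrite (near_eq_derive (g := (cst 1 : R -> R))) ?derive_cst//; near=> z; apply: K1; apply: ltW.
  by near: z; exact: lt_nbhsr.
rewrite (near_eq_derive (g := (cst 0 : R -> R))) ?derive_cst//; near=> z; apply: (K0 _ _).2.
near: z; have t2 : t < -1 by lra.
by apply: filterS (lt_nbhsl t2) => w /ltW.
Unshelve. all: by end_near. Qed.

Lemma exists_cutoff (r : R) : 0 < r -> exists chi : R -> R,
  [/\ ctest chi, forall t, r + 2 < `|t| -> chi t = 0 & forall t, `|t| <= r -> chi t = 1].
Proof.
move=> r0; have [K [sK K0 K01 K1 K2]] := @smooth_step R.
have ss := smooth1_derive1 sK.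
pose chi (t : R) := derive1 K (1 * t + (r + 1)) * derive1 K (-1 * t + (r + 1)).
have sc : smooth1 chi.
  by apply: (@smooth1M _ (fun t => derive1 K (1 * t + (r + 1))) (fun t => derive1 K (-1 * t + (r + 1)))); exact: smooth1_affine.
have c0 t : r + 2 < `|t| -> chi t = 0.
  rewrite real_ltr_normr ?num_real// /chi => /orP[t1|t1].
    by rewrite [X in _ * X](_ : _ = 0) ?mulr0//; apply: (K0 _ _).2; lra.
  by rewrite [X in X * _](_ : _ = 0) ?mul0r//; apply: (K0 _ _).2; lra.
exists chi; split => //; first by split => //; exists (r + 2).
move=> t; rewrite ler_norml => /andP[t1 t2]; rewrite /chi !K1 ?mulr1//; lra.
Qed.

Lemma smooth1N f : smooth1 f -> smooth1 (\- f).
Proof.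
move=> sf; rewrite (_ : \- f = fun x => -1 * f x); first exact: smooth1Z.
by apply/funext => x; rewrite mulN1r.
Qed.

Lemma decomp_intro rho b (u0 u1 u2 T : R -> R) :
  smooth1 u0 -> smooth1 u1 -> smooth1 u2 ->
  (forall t, rho < `|t| -> [/\ u0 t = 0, u1 t = 0 & u2 t = 0]) ->
  (forall t, [/\ `|u0 t| <= b, `|u1 t| <= b & `|u2 t| <= b]) ->
  (forall t, T t = u0 t + derive1 u1 t + derive1 (derive1 u2) t) -> decomp rho b T.
Proof.
move=> s0 s1 s2 ur ub E.
exists (fun k : nat => if k is k'.+1 then if k' is _.+1 then u2 else u1 else u0); split.
- by case=> [|[|k]].
- by case=> [|[|k]] t /ur[].
- by case=> [|[|k]] t; have [] := ub t.
- by move=> t; rewrite E !big_ord_recl big_ord0 /= addr0 addrA.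
Qed.

(** From chi S' = (chi S)' - chi' S: the cost involves the size of [S], not that of its
    derivative. *)
Lemma decomp_derive1 chi S rho X b : smooth1 chi -> smooth1 S ->
  (forall t, rho < `|t| -> chi t = 0) ->
  (forall t, `|chi t| <= X) -> (forall t, `|derive1 chi t| <= X) ->
  (forall t, `|S t| <= b) -> decomp rho (X * b) (chi \* derive1 S).
Proof.
move=> sc sS cr cX dcX Sb.
have X0 : 0 <= X := le_trans (normr_ge0 _) (cX 0).
have b0 : 0 <= b := le_trans (normr_ge0 _) (Sb 0).
have dcr := derive1_supp cr.
have s0 := smooth1N (smooth1M (smooth1_derive1 sc) sS); have s1 := smooth1M sc sS.
apply: (@decomp_intro rho (X * b) (\- (derive1 chi \* S)) (chi \* S) (fun=> 0) (chi \* derive1 S) s0 s1 (@smooth1_cst R 0)).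
- by move=> t rt; rewrite /= dcr// cr// !mul0r oppr0.
- by move=> t; rewrite /= normrN normr0 !normrM !ler_pM// mulr_ge0.
- move=> t; rewrite (_ : derive1 (derive1 (fun=> 0)) t = 0); last first.
    by have /(congr1 (fun F => F t)) := @derive1n_zero R 2.
  rewrite derive1_mul// /=.
  by move: (derive1 chi t) (chi t) (S t) (derive1 S t) => a1 a2 a3 a4; ring.
Qed.

Lemma derive1_mul2 f g : smooth1 f -> smooth1 g -> f \* derive1 (derive1 g) =
  fun t => derive1 (derive1 (f \* g)) t + derive1 (\- (fun x => 2 * (derive1 f \* g) x)) t
    + (derive1 (derive1 f) \* g) t.
Proof.
move=> sf sg; have sf1 := smooth1_derive1 sf; have sg1 := smooth1_derive1 sg.
have E1 t : derive1 (derive1 (f \* g)) t = derive1 (derive1 f) t * g t + 2 * (derive1 f t * derive1 g t)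
    + f t * derive1 (derive1 g) t.
  rewrite derive1_mul//.
  have d1 := smooth1_derivable (x := t) (smooth1M sf1 sg).
  have d2 := smooth1_derivable (x := t) (smooth1M sf sg1).
  rewrite derive1E (deriveD d1 d2) -!derive1E !derive1_mul//=.
  by move: (derive1 (derive1 f) t) (derive1 (derive1 g) t) (derive1 f t) (derive1 g t) (f t) (g t) => a1 a2 a3 a4 a5 a6; ring.
have E2 t : derive1 (\- (fun x => 2 * (derive1 f \* g) x)) t =
    - (2 * (derive1 (derive1 f) t * g t) + 2 * (derive1 f t * derive1 g t)).
  have d1 := smooth1_derivable (x := t) (smooth1M sf1 sg).
  rewrite derive1E deriveN; last exact: (@derivableZ _ _ _ (derive1 f \* g) 2).
  rewrite [X in - X](deriveZ 2 d1) -derive1E derive1_mul// /GRing.scale/=.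
  by move: (derive1 (derive1 f) t) (derive1 f t) (derive1 g t) (g t) => a1 a2 a3 a4; ring.
apply/funext => t; rewrite E1 E2 /=.
by move: (derive1 (derive1 f) t) (derive1 (derive1 g) t) (derive1 f t) (derive1 g t) (f t) (g t) => a1 a2 a3 a4 a5 a6; ring.
Qed.

(** From chi S'' = (chi S)'' - (2 chi' S)' + chi'' S; the factor 2 in the cost is that of the middle
    term. *)
Lemma decomp_derive2 chi S rho X b : smooth1 chi -> smooth1 S ->
  (forall t, rho < `|t| -> chi t = 0) ->
  (forall t, `|chi t| <= X) -> (forall t, `|derive1 chi t| <= X) ->
  (forall t, `|derive1 (derive1 chi) t| <= X) ->
  (forall t, `|S t| <= b) -> decomp rho (2 * X * b) (chi \* derive1 (derive1 S)).
Proof.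
move=> sc sS cr cX dcX ddcX Sb.
have X0 : 0 <= X := le_trans (normr_ge0 _) (cX 0).
have b0 : 0 <= b := le_trans (normr_ge0 _) (Sb 0).
have dcr := derive1_supp cr; have ddcr := derive1_supp dcr.
have sc1 := smooth1_derive1 sc; have sc2 := smooth1_derive1 sc1.
have H (y z : R) : `|y| <= X -> `|z| <= b -> `|y * z| <= 2 * X * b.
  move=> yX zb; rewrite normrM (@le_trans _ _ (X * b)) ?ler_pM//.
  by rewrite ?ler_wpM2r// ler_peMl// ler1n.
have s0 := smooth1M sc2 sS; have s1 := smooth1N (@smooth1Z R 2 _ (smooth1M sc1 sS)); have s2 := smooth1M sc sS.
apply: (@decomp_intro rho (2 * X * b) _ _ _ (chi \* derive1 (derive1 S)) s0 s1 s2).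
- by move=> t rt; rewrite /= ddcr// dcr// cr// !mul0r mulr0 oppr0.
- move=> t; split; [exact: H| |exact: H].
  by rewrite /= normrN normrM ger0_norm// -mulrA ler_wpM2l// normrM ler_pM.
- move=> t; rewrite (derive1_mul2 sc sS).
  by rewrite [RHS]addrC [X in _ = _ + X]addrC addrA.
Qed.

Record mollifier (eps : R) (y : R) (T : R -> R) : Prop := Mollifier {
  mollifier_smooth : smooth1 T;
  mollifier_ge0 : forall t, 0 <= T t;
  mollifier_supp : forall t, eps < `|t - y| -> T t = 0;
  mollifier_int : (\int[lebesgue_measure]_t (T t)%:E = 1)%E }.

(* A mollifier has a second antiderivative bounded independently of its width, and
   the difference of two mollifiers has one bounded by the distance of their
   centres; cutting these off gives the decompositions. *)
Lemma exists_mollifier (r : R) : 0 < r -> exists rho X : R, 0 < rho /\ 0 < X /\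
  forall eps, 0 < eps <= 1 -> exists T : R -> R -> R, [/\
    forall y, mollifier eps y (T y),
    forall y, `|y| <= r -> decomp rho X (T y) &
    forall y z, `|y| <= r -> `|z| <= r -> decomp rho (X * `|y - z|) (T y \- T z)].
Proof.
move=> r0; have [K [sK K0 K01 K1 K2]] := @smooth_step R.
have Kk : step_kernel K by [].
(* For eps <= 1 and |y| <= r the mollifier lives where |t| <= r + 1. There [chi] is 1, so
   multiplying by it changes nothing, while the antiderivatives become compactly supported. *)
have [chi [tchi chi0 chi1]] := @exists_cutoff (r + 1) (ltr_wpDl (ltW r0) ltr01).
have [M0 M00 HM0] := smooth1_bounded tchi.
have [M1 M10 HM1] := smooth1_bounded (ctest_derive1 tchi).
have [M2 M20 HM2] := smooth1_bounded (ctest_derive1 (ctest_derive1 tchi)).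
pose X := M0 + M1 + M2.
have H0 t : `|chi t| <= X by rewrite (le_trans (HM0 t))// /X -addrA lerDl addr_ge0// ltW.
have H1 t : `|derive1 chi t| <= X.
  by rewrite (le_trans (HM1 t))// /X addrAC lerDr addr_ge0// ltW.
have H2 t : `|derive1 (derive1 chi) t| <= X by rewrite (le_trans (HM2 t))// /X lerDr addr_ge0// ltW.
have X0 : 0 < X by rewrite !addr_gt0.
exists (r + 1 + 2), (2 * X); split; first by rewrite !addr_gt0.
split; first by rewrite mulr_gt0.
move=> eps /andP[e0 e1].
have sc : smooth1 chi by case: tchi.
(* The mollifier is S'', equal to K''((t - y)/eps)/eps. It is decomposed as the first derivative of
   S', which takes values in [0, 1]; a difference of mollifiers is decomposed as the second
   derivative of [S y - S z], which is at most |y - z| since K is 1-Lipschitz. Neither bound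
   involves eps. *)
pose S (y t : R) := eps * K (eps^-1 * t + (- eps^-1 * y)).
have sS y : smooth1 (S y).
  by apply: (@smooth1Z _ eps (fun t => K (eps^-1 * t + (- eps^-1 * y)))); exact: smooth1_affine.
have en : eps != 0 by rewrite gt_eqF.
have dS y : derive1 (S y) = fun t => derive1 K (eps^-1 * t + (- eps^-1 * y)).
  apply/funext => t.
  have := derive1_affine (smooth1_derivable (x := eps^-1 * t + - eps^-1 * y) sK) => ?.
  rewrite derive1E (_ : S y = eps \*: (fun t => K (eps^-1 * t + - eps^-1 * y)))//.
  by rewrite deriveZ// derive_val /GRing.scale/= mulrA mulfV// mul1r.
have ddS y : derive1 (derive1 (S y)) = fun t => eps^-1 * derive1 (derive1 K) (eps^-1 * t + (- eps^-1 * y)).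
  rewrite dS; apply/funext => t.
  have := derive1_affine (smooth1_derivable (x := eps^-1 * t + - eps^-1 * y) (smooth1_derive1 sK)) => ?.
  by rewrite derive1E derive_val.
have KL (c d : R) : `|K c - K d| <= `|c - d|.
  wlog cd : c d / d <= c.
    by move=> W; have [/W//|/ltW/W] := leP d c; rewrite distrC [leRHS]distrC.
  move: cd; rewrite le_eqVlt => /orP[/eqP ->|dc]; first by rewrite !subrr normr0.
  have dK (z : R) : z \in `]d, c[ -> is_derive z 1 K (derive1 K z).
    by move=> _; rewrite derive1E; apply: derivableP; exact: smooth1_derivable.
  have cK : {within `[d, c], continuous K} by apply: continuous_subspaceT; exact: smooth1_continuous.
  have [z _ ->] := MVT dc dK cK.
  have /andP[k0 k1] := K01 z.
  by rewrite normrM ger0_norm// ler_piMl.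
have SL y z t : `|S y t - S z t| <= `|y - z|.
  rewrite /S -mulrBr normrM gtr0_norm// mulrC -ler_pdivlMr//; apply: (le_trans (KL _ _)).
  rewrite (_ : _ - _ = eps^-1 * (z - y)); last by ring.
  by rewrite normrM gtr0_norm ?invr_gt0// mulrC distrC.
pose T y := derive1 (derive1 (S y)).
have Tsupp y t : eps < `|t - y| -> T y t = 0.
  move=> h; rewrite /T ddS (_ : derive1 (derive1 K) _ = 0) ?mulr0//.
  apply: (step_kernel_bump0 Kk); rewrite mulNr -mulrBr normrM gtr0_norm ?invr_gt0//.
  by rewrite mulrC ltr_pdivlMr// mul1r.
have Tchi' y t : `|y| <= r -> T y t = chi t * T y t.
  move=> yr; have [h|h] := ltP eps `|t - y|; first by rewrite Tsupp// mulr0.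
  rewrite chi1 ?mul1r//.
  have := ler_normD (t - y) y; rewrite subrK; lra.
have Tchi y : `|y| <= r -> T y = chi \* T y by move=> yr; apply/funext => t; exact: Tchi'.
exists T; split.
- move=> y; split.
  + exact: (smooth1_derive1 (smooth1_derive1 (sS y))).
  + move=> t; rewrite /T ddS mulr_ge0 ?invr_ge0 ?(ltW e0)//; have := K2 (eps^-1 * t + - eps^-1 * y).
    by rewrite derive1nS derive1n1.
  + exact: Tsupp.
  + pose F := derive1 (S y); have sF : smooth1 F := smooth1_derive1 (sS y).
    have ab : y - eps < y + eps by lra.
    have dF : derivable_oo_LRcontinuous F (y - eps) (y + eps).
      split.
      - by move=> z _; exact: smooth1_derivable.
      - by apply: cvg_at_right_filter; exact: smooth1_continuous.
      - by apply: cvg_at_left_filter; exact: smooth1_continuous.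
    have := @continuous_FTC2 R (T y) F _ _ ab (continuous_subspaceT (smooth1_continuous (smooth1_derive1 sF))) dF (fun z _ => erefl).
    have Fa : F (y - eps) = 0.
      rewrite /F dS; apply: (K0 _ _).2; rewrite mulrBr mulVf// mulNr; lra.
    have Fb : F (y + eps) = 1.
      rewrite /F dS; apply: K1; rewrite mulrDr mulVf// mulNr; lra.
    rewrite Fa Fb sube0 => <-; rewrite [RHS]integral_mkcond; apply: eq_integral => t _.
    rewrite patchE mem_setE in_itv/=; case: ifPn => // h.
    by rewrite Tsupp// ltNge ler_distl.
- move=> y yr; rewrite Tchi//.
  have -> : 2 * X = X * 2 * 1 by rewrite mulr1 mulrC.
  rewrite /T; have [u [u1 u2 u3 u4]] : decomp (r + 1 + 2) (X * 1) (chi \* derive1 (derive1 (S y))).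
    apply: (decomp_derive1 sc (smooth1_derive1 (sS y)) chi0 H0 H1).
    by move=> t; rewrite dS; have /andP[? ?] := K01 (eps^-1 * t + - eps^-1 * y); rewrite ger0_norm.
  exists u; split => // k t; rewrite (le_trans (u3 k t))// !mulr1 ler_peMr ?(ltW X0) ?ler1n//.
- move=> y z yr zr.
  have sSN : smooth1 (S y \- S z) := smooth1D (sS y) (smooth1N (sS z)).
  have dB (f g : R -> R) : smooth1 f -> smooth1 g -> derive1 (f \- g) = derive1 f \- derive1 g.
    move=> sf sg; apply/funext => t.
    have E := deriveB (smooth1_derivable sf : derivable f t 1) (smooth1_derivable sg : derivable g t 1).
    by rewrite derive1E [LHS]E -!derive1E.
  have -> : T y \- T z = chi \* derive1 (derive1 (S y \- S z)).
    rewrite (dB _ _ (sS y) (sS z)) (dB _ _ (smooth1_derive1 (sS y)) (smooth1_derive1 (sS z))).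
    apply/funext => t; change (T y t - T z t = chi t * (T y t - T z t)).
    by rewrite mulrBr -(Tchi' _ _ yr) -(Tchi' _ _ zr).
  exact: (decomp_derive2 sc sSN chi0 H0 H1 H2 (SL y z)).
Qed.

End kernels.

(** * Square-integrable weak derivatives and the classes [in_H] *)

Section weak_regularity.
Context {R : realType}.

Definition seq3 a b c : seq 'I_3 := nseq a 0 ++ nseq b 1 ++ nseq c 2.

Lemma partials_seq3 a b c (f g h : R -> R) : smooth1 f -> smooth1 g -> smooth1 h ->
  partials (seq3 a b c) (tensor f g h) = tensor (derive1n a f) (derive1n b g) (derive1n c h).
Proof.
move=> sf sg sh; rewrite partials_tensor// /seq3 !count_cat !count_nseq /=.
by rewrite !mul1n !mul0n !addn0 !add0n.
Qed.

Lemma Rintegral_bigsum (I : Type) (s : seq I) (F : I -> R3 R -> R) :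
  (forall i, leb3.-integrable setT (EFin \o F i)) ->
  leb3.-integrable setT (EFin \o (fun x => \sum_(i <- s) F i x)) /\
  \int[leb3]_x (\sum_(i <- s) F i x) = \sum_(i <- s) \int[leb3]_x F i x.
Proof.
move=> iF; elim: s => [|i s [IH1 IH2]].
  rewrite big_nil; have E : (fun x : R3 R => \sum_(i <- [::]) F i x) = cst 0.
    by apply/funext => x; rewrite big_nil.
  rewrite E; split; first exact: integrable0.
  by rewrite Rintegral_cst ?mul0r.
have E : (fun x : R3 R => \sum_(i <- i :: s) F i x) = (fun x => F i x + \sum_(i <- s) F i x).
  by apply/funext => x; rewrite big_cons.
split.
  by rewrite E; have := integrableD measurableT (iF i) IH1; apply: eq_integrable.
by rewrite E RintegralD// big_cons IH2.
Qed.

Lemma Rintegral_sum3_le (F : nat -> R3 R -> R) c :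
  (forall i, leb3.-integrable setT (EFin \o F i)) ->
  (forall i, (i <= 2)%N -> `|\int[leb3]_x F i x| <= c) ->
  `|\int[leb3]_x (\sum_(i < 3) F i x)| <= 3 * c.
Proof.
move=> iF Fc; rewrite (Rintegral_bigsum (index_enum 'I_3) (fun i : 'I_3 => iF i)).2 (le_trans (ler_norm_sum _ _ _))//.
apply: (@le_trans _ _ (\sum_(i < 3) c)); first by apply: ler_sum => i _; apply: Fc; rewrite -ltnS.
by rewrite sumr_const card_ord mulr_natl.
Qed.

Definition l2_bound (g : R3 R -> R) (B : R) := (\int[leb3]_x ((g x) ^+ 2)%:E <= (B ^+ 2)%:E)%E.

Lemma Lnorm2_l2_bound (g : R3 R -> R) B : 0 <= B ->
  ('N[leb3]_2%:E[EFin \o g] <= B%:E)%E -> l2_bound g B.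
Proof.
move=> B0 gB; rewrite /l2_bound.
have -> : (\int[leb3]_x ((g x) ^+ 2)%:E = 'N[leb3]_2%:E[EFin \o g] `^ 2)%E.
  rewrite poweR_Lnorm ?pnatr_eq0//; apply: eq_integral => x _ /=.
  by rewrite powR_mulrn// real_normK ?num_real.
have -> : (B ^+ 2)%:E = (B%:E `^ 2)%E by rewrite poweR_EFin powR_mulrn.
by apply: gt0_ler_poweR => //; rewrite in_itv/= ?leey ?andbT ?lee_fin ?B0 ?Lnorm_ge0.
Qed.

Lemma measurable_sqr (g : R3 R -> R) : measurable_fun setT g ->
  measurable_fun setT (fun x => ((g x) ^+ 2)%:E).
Proof. by move=> mg; apply/measurable_EFinP; exact: measurable_funX. Qed.

(** Young's inequality with the weight [B] does the work of Cauchy-Schwarz: |g| <= (g^2 + B^2) / B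
    on the cube, and integrating gives M B (1 + v), with [v] the volume of the cube. *)
Lemma cauchy_schwarz_cube (rho : R) : exists2 V, 0 < V &
  forall (g phi : R3 R -> R) B M, loc_integrable g -> 0 < B -> l2_bound g B ->
    measurable_fun setT phi -> (forall x, `|phi x| <= M) ->
    (forall x, rho < `|x| -> phi x = 0) -> `|\int[leb3]_x (g x * phi x)| <= V * B * M.
Proof.
pose v := fine (leb3 [set x : R3 R | (`|x| <= rho)%R]).
have vE : leb3 [set x : R3 R | (`|x| <= rho)%R] = v%:E.
  by rewrite /v fineK// ge0_fin_numE// leb3_cube_lty.
have v0 : 0 <= v by rewrite fine_ge0.
exists (v + 1); first by rewrite ltr_wpDl.
move=> g phi B M lg B0 gB mphi phiM phir.
have M0 : 0 <= M := le_trans (normr_ge0 _) (phiM 0).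
have ig := loc_integrable_mul lg mphi phiM phir.
have mg : measurable_fun setT g by case: lg.
have i1 : (\int[leb3]_x (\1_[set x : R3 R | (`|x| <= rho)%R] x)%:E = v%:E)%E.
  by rewrite integral_indic ?setIT//; exact: measurable_cube.
have m1 : measurable_fun setT (fun x : R3 R => (\1_[set x : R3 R | (`|x| <= rho)%R] x)%:E : \bar R).
  by apply/measurable_EFinP; apply: measurable_indic; exact: measurable_cube.
have i10 (x : R3 R) : 0 <= \1_[set x : R3 R | (`|x| <= rho)%R] x :> R by rewrite indicE; case: (_ \in _).
have mg2 := measurable_sqr mg.
have BM : 0 <= M / B by rewrite divr_ge0// ltW.
have MB : 0 <= M * B by rewrite mulr_ge0// ltW.
rewrite -lee_fin (@EFin_normr_Rintegral _ _ _ leb3)//.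
apply: (le_trans (le_abse_integral leb3 measurableT _)); first by case/integrableP: ig.
apply: (@le_trans _ _ (\int[leb3]_x ((M / B)%:E * ((g x) ^+ 2)%:E +
    (M * B)%:E * (\1_[set x : R3 R | (`|x| <= rho)%R] x)%:E))%E).
  apply: ge0_le_integral => //.
  - by apply: measurableT_comp => //; case/integrableP: ig.
  - by apply: emeasurable_funD; apply: measurable_funeM.
  - move=> x _; rewrite -!EFinM -EFinD /= lee_fin indicE mem_cube.
    have [xr|xr] := leP `|x| rho; last first.
      by rewrite phir// mulr0 normr0 mulr0 addr0 mulr_ge0// sqr_ge0.
    rewrite mulr1 normrM (@le_trans _ _ (`|g x| * M))// ?ler_wpM2l//.
    have -> : M / B * g x ^+ 2 + M * B = M / B * (`|g x| ^+ 2 + B ^+ 2).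
      by rewrite real_normK ?num_real// mulrDr; congr (_ + _); rewrite expr2 mulrA divfK// gt_eqF.
    rewrite (_ : `|g x| * M = M / B * (`|g x| * B)); last first.
      by rewrite mulrCA divfK// ?gt_eqF// mulrC.
    rewrite ler_wpM2l//; have := normr_ge0 (g x); move: B0; clear; nra.
rewrite ge0_integralD//; last 4 first.
- by move=> x _; rewrite -EFinM lee_fin mulr_ge0// sqr_ge0.
- exact: measurable_funeM.
- by move=> x _; rewrite -EFinM lee_fin mulr_ge0.
- exact: measurable_funeM.
rewrite ge0_integralZl//; last by move=> x _; rewrite lee_fin sqr_ge0.
rewrite ge0_integralZl//.
rewrite i1 (_ : (v + 1) * B * M = M / B * B ^+ 2 + M * B * v); last first.
  by rewrite expr2 mulrA divfK ?gt_eqF//; ring.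
by rewrite EFinD leeD// [leRHS]EFinM lee_wpmul2l// lee_fin.
Qed.

Lemma l2_boundD (g1 g2 : R3 R -> R) B1 B2 : measurable_fun setT g1 -> measurable_fun setT g2 ->
  0 <= B1 -> 0 <= B2 -> l2_bound g1 B1 -> l2_bound g2 B2 -> l2_bound (g1 \+ g2) (2 * (B1 + B2)).
Proof.
move=> m1 m2 B10 B20 H1 H2; rewrite /l2_bound.
have mg1 := measurable_sqr m1; have mg2 := measurable_sqr m2.
apply: (@le_trans _ _ (\int[leb3]_x (2%:E * ((g1 x) ^+ 2)%:E + 2%:E * ((g2 x) ^+ 2)%:E))%E).
  apply: ge0_le_integral => //.
  - by move=> x _; rewrite lee_fin sqr_ge0.
  - by apply: measurable_sqr; exact: measurable_funD.
  - by apply: emeasurable_funD; apply: measurable_funeM.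
  - move=> x _; rewrite -!EFinM -EFinD lee_fin /=.
    by have := sqr_ge0 (g1 x - g2 x); rewrite sqrrB sqrrD; lra.
rewrite ge0_integralD//; last 4 first.
- by move=> x _; rewrite -EFinM lee_fin mulr_ge0// sqr_ge0.
- exact: measurable_funeM.
- by move=> x _; rewrite -EFinM lee_fin mulr_ge0// sqr_ge0.
- exact: measurable_funeM.
rewrite !ge0_integralZl//; try by move=> x _; rewrite lee_fin sqr_ge0.
apply: (@le_trans _ _ (2%:E * (B1 ^+ 2)%:E + 2%:E * (B2 ^+ 2)%:E)%E).
  by rewrite leeD// lee_wpmul2l// lee_fin.
rewrite -!EFinM -EFinD lee_fin; nra.
Qed.

(** Two derivatives in each variable are what a tensor product of three [decomp] kernels can move
    onto [f]. The total order is 6, so this regularity is contained in H^6. *)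
Definition wreg (B : R) (f : R3 R -> R) := forall a b c, (a <= 2)%N -> (b <= 2)%N -> (c <= 2)%N ->
  exists2 g, is_wderiv (seq3 a b c) f g & l2_bound g B.

Lemma loc_integrable_scale c (f : R3 R -> R) : loc_integrable f -> loc_integrable (fun x => c * f x).
Proof.
move=> [mf fi]; split; first exact: measurable_funM.
move=> r; have := integrableZl (measurable_cube r) c (fi r).
by apply: eq_integrable => //; exact: measurable_cube.
Qed.

Lemma loc_integrableD (f g : R3 R -> R) : loc_integrable f -> loc_integrable g -> loc_integrable (f \+ g).
Proof.
move=> [mf fi] [mg gi]; split; first exact: measurable_funD.
move=> r; have := integrableD (measurable_cube r) (fi r) (gi r).
by apply: eq_integrable => //; exact: measurable_cube.
Qed.

Lemma compact_cube (r : R) : compact [set x : R3 R | `|x| <= r].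
Proof.
rewrite cubeE; have ci : compact [set x : R | `|x| <= r].
  rewrite (_ : [set _ | _] = [set` `[-r, r]]); first exact: segment_compact.
  by apply/seteqP; split => x; rewrite /= in_itv/= ler_norml.
by apply: compact_setX => //; exact: compact_setX.
Qed.

Lemma continuous_cube_bounded (f : R3 R -> R) (r : R) : continuous f ->
  exists2 M, 0 < M & forall x, `|x| <= r -> `|f x| <= M.
Proof.
move=> cf; have [|M [_ HM]] := @compact_bounded _ _ (f @` [set x : R3 R | `|x| <= r]).
  apply: continuous_compact; last exact: compact_cube.
  exact: continuous_subspaceT.
exists (`|M| + 1) => [|x xr]; first by rewrite ltr_wpDl.
apply: HM; last by exists x.
by rewrite (le_lt_trans (ler_norm M))// ltrDl.
Qed.

Lemma partial_supp i (f : R3 R -> R) (r : R) : (forall x, r < `|x| -> f x = 0) ->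
  forall x, r < `|x| -> partial i f x = 0.
Proof.
move=> fr x rx; rewrite /partial (near_eq_derive (g := (cst 0 : R3 R -> R))) ?derive_cst//.
near=> z; rewrite fr//; near: z.
have : open [set z : R3 R | r < `|z|].
  rewrite (_ : [set _ | _] = (fun z : R3 R => `|z|) @^-1` [set` `]r, +oo[]); last first.
    by apply/seteqP; split => z; rewrite /= in_itv/= andbT.
  apply: open_comp; last exact: interval_open.
  by move=> z _; exact: norm_continuous.
by rewrite openE; apply.
Unshelve. all: by end_near. Qed.

Lemma partials_supp s (f : R3 R -> R) (r : R) : (forall x, r < `|x| -> f x = 0) ->
  forall x, r < `|x| -> partials s f x = 0.
Proof. by move=> fr; elim: s => [//|i s IH] /=; exact: partial_supp. Qed.

Lemma test_partials s (phi : R3 R -> R) : test_function phi -> test_function (partials s phi).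
Proof.
move=> [sphi [r phir]]; split; last by exists r; exact: partials_supp.
by move=> s' x; rewrite /partials -foldr_cat; exact: sphi.
Qed.

Lemma test_integrable (f phi : R3 R -> R) : loc_integrable f -> test_function phi ->
  leb3.-integrable setT (EFin \o (f \* phi)).
Proof.
move=> lf [sphi [r phir]].
have cphi : continuous phi by move=> x; apply: differentiable_continuous; exact: (sphi [::] x).
have [M M0 HM'] := continuous_cube_bounded r cphi.
have HM x : `|phi x| <= M.
  by have [/HM'//|rx] := leP `|x| r; rewrite phir// normr0 ltW.
exact: (loc_integrable_mul lf (continuous_measurable_R3 cphi) HM phir).
Qed.

Lemma is_wderivD s (f1 f2 g1 g2 : R3 R -> R) : is_wderiv s f1 g1 -> is_wderiv s f2 g2 ->
  is_wderiv s (f1 \+ f2) (g1 \+ g2).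
Proof.
move=> [lf1 lg1 H1] [lf2 lg2 H2]; split; [exact: loc_integrableD..|].
move=> phi tphi; have tp := test_partials s tphi.
transitivity (\int[leb3]_x (f1 x * partials s phi x) + \int[leb3]_x (f2 x * partials s phi x)).
  rewrite -RintegralD//; [|exact: test_integrable..].
  by apply: eq_Rintegral => x _ /=; rewrite mulrDl.
rewrite H1// H2// -mulrDr -RintegralD//; [|exact: test_integrable..].
by congr (_ * _); apply: eq_Rintegral => x _ /=; rewrite mulrDl.
Qed.

Lemma is_wderivZ s c (f g : R3 R -> R) : is_wderiv s f g ->
  is_wderiv s (fun x => c * f x) (fun x => c * g x).
Proof.
move=> [lf lg H]; split; [exact: loc_integrable_scale..|].
move=> phi tphi; have tp := test_partials s tphi.
transitivity (c * \int[leb3]_x (f x * partials s phi x)).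
  rewrite -RintegralZl//; last exact: test_integrable.
  by apply: eq_Rintegral => x _ /=; rewrite mulrA.
rewrite H// mulrCA -RintegralZl//; last exact: test_integrable.
by congr (_ * _); apply: eq_Rintegral => x _ /=; rewrite mulrA.
Qed.

Lemma wregD B1 B2 (f1 f2 : R3 R -> R) : 0 <= B1 -> 0 <= B2 -> wreg B1 f1 -> wreg B2 f2 ->
  wreg (2 * (B1 + B2)) (f1 \+ f2).
Proof.
move=> B10 B20 w1 w2 a b c a2 b2 c2.
have [g1 d1 l1] := w1 a b c a2 b2 c2; have [g2 d2 l2] := w2 a b c a2 b2 c2.
exists (g1 \+ g2); first exact: is_wderivD.
by apply: l2_boundD => //; [case: d1 => _ [] | case: d2 => _ []].
Qed.

Lemma is_wderiv_wderiv s (f g : R3 R -> R) : is_wderiv s f g -> is_wderiv s f (wderiv s f).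
Proof. by move=> d; exact: (@xgetPex _ (fun=> 0) [set g | is_wderiv s f g] (ex_intro _ g d)). Qed.

Lemma mseq_seq3 m (a : mindex m) : mseq a = seq3 (a 0) (a 1) (a 2).
Proof.
rewrite /mseq /seq3 !enum_ordSl enum_ord0 /= cats0.
have e0 : ord0 = 0 :> 'I_3 by exact: val_inj.
have e1 : lift ord0 ord0 = 1 :> 'I_3 by exact: val_inj.
have e2 : lift ord0 (lift ord0 ord0) = 2 :> 'I_3 by exact: val_inj.
by rewrite e2 e1 e0.
Qed.

Lemma seq3_mindex m a b c : (6 <= m)%N -> (a <= 2)%N -> (b <= 2)%N -> (c <= 2)%N ->
  exists2 al : mindex m, (mlength al <= m)%N & mseq al = seq3 a b c.
Proof.
move=> m6 a2 b2 c2.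
exists [ffun i : 'I_3 => inord (nth 0%N [:: a; b; c] i)].
  rewrite /mlength !big_ord_recl big_ord0 !ffunE /= !inordK ?addn0; last 3 first.
  - by rewrite ltnS (leq_trans c2)// (leq_trans _ m6).
  - by rewrite ltnS (leq_trans b2)// (leq_trans _ m6).
  - by rewrite ltnS (leq_trans a2)// (leq_trans _ m6).
  by rewrite (leq_trans _ m6)// (leq_add a2 (leq_add b2 c2)).
rewrite mseq_seq3 !ffunE /= !inordK//.
- by rewrite ltnS (leq_trans c2)// (leq_trans _ m6).
- by rewrite ltnS (leq_trans b2)// (leq_trans _ m6).
- by rewrite ltnS (leq_trans a2)// (leq_trans _ m6).
Qed.

Lemma in_H_wreg m n (w : R3 R -> 'rV[R]_n) i : (6 <= m)%N -> in_H m w ->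
  exists2 B, 0 < B & wreg B (component w i).
Proof.
move=> m6 wH.
have H a b c : exists B, 0 < B /\ ((a <= 2)%N -> (b <= 2)%N -> (c <= 2)%N ->
    exists2 g, is_wderiv (seq3 a b c) (component w i) g & l2_bound g B).
  have [/and3P[a2 b2 c2]|] := boolP [&& (a <= 2)%N, (b <= 2)%N & (c <= 2)%N]; last first.
    by move=> h; exists 1; split => // a2 b2 c2; move: h; rewrite a2 b2 c2.
  have [al alm alE] := seq3_mindex m6 a2 b2 c2.
  have [g dg gL] := wH i al alm; rewrite alE in dg.
  have /Lfun2_integrable_sqr ig := gL.
  exists (fine (\int[leb3]_x ((g x) ^+ 2)%:E) + 1).
  have I0 : (0 <= \int[leb3]_x ((g x) ^+ 2)%:E)%E.
    by apply: integral_ge0 => x _; rewrite lee_fin sqr_ge0.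
  split; first by rewrite ltr_wpDl// fine_ge0.
  move=> _ _ _; exists g => //; rewrite /l2_bound.
  set I := (\int[leb3]_x ((g x) ^+ 2)%:E)%E in I0 *.
  have fI : I \is a fin_num by apply: integrable_fin_num.
  rewrite -(fineK fI) lee_fin; rewrite /=.
  have : 0 <= fine I by rewrite fine_ge0.
  by move: (fine I) => z z0; nra.
have /choice[B HB] : forall t : 'I_3 * 'I_3 * 'I_3, exists B, 0 < B /\
    (exists2 g, is_wderiv (seq3 t.1.1 t.1.2 t.2) (component w i) g & l2_bound g B).
  move=> t; have [B [B0 HB]] := H t.1.1 t.1.2 t.2; exists B; split => //.
  by apply: HB; rewrite -ltnS.
exists (\sum_t B t + 1).
  by rewrite ltr_wpDl// sumr_ge0// => t _; apply: ltW; case: (HB t).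
move=> a b c a2 b2 c2.
pose t : 'I_3 * 'I_3 * 'I_3 := (inord a, inord b, inord c).
have [B0 [g dg gB]] := HB t; exists g.
  by move: dg; rewrite /t /= !inordK.
apply: (le_trans gB); rewrite lee_fin ler_pXn2r ?nnegrE//; last 2 first.
- exact: ltW.
- by rewrite addr_ge0// sumr_ge0// => u _; apply: ltW; case: (HB u).
rewrite (bigD1 t)//= -addrA lerDl addr_ge0// sumr_ge0// => u _; apply: ltW; by case: (HB u).
Qed.

Lemma Hnorm_wreg m n (w : R3 R -> 'rV[R]_n) i B : (6 <= m)%N -> in_H m w -> 0 <= B ->
  (Hnorm m w <= B%:E)%E -> wreg B (component w i).
Proof.
move=> m6 wH B0 wB a b c a2 b2 c2.
have [al alm alE] := seq3_mindex m6 a2 b2 c2.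
have [g dg _] := wH i al alm.
exists (wderiv (mseq al) (component w i)).
  by rewrite -alE; exact: is_wderiv_wderiv dg.
apply: Lnorm2_l2_bound => //; apply: le_trans wB; rewrite /Hnorm.
set N := ('N[leb3]_2%:E[EFin \o wderiv (mseq al) (component w i)])%E.
have N0 : (0 <= N)%E by exact: Lnorm_ge0.
have NE : N = ((N `^ 2) `^ 2^-1)%E by rewrite -poweRrM mulfV ?pnatr_eq0// poweRe1.
rewrite NE.
apply: gt0_ler_poweR => //; rewrite ?in_itv/= ?leey ?andbT ?poweR_ge0//.
  by apply: sume_ge0 => j _; apply: sume_ge0 => d _; exact: poweR_ge0.
rewrite (bigD1 i)//= (bigD1 al)//= -addeA leeDl// adde_ge0//.
  by apply: sume_ge0 => d _; exact: poweR_ge0.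
by apply: sume_ge0 => j _; apply: sume_ge0 => d _; exact: poweR_ge0.
Qed.

End weak_regularity.

(** * Sobolev bounds on cubes by duality *)

Section sobolev.
Context {R : realType}.

(** Expanding each kernel into its three derivative terms gives 27 integrals. In each the
    derivatives are moved onto [f], and what remains is a bounded function with compact support. *)
Lemma decomp_tensor_bound (rho : R) : exists2 V, 0 < V &
  forall (f : R3 R -> R) B b1 b2 b3 T1 T2 T3, 0 < B -> wreg B f ->
    decomp rho b1 T1 -> decomp rho b2 T2 -> decomp rho b3 T3 ->
    `|\int[leb3]_x (f x * tensor T1 T2 T3 x)| <= V * B * (b1 * b2 * b3).
Proof.
have [V V0 HV] := @cauchy_schwarz_cube R rho.
exists (3 * (3 * (3 * V))); first by rewrite !mulr_gt0.
move=> f B b1 b2 b3 T1 T2 T3 B0 wf [u1 [s1 z1 l1 e1]] [u2 [s2 z2 l2 e2]] [u3 [s3 z3 l3 e3]].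
have ct u : smooth1 u -> (forall t : R, rho < `|t| -> u t = 0) -> ctest u by move=> su zu; split => //; exists rho.
have c1 k := ct _ (s1 k) (z1 k); have c2 k := ct _ (s2 k) (z2 k); have c3 k := ct _ (s3 k) (z3 k).
pose G i j k (x : R3 R) : R := f x * tensor (derive1n i (u1 i)) (derive1n j (u2 j)) (derive1n k (u3 k)) x.
have [_ [lf _ _] _] := wf 0%N 0%N 0%N isT isT isT.
have iG i j k : leb3.-integrable setT (EFin \o G i j k).
  by apply: test_integrable => //; apply: test_tensor; exact: ctest_derive1n.
have bG i j k : (i <= 2)%N -> (j <= 2)%N -> (k <= 2)%N -> `|\int[leb3]_x G i j k x| <= V * B * (b1 * b2 * b3).
  move=> i2 j2 k2; have [g [_ lg H] gB] := wf i j k i2 j2 k2.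
  have tt : test_function (tensor (u1 i) (u2 j) (u3 k)) by exact: test_tensor.
  have := H _ tt; rewrite partials_seq3// => ->.
  rewrite normrM normrX normrN1 expr1n mul1r; apply: (HV) => //.
  - by apply: continuous_measurable_R3; apply: tensor_continuous; exact: smooth1_continuous.
  - by move=> x; rewrite !normrM !ler_pM// mulr_ge0.
  - move=> x; rewrite normR3 !lt_max -orbA /tensor => /or3P[] hx.
    + by rewrite z1 ?mul0r.
    + by rewrite z2 ?mulr0 ?mul0r.
    + by rewrite z3 ?mulr0.
have i1 i j : leb3.-integrable setT (EFin \o (fun x => \sum_(k < 3) G i j k x)).
  exact: (Rintegral_bigsum (index_enum 'I_3) (fun k : 'I_3 => iG i j k)).1.
have i2 i : leb3.-integrable setT (EFin \o (fun x => \sum_(j < 3) \sum_(k < 3) G i j k x)).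
  exact: (Rintegral_bigsum (index_enum 'I_3) (fun j : 'I_3 => i1 i j)).1.
have -> : \int[leb3]_x (f x * tensor T1 T2 T3 x) =
    \int[leb3]_x (\sum_(i < 3) \sum_(j < 3) \sum_(k < 3) G i j k x).
  apply: eq_Rintegral => x _; rewrite /tensor e1 e2 e3 -mulrA mulr_suml mulr_sumr.
  apply: eq_bigr => i _; rewrite mulr_suml !mulr_sumr.
  apply: eq_bigr => j _; rewrite !mulr_sumr.
  by apply: eq_bigr => k _; rewrite /G /tensor; ring.
rewrite (_ : _ * B * _ = 3 * (3 * (3 * (V * B * (b1 * b2 * b3))))); last by ring.
apply: (Rintegral_sum3_le (F := fun i x => \sum_(j < 3) \sum_(k < 3) G i j k x)) => // i hi.
apply: (Rintegral_sum3_le (F := fun j x => \sum_(k < 3) G i j k x)) => // j hj.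
by apply: (Rintegral_sum3_le (F := fun k x => G i j k x)) => // k hk; exact: bG.
Qed.

Lemma sigma_finite_lebesgue2 :
  sigma_finite setT (lebesgue_measure \x lebesgue_measure : set (measurableTypeR R * measurableTypeR R) -> \bar R)%E.
Proof.
exists (fun n => ([set` `[-n%:R, n%:R]] : set (measurableTypeR R)) `*` ([set` `[-n%:R, n%:R]] : set (measurableTypeR R))).
  apply/esym/seteqP; split => // x _; exists (Num.bound `|x|) => //.
  have h : `|x| <= (Num.bound `|x|)%:R by rewrite ltW// archi_boundP.
  by move: h; rewrite prod_normE ge_max => /andP[h1 h2]; split => /=; rewrite in_itv/= -ler_norml.
move=> n; split; first exact: measurableX.
rewrite product_measure1E//.
by rewrite lte_mul_pinfty ?ge0_fin_numE//= lebesgue_measure_itv/= lte_fin; case: ifP => // _; rewrite -EFinB ltry.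
Qed.

Lemma integral_prod3 (F : R3 R -> \bar R) :
  measurable_fun setT F -> (forall x, (0 <= F x)%E) ->
  (\int[leb3]_x F x = \int[lebesgue_measure \x lebesgue_measure]_x \int[lebesgue_measure]_y F (x, y))%E.
Proof.
move=> mF F0.
pose sf : {sigma_finite_measure set (measurableTypeR R * measurableTypeR R)%type -> \bar R} :=
  HB.pack (lebesgue_measure \x lebesgue_measure)%E (Measure_isSigmaFinite.Build _ _ _ (lebesgue_measure \x lebesgue_measure)%E sigma_finite_lebesgue2).
exact: (@fubini_tonelli1 _ _ _ _ R sf (@lebesgue_measure R) F mF F0).
Qed.

Lemma integral_tensor_mollifier eps y (T1 T2 T3 : R -> R) :
  mollifier eps y.1.1 T1 -> mollifier eps y.1.2 T2 -> mollifier eps y.2 T3 ->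
  (\int[leb3]_x (tensor T1 T2 T3 x)%:E = 1)%E.
Proof.
move=> [s1 p1 _ i1] [s2 p2 _ i2] [s3 p3 _ i3].
have c1 := smooth1_continuous s1; have c2 := smooth1_continuous s2; have c3 := smooth1_continuous s3.
pose f12 (z : measurableTypeR R * measurableTypeR R) : \bar R := (T1 z.1 * T2 z.2)%:E.
have m (T : R -> R) : continuous T -> measurable_fun setT (T : measurableTypeR R -> R).
  by move=> cT; exact: continuous_measurable_fun.
have m12 : measurable_fun setT f12.
  apply/measurable_EFinP; apply: measurable_funM; apply: measurableT_comp => //; exact: m.
have f120 z : (0 <= f12 z)%E by rewrite lee_fin mulr_ge0.
have I12 : (\int[lebesgue_measure \x lebesgue_measure]_z f12 z = 1)%E.
  rewrite (fubini_tonelli1 f12)// /fubini_F /f12/= -[RHS]i1.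
  apply: eq_integral => x _; under eq_integral do rewrite EFinM.
  rewrite ge0_integralZl//; first by rewrite i2 mule1.
  - by apply/measurable_EFinP; exact: m.
  - by move=> t _; rewrite lee_fin.
  - by rewrite lee_fin.
pose F (x : R3 R) : \bar R := (tensor T1 T2 T3 x)%:E.
have mF : measurable_fun setT F.
  by apply/measurable_EFinP; exact: continuous_measurable_R3 (tensor_continuous c1 c2 c3).
have F0 x : (0 <= F x)%E by rewrite lee_fin !mulr_ge0.
transitivity (\int[lebesgue_measure \x lebesgue_measure]_x \int[lebesgue_measure]_y F (x, y))%E.
  exact: (integral_prod3 mF F0).
rewrite -I12; apply: eq_integral => x _.
rewrite /F /tensor /f12 /=; under eq_integral do rewrite EFinM.
rewrite ge0_integralZl//; first by rewrite i3 mule1.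
- by apply/measurable_EFinP; exact: m.
- by move=> t _; rewrite lee_fin.
- by rewrite lee_fin mulr_ge0.
Qed.

Lemma mollify_near (f : R3 R -> R) (y : R3 R) (e : R) : loc_integrable f -> continuous f -> 0 < e ->
  exists2 eps, 0 < eps <= 1 & forall T1 T2 T3,
    mollifier eps y.1.1 T1 -> mollifier eps y.1.2 T2 -> mollifier eps y.2 T3 ->
    `|\int[leb3]_x (f x * tensor T1 T2 T3 x) - f y| <= e.
Proof.
move=> lf cf e0.
have /cvgrPdist_le/(_ _ e0) := cf y.
move/nbhs_ballP => [d /= d0 Hd].
exists (Num.min 1 (d / 2)); first by rewrite lt_min ltr01 divr_gt0//= ge_min lexx.
set eps := Num.min _ _ => T1 T2 T3 m1 m2 m3.
have ed : eps < d.
  by rewrite (@le_lt_trans _ _ (d / 2))// ?ge_min ?lexx ?orbT// ltr_pdivrMr//; move: d0; rewrite /=; lra.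
have eps0 : 0 < eps by rewrite lt_min ltr01 divr_gt0.
have ct t T : mollifier eps t T -> ctest T.
  move=> [sT _ zT _]; split => //; exists (`|t| + eps) => s hs; apply: zT.
  by have := ler_normB t (t - s); rewrite subKr distrC => h; move: hs; rewrite distrC in h *; lra.
have c1 := ct _ _ m1; have c2 := ct _ _ m2; have c3 := ct _ _ m3.
have tt := test_tensor c1 c2 c3.
have I1 := integral_tensor_mollifier m1 m2 m3.
have iT : leb3.-integrable setT (EFin \o tensor T1 T2 T3).
  have := test_integrable (loc_integrable_cst 1) tt.
  by apply: eq_integrable => // x _ /=; rewrite mul1r.
have iF := test_integrable lf tt.
have ifT : leb3.-integrable setT (EFin \o (fun x => f y * tensor T1 T2 T3 x)).
  exact: (test_integrable (loc_integrable_cst (f y)) tt).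
have -> : f y = \int[leb3]_x (f y * tensor T1 T2 T3 x).
  rewrite RintegralZl// /Rintegral; move: I1 => /= -> /=; by rewrite mulr1.
rewrite -RintegralB//.
rewrite -lee_fin EFin_normr_Rintegral//; last first.
  by have := integrableB measurableT iF ifT; apply: eq_integrable.
apply: (le_trans (le_abse_integral leb3 measurableT _)).
  apply/measurable_EFinP; apply: measurable_funB; by [case/integrableP: iF => /measurable_EFinP | case/integrableP: ifT => /measurable_EFinP].
have mT : measurable_fun setT (fun x => (tensor T1 T2 T3 x)%:E) by case/integrableP: iT.
have T0 (x : R3 R) : 0 <= tensor T1 T2 T3 x.
  by rewrite /tensor !mulr_ge0//; [case: m1|case: m2|case: m3].
apply: (@le_trans _ _ (\int[leb3]_x (e%:E * (tensor T1 T2 T3 x)%:E))%E).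
  apply: ge0_le_integral => //.
  - apply: measurableT_comp => //; apply/measurable_EFinP; apply: measurable_funB; by [case/integrableP: iF => /measurable_EFinP | case/integrableP: ifT => /measurable_EFinP].
  - exact: measurable_funeM.
  - move=> x _; rewrite -EFinM /= lee_fin -mulrBl normrM (ger0_norm (T0 x)).
    have [H|H] := leP `|y - x| eps.
      by rewrite ler_wpM2r// distrC; apply: Hd; rewrite -ball_normE /ball_/= (le_lt_trans H).
    suff -> : tensor T1 T2 T3 x = 0 by rewrite !mulr0.
    move: H; rewrite normR3 !lt_max -orbA /tensor => /or3P[] hx.
    + by rewrite (mollifier_supp m1) ?mul0r// distrC.
    + by rewrite (mollifier_supp m2) ?mulr0 ?mul0r// distrC.
    + by rewrite (mollifier_supp m3) ?mulr0// distrC.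
rewrite ge0_integralZl//; last 2 first.
- by move=> x _; rewrite lee_fin.
- by rewrite lee_fin ltW.
by rewrite I1 mule1.
Qed.

(** Averages of [f] against products of mollifiers are bounded independently of the width, and tend
    to the value of [f] as the width shrinks. Increments are treated in the same way, which yields a
    Lipschitz bound. *)
Lemma sobolev_cube (r : R) : 0 < r -> exists2 C, 0 < C &
  forall (f : R3 R -> R) B, continuous f -> 0 < B -> wreg B f ->
    (forall y, `|y| <= r -> `|f y| <= C * B) /\
    (forall y z, `|y| <= r -> `|z| <= r -> `|f y - f z| <= C * B * `|y - z|).
Proof.
move=> r0; have [rho [X [rho0 [X0 HX]]]] := exists_mollifier r0.
have [V V0 HV] := decomp_tensor_bound rho.
exists (3 * (V * X ^+ 3)); first by rewrite !mulr_gt0// exprn_gt0.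
move=> f B cf B0 wf; have [_ [lf _ _] _] := wf 0%N 0%N 0%N isT isT isT.
have P0 : 0 < V * X ^+ 3 * B by rewrite !mulr_gt0// exprn_gt0.
have eval e y z : 0 < e -> exists T : R -> R -> R, [/\
    (forall t : R, `|t| <= r -> decomp rho X (T t)) /\ (forall t : R, ctest (T t)),
    (forall s t : R, `|s| <= r -> `|t| <= r -> decomp rho (X * `|s - t|) (T s \- T t)),
    leb3.-integrable setT (EFin \o (f \* tensor (T y.1.1) (T y.1.2) (T y.2))) /\
    leb3.-integrable setT (EFin \o (f \* tensor (T z.1.1) (T z.1.2) (T z.2))),
    `|\int[leb3]_x (f x * tensor (T y.1.1) (T y.1.2) (T y.2) x) - f y| <= e &
    `|\int[leb3]_x (f x * tensor (T z.1.1) (T z.1.2) (T z.2) x) - f z| <= e].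
  move=> e0.
  have [d1 /andP[d10 d11] H1] := mollify_near y lf cf e0.
  have [d2 /andP[d20 d21] H2] := mollify_near z lf cf e0.
  (* The same width serves both points, as the difference of two mollifiers is only controlled for
     equal widths. *)
  have [|T [mT T1 T2]] := HX (Num.min d1 d2).
    by rewrite lt_min d10 d20/= ge_min d11.
  have mono d t : Num.min d1 d2 <= d -> mollifier d t (T t).
    move=> hd; have [sT pT zT iT] := mT t; split => // s hs; apply: zT.
    exact: (le_lt_trans hd).
  have L1 : Num.min d1 d2 <= d1 by rewrite ge_min lexx.
  have L2 : Num.min d1 d2 <= d2 by rewrite ge_min lexx orbT.
  have ct t : ctest (T t).
    have [sT _ zT _] := mT t; split => //; exists (`|t| + Num.min d1 d2) => s hs; apply: zT.
    by move: hs; have := ler_normB s t; have := ler_normD (s - t) t; rewrite subrK; lra.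
  exists T; split => //.
  - by split; apply: test_integrable => //; apply: test_tensor.
  - by apply: H1; apply: mono.
  - by apply: H2; apply: mono.
split => [y yr|y z yr zr].
  move: (yr); rewrite normR3_le => /and3P[y1 y2 y3].
  apply/ler_addgt0Pr => e e0; have [T [[T1 _] _ _ Ty _]] := eval e y y e0.
  have := HV _ _ _ _ _ _ _ _ B0 wf (T1 _ y1) (T1 _ y2) (T1 _ y3).
  have := P0; move: Ty; set I := \int[leb3]_x _; rewrite (_ : X * X * X = X ^+ 3); last by ring.
  have := ler_normB I (I - f y); rewrite subKr.
  rewrite [V * B * _]mulrAC (_ : 3 * _ * B = 3 * (V * X ^+ 3 * B)); last by ring.
  move: (V * X ^+ 3 * B) `|_ - _| `|I| `|f y| => Q a b c; lra.
move: (yr) (zr); rewrite !normR3_le => /and3P[y1 y2 y3] /and3P[z1 z2 z3].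
have : `|y - z| <= `|y - z| by [].
rewrite {1}normR3_le => /and3P[n1 n2 n3].
apply/ler_addgt0Pr => e0 e00.
have e0' : 0 < e0 / 2 by rewrite divr_gt0.
have [T [[T1 Tc] T2 [iy iz] Ty Tz]] := eval _ y z e0'.
(* The difference of the two products telescopes through one coordinate at a time, so each term has
   exactly one factor of size |y - z|. *)
pose D1 := tensor (T y.1.1 \- T z.1.1) (T y.1.2) (T y.2).
pose D2 := tensor (T z.1.1) (T y.1.2 \- T z.1.2) (T y.2).
pose D3 := tensor (T z.1.1) (T z.1.2) (T y.2 \- T z.2).
have H1 := HV _ _ _ _ _ _ _ _ B0 wf (T2 _ _ y1 z1) (T1 _ y2) (T1 _ y3).
have H2 := HV _ _ _ _ _ _ _ _ B0 wf (T1 _ z1) (T2 _ _ y2 z2) (T1 _ y3).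
have H3 := HV _ _ _ _ _ _ _ _ B0 wf (T1 _ z1) (T1 _ z2) (T2 _ _ y3 z3).
rewrite -/D1 in H1; rewrite -/D2 in H2; rewrite -/D3 in H3.
have bd (I b1 b2 b3 : R) : `|I| <= V * B * (b1 * b2 * b3) ->
    b1 * b2 * b3 <= X ^+ 3 * `|y - z| -> `|I| <= V * X ^+ 3 * B * `|y - z|.
  move=> h1 h2; apply: (le_trans h1); rewrite (_ : V * X ^+ 3 * B * _ = V * B * (X ^+ 3 * `|y - z|)); last by ring.
  by rewrite ler_wpM2l// mulr_ge0// ltW.
have X30 : 0 <= X ^+ 3 by rewrite exprn_ge0// ltW.
have {}H1 := bd _ _ _ _ H1; have {}H2 := bd _ _ _ _ H2; have {}H3 := bd _ _ _ _ H3.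
have {}H1 : `|\int[leb3]_x (f x * D1 x)| <= V * X ^+ 3 * B * `|y - z|.
  by apply: H1; rewrite (_ : _ * X * X = X ^+ 3 * `|y.1.1 - z.1.1|); [rewrite ler_wpM2l|ring].
have {}H2 : `|\int[leb3]_x (f x * D2 x)| <= V * X ^+ 3 * B * `|y - z|.
  by apply: H2; rewrite (_ : X * _ * X = X ^+ 3 * `|y.1.2 - z.1.2|); [rewrite ler_wpM2l|ring].
have {}H3 : `|\int[leb3]_x (f x * D3 x)| <= V * X ^+ 3 * B * `|y - z|.
  by apply: H3; rewrite (_ : X * X * _ = X ^+ 3 * `|y.2 - z.2|); [rewrite ler_wpM2l|ring].
have ct t : ctest (T t) by exact: Tc.
have cD s t : ctest (T s \- T t).
  have [sT [r1 zT]] := ct s; have [sT' [r2 zT']] := ct t.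
  split; first by exact: smooth1D sT (smooth1N sT').
  exists (Num.max r1 r2) => u; rewrite gt_max => /andP[u1 u2] /=.
  by rewrite zT// zT'// subrr.
have iD1 : leb3.-integrable setT (EFin \o (f \* D1)) by exact: (test_integrable lf (test_tensor (cD _ _) (ct _) (ct _))).
have iD2 : leb3.-integrable setT (EFin \o (f \* D2)) by exact: (test_integrable lf (test_tensor (ct _) (cD _ _) (ct _))).
have iD3 : leb3.-integrable setT (EFin \o (f \* D3)) by exact: (test_integrable lf (test_tensor (ct _) (ct _) (cD _ _))).
have E : \int[leb3]_x (f x * tensor (T y.1.1) (T y.1.2) (T y.2) x) - \int[leb3]_x (f x * tensor (T z.1.1) (T z.1.2) (T z.2) x) =
    \int[leb3]_x (f x * D1 x) + \int[leb3]_x (f x * D2 x) + \int[leb3]_x (f x * D3 x).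
  have iD12 : leb3.-integrable setT (EFin \o (fun x => f x * D1 x + f x * D2 x)).
    by have := integrableD measurableT iD1 iD2; apply: eq_integrable.
  rewrite -RintegralB// -RintegralD// -RintegralD//.
  by apply: eq_Rintegral => x _; rewrite /D1 /D2 /D3 /tensor /=; ring.
have A1 := ler_normB (f y - f z - (\int[leb3]_x (f x * D1 x) + \int[leb3]_x (f x * D2 x) + \int[leb3]_x (f x * D3 x))) (- (\int[leb3]_x (f x * D1 x) + \int[leb3]_x (f x * D2 x) + \int[leb3]_x (f x * D3 x))).
have A2 := ler_normD (\int[leb3]_x (f x * D1 x) + \int[leb3]_x (f x * D2 x)) (\int[leb3]_x (f x * D3 x)).
have A3 := ler_normD (\int[leb3]_x (f x * D1 x)) (\int[leb3]_x (f x * D2 x)).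
rewrite -E in A1 A2; rewrite normrN opprK subrK in A1.
set Iy := (X in `|_ - _ - (X - _)|) in A1 Ty; set Iz := (X in `|_ - _ - (_ - X)|) in A1 Tz.
have A4 := ler_normB (f y - Iy) (f z - Iz).
rewrite (_ : f y - Iy - (f z - Iz) = f y - f z - (Iy - Iz)) in A4; last by ring.
rewrite distrC in Ty; rewrite distrC in Tz.
rewrite (_ : 3 * _ * B * _ = 3 * (V * X ^+ 3 * B * `|y - z|)); last by ring.
move: (V * X ^+ 3 * B * `|y - z|) H1 H2 H3 A1 A2 A3 A4 Ty Tz; rewrite -/Iy -/Iz => Q; lra.
Qed.
End sobolev.

(** * From Sobolev norms to uniform estimates on cubes *)

Section cube_estimates.
Context {R : realType}.

Lemma differentiable_component n (w : R3 R -> 'rV[R]_n) i x :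
  differentiable w x -> differentiable (component w i) x.
Proof.
move=> dw; apply: (@differentiable_comp _ _ _ _ w (fun M : 'rV[R]_n => M 0 i) x dw).
exact: differentiable_coord.
Qed.

Lemma partial_component n (w : R3 R -> 'rV[R]_n) i j x :
  derivable w x (unit_vec j) -> partial j w x 0 i = partial j (component w i) x.
Proof. by move=> dw; rewrite /partial derive_mx ?mxE. Qed.

Lemma Lfun2_lin c (f g : R3 R -> R) : f \in Lfun leb3 2%:E -> g \in Lfun leb3 2%:E ->
  (fun x => c * f x + g x) \in Lfun leb3 2%:E.
Proof.
move=> lf lg; have p1 : (1 <= 2%:E :> \bar R)%E by rewrite lee_fin ler1n.
exact: ((@Lfun_submod_closed _ _ _ leb3 _ p1).2 c f g lf lg).
Qed.

Lemma in_H_lin m n c (w1 w2 : R3 R -> 'rV[R]_n) : in_H m w1 -> in_H m w2 ->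
  in_H m (fun x => c *: w1 x + w2 x).
Proof.
move=> h1 h2 i a am; have [g1 d1 l1] := h1 i a am; have [g2 d2 l2] := h2 i a am.
exists ((fun x => c * g1 x) \+ g2); last exact: Lfun2_lin.
have -> : component (fun x => c *: w1 x + w2 x) i = (fun x => c * component w1 i x) \+ component w2 i.
  by apply/funext => x; rewrite /component /= !mxE.
by apply: is_wderivD => //; exact: is_wderivZ.
Qed.

Lemma in_HB m n (w1 w2 : R3 R -> 'rV[R]_n) : in_H m w1 -> in_H m w2 ->
  in_H m (fun x => w1 x - w2 x).
Proof.
move=> h1 h2; have := in_H_lin (-1) h2 h1; congr in_H.
by apply/funext => x; rewrite scaleN1r addrC.
Qed.

Lemma in_HZ m n c (w : R3 R -> 'rV[R]_n) : in_H m w -> in_H m (fun x => c *: w x).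
Proof.
move=> h; have := in_H_lin (c - 1) h h; congr in_H.
by apply/funext => x; rewrite scalerBl scale1r subrK.
Qed.

Lemma cvge0_near (T : Type) (F : set_system T) (FF : Filter F) (f : T -> \bar R) (e : R) :
  0 < e -> f @ F --> 0%E -> \forall s \near F, (f s <= e%:E)%E.
Proof.
move=> e0 f0; have : nbhs (0%E : \bar R) [set y | (y < e%:E)%E].
  by apply: open_nbhs_nbhs; split; [exact: open_ereal_lt_ereal|rewrite /= lte_fin].
move=> /f0 h; apply: (@filterS _ F _ _ _ _ h) => s /=; exact: ltW.
Qed.

Lemma H_cont_cube m n (I : set R) (w : R -> R3 R -> 'rV[R]_n) i (r : R) :
  (6 <= m)%N -> 0 < r -> H_cont m I w -> (forall t, I t -> continuous (component (w t) i)) ->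
  forall t, I t -> forall e, 0 < e -> exists2 d, 0 < d & forall s, I s -> `|s - t| < d ->
    forall x, `|x| <= r -> `|w s x 0 i - w t x 0 i| <= e.
Proof.
move=> m6 r0 [wH wc] cw t It e e0.
have [C C0 HC] := sobolev_cube r0.
have eC : 0 < e / C by rewrite divr_gt0.
have := cvge0_near _ eC (wc t It); rewrite near_withinE => -/(_ _)/nbhs_ballP[d /= d0 Hd].
exists d => // s Is sd x xr.
have h : (Hnorm m (fun x : R3 R => (w s x - w t x)%R) <= (e / C)%:E)%E.
  by apply: Hd => //; rewrite -ball_normE /ball_/= distrC.
have dH := in_HB (wH s Is) (wH t It).
have wd := Hnorm_wreg i m6 dH (ltW eC) h.
have cE : component (fun x => w s x - w t x) i = component (w s) i \- component (w t) i.
  by apply/funext => z; rewrite /component !mxE.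
rewrite cE in wd.
have [|H _] := HC _ _ _ eC wd; first by move=> z; apply: cvgB; exact: cw.
by have := H x xr; rewrite /component [C * _]mulrC divfK ?gt_eqF.
Qed.

Lemma in_H_cube m n (w : R3 R -> 'rV[R]_n) i (r : R) :
  (6 <= m)%N -> 0 < r -> in_H m w -> continuous (component w i) ->
  exists2 L, 0 < L & (forall x, `|x| <= r -> `|w x 0 i| <= L) /\
    forall x y, `|x| <= r -> `|y| <= r -> `|w x 0 i - w y 0 i| <= L * `|x - y|.
Proof.
move=> m6 r0 wH cw; have [C C0 HC] := sobolev_cube r0.
have [B B0 wB] := in_H_wreg i m6 wH.
by have [H1 H2] := HC _ _ cw B0 wB; exists (C * B); [rewrite mulr_gt0|].
Qed.

Lemma lipschitz_partial_bound (f : R3 R -> R) (r L : R) j :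
  (forall x, derivable f x (unit_vec j)) ->
  (forall x y, `|x| <= r + 1 -> `|y| <= r + 1 -> `|f x - f y| <= L * `|x - y|) ->
  forall x, `|x| <= r -> `|partial j f x| <= L.
Proof.
move=> df fL x xr.
have dc : h^-1 *: (f (h *: unit_vec j + x) - f x) @[h --> 0^'] --> partial j f x by exact: (df x).
apply/ler_addgt0Pr => e e0.
have [h [h1 h2 h3]] : exists h : R, [/\ h != 0, `|h| <= 1 & `|partial j f x - h^-1 *: (f (h *: unit_vec j + x) - f x)| <= e].
  have : \forall h \near (0 : R)^', [/\ h != 0, `|h| <= 1 & `|partial j f x - h^-1 *: (f (h *: unit_vec j + x) - f x)| <= e].
    near=> h; split.
    - near: h; exact: nbhs_dnbhs_neq.
    - near: h; apply: nbhs_dnbhs; exists 1 => //= h; rewrite /= sub0r normrN; exact: ltW.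
    - near: h; move/cvgrPdist_le : dc; exact.
  by move/filter_ex.
have nh : `|h *: unit_vec j : R3 R| = `|h| by rewrite normrZ norm_unit_vec mulr1.
have hx : `|h *: unit_vec j + x| <= r + 1.
  by rewrite addrC (le_trans (ler_normD _ _))// lerD// nh.
have xr1 : `|x| <= r + 1 by rewrite (le_trans xr)// lerDl.
have := fL _ x hx xr1; rewrite addrK nh => h4.
rewrite -(subrK (h^-1 *: (f (h *: unit_vec j + x) - f x)) (partial j f x)) addrC.
rewrite (le_trans (ler_normD _ _))// lerD// normrZ normfV.
by rewrite ler_pdivrMl ?normr_gt0// mulrC.
Unshelve. all: by end_near. Qed.

(** The limit [w t] in the Sobolev norm is not known to be continuous, so the pointwise bound is
    applied to the difference of two quotients, where [w t] cancels. The quotients are thus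
    uniformly Cauchy on the cube, and the pointwise time derivative identifies their limit. *)
Lemma H_C1_cube m n (T : R) (u : R -> R3 R -> 'rV[R]_n) i (r : R) :
  (6 <= m)%N -> 0 < r -> H_C1 m `[0, T] u ->
  (forall t, 0 <= t <= T -> continuous (component (u t) i)) ->
  forall t, 0 < t < T -> (forall x, derivable (fun s => u s x 0 i) t 1) ->
  forall e, 0 < e -> exists2 d, 0 < d & forall h, h != 0 -> `|h| < d -> 0 <= h + t <= T /\
    forall x, `|x| <= r ->
    `|h^-1 * (u (h + t) x 0 i - u t x 0 i) - derive1 (fun s : R => u s x 0 i : R) t| <= e.
Proof.
move=> m6 r0 [uH [w [wH wc] uw]] cu t /andP[t0 tT] du e e0.
have [C C0 HC] := sobolev_cube r0.
(* [wregD] turns two bounds e' into 2 (e' + e'), and the Sobolev bound multiplies by [C]. *)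
pose e' := e / (4 * C); have e'0 : 0 < e' by rewrite divr_gt0 ?mulr_gt0.
have It : `[0, T]%classic t by rewrite /= in_itv/= !ltW.
pose D h (x : R3 R) : R := h^-1 * (u (h + t) x 0 i - u t x 0 i).
pose good h := `[0, T]%classic (h + t) /\ (Hnorm m (fun x => (h^-1 *: (u (h + t) x - u t x) - w t x)%R) <= e'%:E)%E.
have [d d0 dgood] : exists2 d, 0 < d & forall h, h != 0 -> `|h| < d -> good h.
  have := cvge0_near _ e'0 (uw t It); rewrite near_withinE => -/(_ _)/nbhs_ballP[d /= d0 Hd].
  exists (Num.min d (Num.min t (T - t))); first by rewrite !lt_min d0 t0 subr_gt0.
  move=> h h0; rewrite !lt_min => /and3P[hd ht hT].
  have Ih : `[0, T]%classic (h + t).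
    by rewrite /= in_itv/=; move: ht hT; rewrite !ltr_norml => /andP[? ?] /andP[? ?]; apply/andP; split; lra.
  split => //; have := Hd (h + t); rewrite addrK; apply => //.
  - by rewrite -ball_normE /ball_/= opprD addrCA subrr addr0 normrN.
  - by rewrite -subr_eq0 addrK.
have cauchy h h' x : good h -> good h' -> `|x| <= r -> `|D h x - D h' x| <= e.
  move=> [Is gs] [Is' gs'] xr.
  have dH h1 : `[0, T]%classic (h1 + t) -> in_H m (fun x => h1^-1 *: (u (h1 + t) x - u t x) - w t x).
    by move=> I1; apply: in_HB; [apply: in_HZ; apply: in_HB; exact: uH|exact: wH].
  have W1 := Hnorm_wreg i m6 (dH h Is) (ltW e'0) gs.
  have W2 := Hnorm_wreg i m6 (in_HZ (-1) (dH h' Is')) (ltW e'0).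
  have {}W2 : wreg e' (component (fun x => -1 *: (h'^-1 *: (u (h' + t) x - u t x) - w t x)) i).
    have := Hnorm_wreg i m6 (dH h' Is') (ltW e'0) gs' => W a b c a2 b2 c2.
    have [g dg lg] := W a b c a2 b2 c2; exists (fun x => -1 * g x).
      rewrite (_ : component _ _ = (fun x => -1 * component (fun x => h'^-1 *: (u (h' + t) x - u t x) - w t x) i x)).
        exact: is_wderivZ.
      by apply/funext => z; rewrite /component mxE.
    by rewrite /l2_bound; under eq_integral do rewrite mulN1r sqrrN.
  have W3 := wregD (ltW e'0) (ltW e'0) W1 W2.
  have DE : (component (fun x => h^-1 *: (u (h + t) x - u t x) - w t x) i \+
      component (fun x => -1 *: (h'^-1 *: (u (h' + t) x - u t x) - w t x)) i) = D h \- D h'.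
    by apply/funext => z; rewrite /component /D /= !mxE; ring.
  rewrite DE in W3.
  have cD h1 : `[0, T]%classic (h1 + t) -> continuous (D h1).
    move=> I1 z; apply: cvgM; first exact: cvg_cst.
    by apply: cvgB; apply: cu; [move: I1|move: It]; rewrite /= in_itv.
  have [||H _] := HC (D h \- D h') _ _ _ W3.
  - by move=> z; apply: cvgB; exact: cD.
  - by rewrite mulr_gt0// addr_gt0.
  - have := H x xr; rewrite /e' (_ : C * _ = e)//.
    by field; rewrite gt_eqF.
exists d => // h h0 hd; have gh := dgood h h0 hd; split; first by have := gh.1; rewrite /= in_itv.
move=> x xr; apply/ler_addgt0Pr => eta eta0.
have dx : D h' x @[h' --> 0^'] --> derive1 (fun s : R => u s x 0 i : R) t.
  rewrite derive1E; have dd : h^-1 *: (u (h *: 1 + t) x 0 i - u t x 0 i) @[h --> (0 : R)^'] --> 'D_1 (fun s : R => u s x 0 i : R) t.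
    exact: (du x).
  apply: cvg_trans dd; apply: near_eq_cvg; apply: nearW => h1.
  by rewrite /D (_ : h1 *: 1 = h1)// /GRing.scale/= mulr1.
have [h' [gh' hh']] : exists h', good h' /\ `|derive1 (fun s : R => u s x 0 i : R) t - D h' x| <= eta.
  have : \forall h' \near (0 : R)^', good h' /\ `|derive1 (fun s : R => u s x 0 i : R) t - D h' x| <= eta.
    near=> h'; split.
    - apply: dgood; first by near: h'; exact: nbhs_dnbhs_neq.
      by near: h'; apply: nbhs_dnbhs; exists d => //= h'; rewrite /= sub0r normrN.
    - by near: h'; move/cvgrPdist_le : dx; exact.
  by move/filter_ex.
have H := cauchy h h' x gh gh' xr; rewrite -/(D h x).
rewrite -(subrK (D h' x) (D h x)) -addrA (le_trans (ler_normD _ _))// lerD// distrC//.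
Unshelve. all: by end_near. Qed.

(** The bound on [f] is required only almost everywhere because it will come from an essential
    supremum. *)
Lemma cube_functional (phi : R3 R -> R) (r M : R) : measurable_fun setT phi ->
  (forall x, `|phi x| <= M) -> (forall x, r < `|x| -> phi x = 0) -> exists2 K, 0 < K &
  forall (f : R3 R -> R) e, measurable_fun setT f -> 0 <= e ->
    {ae leb3, forall x : R3 R, `|x| <= r -> `|f x| <= e} ->
    leb3.-integrable setT (EFin \o (f \* phi)) /\ `|\int[leb3]_x (f x * phi x)| <= K * e.
Proof.
move=> mphi phiM phir.
have iphi : leb3.-integrable setT (EFin \o phi).
  have := loc_integrable_mul (loc_integrable_cst 1) mphi phiM phir.
  by apply: eq_integrable => // x _ /=; rewrite mul1r.
have iaphi : leb3.-integrable setT (fun x => `|phi x|%:E).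
  by have := integrable_abse iphi; apply: eq_integrable.
pose k := fine (\int[leb3]_x `|phi x|%:E)%E.
have kE : (\int[leb3]_x `|phi x|%:E = k%:E)%E by rewrite fineK// integrable_fin_num.
have k0 : 0 <= k by rewrite fine_ge0// integral_ge0.
exists (k + 1); first by rewrite ltr_wpDl.
move=> f e mf e0 fe.
have ae : {ae leb3, forall x : R3 R, setT x -> (`|(f x * phi x)%:E| <= e%:E * `|phi x|%:E)%E}.
  move: fe; apply: filterS => x fx _; rewrite -EFinM /= lee_fin normrM.
  have [xr|xr] := leP `|x| r; first by rewrite ler_wpM2r// fx.
  by rewrite phir// normr0 !mulr0.
have mfp : measurable_fun setT (fun x => (f x * phi x)%:E).
  by apply/measurable_EFinP; exact: measurable_funM.
have le : (\int[leb3]_x `|(f x * phi x)%:E| <= e%:E * k%:E)%E.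
  rewrite -kE -ge0_integralZl//; last by case/integrableP: iaphi.
  apply: ae_ge0_le_integral => //.
  - exact: measurableT_comp.
  - by move=> x _; rewrite -EFinM lee_fin mulr_ge0.
  - by apply: measurable_funeM; case/integrableP: iaphi.
have ifp : leb3.-integrable setT (EFin \o (f \* phi)).
  by apply/integrableP; split => //; apply: (le_lt_trans le); rewrite -EFinM ltry.
split => //; rewrite -lee_fin EFin_normr_Rintegral//.
apply: (le_trans (le_abse_integral leb3 measurableT mfp)); apply: (le_trans le).
by rewrite -EFinM lee_fin mulrDl mul1r mulrC lerDl.
Qed.

End cube_estimates.

(** * Weak form of the equations: pairings and pointwise identities *)

Section evolution.
Context {R : realType}.
Implicit Types (w : R3 R -> 'rV[R]_(3 + 1)) (X : 'I_4 -> R3 R -> R).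

Lemma sum4 (F : 'I_4 -> R) : \sum_(i < 4) F i = F 0 + F 1 + F 2 + F 3.
Proof.
rewrite !big_ord_recl big_ord0 addr0 !addrA.
by do ![congr (_ + _)]; congr F; exact: val_inj.
Qed.

Lemma sum3 (F : 'I_3 -> R) : \sum_(i < 3) F i = F 0 + F 1 + F 2.
Proof.
rewrite !big_ord_recl big_ord0 addr0 !addrA.
by do ![congr (_ + _)]; congr F; exact: val_inj.
Qed.

Lemma lshift0 : lshift 1 (0 : 'I_3) = (0 : 'I_4). Proof. exact: val_inj. Qed.
Lemma lshift1 : lshift 1 (1 : 'I_3) = (1 : 'I_4). Proof. exact: val_inj. Qed.
Lemma lshift2 : lshift 1 (2 : 'I_3) = (2 : 'I_4). Proof. exact: val_inj. Qed.
Lemma rshift3 : rshift 3 (0 : 'I_1) = (3 : 'I_4). Proof. exact: val_inj. Qed.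

Lemma ord4P (P : 'I_4 -> Prop) : P 0 -> P 1 -> P 2 -> P 3 -> forall i, P i.
Proof.
move=> P0 P1 P2 P3 [[|[|[|[|//]]]] hi].
- by rewrite (_ : Ordinal hi = 0)//; exact: val_inj.
- by rewrite (_ : Ordinal hi = 1)//; exact: val_inj.
- by rewrite (_ : Ordinal hi = 2)//; exact: val_inj.
- by rewrite (_ : Ordinal hi = 3)//; exact: val_inj.
Qed.

(** The transpose of the linear operator w -> (Omega w_2, - Omega w_1, N w_4, - N w_3) of the
    equations; that operator being skew, this is also its negative. *)
Definition rotate (Omega N : R) X : 'I_4 -> R3 R -> R :=
  fun i x => [:: - Omega * X 1 x; Omega * X 0 x; - N * X 3 x; N * X 2 x]`_i.

Definition fpair (f X : 'I_4 -> R3 R -> R) : R := \int[leb3]_x (\sum_(i < 4) f i x * X i x).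

Definition pairing w X : R := fpair (component w) X.

(** The quadratic term Q: for a divergence-free velocity, advection integrated by parts is the
    tensor of products w_i w_j against the gradient of [X]. *)
Definition transport w X : R := \sum_(j < 3)
  fpair (fun i => component w i \* component w (lshift 1 j)) (fun i => partial j (X i)).

Lemma boussinesq_components (Omega N : R) (u : R -> R3 R -> 'rV[R]_(3 + 1)) p t x :
  derivable (fun s => u s x) t 1 -> differentiable (u t) x ->
  boussinesq_eq Omega N u p t x ->
  (forall i : 'I_4, derive1 (fun s : R => u s x 0 i : R) t +
     \sum_(j < 3) u t x 0 (lshift 1 j) * partial j (component (u t) i) x =
     [:: - Omega * - u t x 0 1; - Omega * u t x 0 0; N * u t x 0 3; - N * u t x 0 2]`_i -
     [:: partial 0 (p t) x; partial 1 (p t) x; partial 2 (p t) x; 0]`_i) /\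
  \sum_(j < 3) partial j (component (u t) (lshift 1 j)) x = 0.
Proof.
move=> du dx [ev et ed].
have vE s : velocity (u s) = (fun y => lsubmx (u s y)) by [].
have cE s (i : 'I_3) : component (velocity (u s)) i = component (u s) (lshift 1 i).
  by apply/funext => y; rewrite /component /velocity mxE.
have tE s : temperature (u s) = component (u s) 3.
  by apply/funext => y; rewrite /component /temperature mxE rshift3.
have dut i : derivable (fun s => u s x 0 i) t 1 by move/derivable_mxP : du; exact.
have dv : derivable (fun s => velocity (u s) x) t 1.
  apply/derivable_mxP => i j; rewrite (ord1 i).
  by rewrite (_ : (fun s => _) = (fun s => u s x 0 (lshift 1 j)))//; apply/funext => s; rewrite mxE.
have dvx j : derivable (velocity (u t)) x (unit_vec j).
  apply/derivable_mxP => i k; rewrite (ord1 i) -/(component (velocity (u t)) k) cE.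
  by apply: diff_derivable; exact: differentiable_component.
have evi (i : 'I_3) : derive1 (fun s : R => u s x 0 (lshift 1 i) : R) t +
    \sum_(j < 3) u t x 0 (lshift 1 j) * partial j (component (u t) (lshift 1 i)) x =
    - (Omega * (e3_cross (velocity (u t) x)) 0 i) - partial i (p t) x + N * u t x 0 3 * (i == 2)%:R.
  have := congr1 (fun M : 'rV[R]_3 => M 0 i) ev; rewrite !mxE.
  rewrite derive1E derive_mx// mxE -derive1E.
  rewrite (_ : (fun s => velocity (u s) x 0 i) = (fun s => u s x 0 (lshift 1 i))); last first.
    by apply/funext => s; rewrite mxE.
  rewrite /advect summxE (tE t) /component => <-; congr (_ + _).
  apply: eq_bigr => j _; rewrite [RHS]mxE (partial_component i (dvx j)) cE.
  by rewrite mxE.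
split; last first.
  by move: ed; rewrite /divergence; under eq_bigr do rewrite cE.
apply: ord4P => /=.
- have := evi 0; rewrite lshift0 => ->; rewrite /e3_cross !mxE /= lshift1 mulr0 addr0; ring.
- have := evi 1; rewrite lshift1 => ->; rewrite /e3_cross !mxE /= lshift0 mulr0 addr0; ring.
- have := evi 2; rewrite lshift2 => ->; rewrite /e3_cross !mxE /=; ring.
- move: et; rewrite /advect (_ : (fun s => temperature (u s) x) = (fun s => u s x 0 3)); last first.
    by apply/funext => s; rewrite tE.
  rewrite tE subr0 mulNr (_ : velocity (u t) x 0 2 = u t x 0 2); last by rewrite mxE lshift2.
  move=> <-; congr (_ + _); apply: eq_bigr => j _.
  by rewrite mxE.
Qed.

(** Everything except the linear and the quadratic term is the divergence of the flux U_j (U . X) +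
    p X_j, provided the velocity and the test field are divergence-free. With derivatives as free
    variables this is polynomial algebra, once the two constraints eliminate [dU 2 2] and
    [dX 2 2]. *)
Lemma flux_identity (U X L dt : 'I_4 -> R) (dU dX : 'I_3 -> 'I_4 -> R) (p : R) (dp : 'I_3 -> R) :
  (forall i, dt i + \sum_(j < 3) U (lshift 1 j) * dU j i = L i - [:: dp 0; dp 1; dp 2; 0]`_i) ->
  \sum_(j < 3) dU j (lshift 1 j) = 0 -> \sum_(j < 3) dX j (lshift 1 j) = 0 ->
  \sum_(i < 4) dt i * X i = \sum_(i < 4) L i * X i +
    \sum_(i < 4) \sum_(j < 3) U i * U (lshift 1 j) * dX j i -
    \sum_(j < 3) (\sum_(i < 4) (dU j i * (U (lshift 1 j) * X i) + U i * (dU j (lshift 1 j) * X i) +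
      U i * (U (lshift 1 j) * dX j i)) + (dp j * X (lshift 1 j) + p * dX j (lshift 1 j))).
Proof.
move=> h dU0 dX0.
have dtE i : dt i = L i - [:: dp 0; dp 1; dp 2; 0]`_i - \sum_(j < 3) U (lshift 1 j) * dU j i by rewrite -h addrK.
rewrite (eq_bigr _ (fun i _ => congr1 (fun z => z * X i) (dtE i))).
move: dU0 dX0; rewrite !sum4 !sum3 !sum4 !lshift0 !lshift1 !lshift2 /=.
move: (U 0) (U 1) (U 2) (U 3) (X 0) (X 1) (X 2) (X 3) (L 0) (L 1) (L 2) (L 3).
move: (dp 0) (dp 1) (dp 2) (dX 0 0) (dX 0 1) (dX 0 2) (dX 0 3) (dX 1 0) (dX 1 1) (dX 1 2) (dX 1 3).
move: (dX 2 0) (dX 2 1) (dX 2 2) (dX 2 3).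
move: (dU 0 0) (dU 0 1) (dU 0 2) (dU 0 3) (dU 1 0) (dU 1 1) (dU 1 2) (dU 1 3).
move: (dU 2 0) (dU 2 1) (dU 2 2) (dU 2 3).
move=> a1 a2 a3 a4 b1 b2 b3 b4 c1 c2 c3 c4 d1 d2 d3 d4 e1 e2 e3' e4 f1 f2 f3 f4 g1 g2 g3 U0 U1 U2 U3 X0 X1 X2 X3 L0 L1 L2 L3.
move=> /eqP; rewrite addr_eq0 => /eqP hU /eqP; rewrite addr_eq0 => /eqP hX.
rewrite (_ : a3 = - (b1 + c2)); last by rewrite hU opprK.
rewrite (_ : d3 = - (e4 + g1)); last by rewrite hX opprK.
ring.
Qed.

Lemma test_continuous (phi : R3 R -> R) : test_function phi -> continuous phi.
Proof. by move=> [sphi _] x; apply: differentiable_continuous; exact: (sphi [::] x). Qed.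

Lemma test_partial j (phi : R3 R -> R) : test_function phi -> test_function (partial j phi).
Proof. exact: (test_partials [:: j]). Qed.

Lemma test_bounded (phi : R3 R -> R) : test_function phi -> exists2 M, 0 < M & forall x, `|phi x| <= M.
Proof.
move=> tphi; have [_ [r phir]] := tphi.
have [M M0 HM] := continuous_cube_bounded r (test_continuous tphi).
by exists M => // x; have [/HM//|rx] := leP `|x| r; rewrite phir// normr0 ltW.
Qed.

Lemma continuous_test_integrable (f phi : R3 R -> R) : continuous f -> test_function phi ->
  leb3.-integrable setT (EFin \o (f \* phi)).
Proof.
move=> cf tphi; have [_ [r phir]] := tphi; have [M M0 HM] := test_bounded tphi.
have [K K0 HK] := cube_functional (continuous_measurable_R3 (test_continuous tphi)) HM phir.
have [B B0 HB] := continuous_cube_bounded r cf.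
have ae : {ae leb3, forall x : R3 R, `|x| <= r -> `|f x| <= B} by apply: aeW.
by have [] := HK f B (continuous_measurable_R3 cf) (ltW B0) ae.
Qed.

Lemma test_field_supp (n : nat) (X : 'I_n -> R3 R -> R) : (forall i, test_function (X i)) ->
  exists2 r, 0 < r & forall i x, r < `|x| -> X i x = 0.
Proof.
move=> hX; have /choice[r hr] : forall i, exists r : R, forall x, r < `|x| -> X i x = 0.
  by move=> i; have [_] := hX i.
exists (\sum_i `|r i| + 1); first by rewrite ltr_wpDl// sumr_ge0.
move=> i x ix; apply: hr; apply: le_lt_trans ix.
rewrite (bigD1 i)//= -addrA (le_trans (ler_norm _))// lerDl addr_ge0// sumr_ge0//.
Qed.

Lemma integral_partial_cube (i : 'I_3) (g : R3 R -> R) (r M : R) :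
  continuous g -> (forall x, derivable g x (unit_vec i)) ->
  (forall x, r < `|x| -> g x = 0) -> (forall x, `|x| <= r -> `|partial i g x| <= M) -> 0 <= M ->
  leb3.-integrable setT (EFin \o partial i g) /\ \int[leb3]_x partial i g x = 0.
Proof.
move=> cg dg gr gM M0; apply: (integral_partial_eq0 cg dg gr (M := M)) => x.
have [/gM//|rx] := leP `|x| r.
by rewrite (partial_supp i gr)// normr0.
Qed.

Lemma partialM j (f g : R3 R -> R) x : differentiable f x -> differentiable g x ->
  partial j (f \* g) x = partial j f x * g x + f x * partial j g x.
Proof.
move=> df dg; rewrite /partial deriveM; [|exact: diff_derivable..].
by rewrite /GRing.scale/= addrC [g x * _]mulrC.
Qed.

Lemma Rintegral_sub_eq0 (F1 F2 G : R3 R -> R) :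
  leb3.-integrable setT (EFin \o F1) -> leb3.-integrable setT (EFin \o F2) ->
  \int[leb3]_x F1 x = 0 -> \int[leb3]_x F2 x = 0 -> (forall x, G x = F1 x - F2 x) ->
  \int[leb3]_x G x = 0.
Proof.
move=> i1 i2 e1 e2 /funext ->.
by rewrite RintegralB// e1 e2 subr0.
Qed.

(** As the mixed derivatives of [phi] commute, the integrand is d_i(psi d_j phi) - d_j(psi d_i phi);
    only first derivatives of [psi] appear. *)
Lemma curl_orthogonal (psi phi : R3 R -> R) (i j : 'I_3) : (forall x, differentiable psi x) ->
  continuous (partial i psi) -> continuous (partial j psi) -> test_function phi ->
  partial i (partial j phi) = partial j (partial i phi) ->
  \int[leb3]_x (partial i psi x * partial j phi x - partial j psi x * partial i phi x) = 0.
Proof.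
move=> dpsi ci cj tphi comm.
have cpsi : continuous psi by move=> x; exact: differentiable_continuous.
have H k l : continuous (partial k psi) ->
    leb3.-integrable setT (EFin \o partial k (psi \* partial l phi)) /\ \int[leb3]_x partial k (psi \* partial l phi) x = 0.
  move=> ck; have tl := test_partial l tphi; have [sl [r lr]] := tl.
  have E x : partial k (psi \* partial l phi) x = partial k psi x * partial l phi x + psi x * partial k (partial l phi) x.
    exact: (partialM k (dpsi x) (sl [::] x)).
  have cc : continuous (partial k (psi \* partial l phi)).
    rewrite (_ : partial k _ = (fun x => partial k psi x * partial l phi x + psi x * partial k (partial l phi) x)); last exact/funext.
    move=> x; apply: cvgD; apply: cvgM; [exact: ck|exact: test_continuous|exact: cpsi|].
    by apply: test_continuous; exact: test_partial.
  have [M M0 HM] := continuous_cube_bounded r cc.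
  apply: (integral_partial_cube _ _ _ HM (ltW M0)).
  - by move=> x; apply: cvgM; [exact: cpsi|exact: test_continuous].
  - move=> x; apply: derivableM; apply: diff_derivable; [exact: dpsi|exact: (sl [::] x)].
  - move=> x rx; exact: (etrans (congr1 (fun z => psi x * z) (lr x rx)) (mulr0 _)).
have [i1 e1] := H i j ci; have [i2 e2] := H j i cj.
apply: (Rintegral_sub_eq0 i1 i2 e1 e2) => x.
have dl l : differentiable (partial l phi) x by have [sl _] := test_partial l tphi; exact: (sl [::] x).
rewrite (partialM i (dpsi x) (dl j)) (partialM j (dpsi x) (dl i)) comm.
move: (partial i psi x) (partial j psi x) (partial j phi x) (partial i phi x) (psi x) (partial _ _ x) => a b c d e f.
by ring.
Qed.

End evolution.

(** * Pairings depending on time: continuity and differentiability *)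

Section weak_evolution.
Context {R : realType}.
Implicit Types (w : R3 R -> 'rV[R]_(3 + 1)) (X f g : 'I_4 -> R3 R -> R).

Definition cube_bd (r : R) (f : R3 R -> R) := measurable_fun setT f /\
  exists B, forall x : R3 R, `|x| <= r -> `|f x| <= B.

Lemma continuous_cube_bd r (f : R3 R -> R) : continuous f -> cube_bd r f.
Proof.
move=> cf; split; first exact: continuous_measurable_R3.
by have [B _ HB] := continuous_cube_bounded r cf; exists B.
Qed.

Lemma cube_bd_cst r (c : R) : cube_bd r (fun=> c).
Proof. by split; [exact: measurable_cst|exists `|c|]. Qed.

Lemma cube_bd_lin r c (f g : R3 R -> R) : cube_bd r f -> cube_bd r g -> cube_bd r (fun x => c * f x + g x).
Proof.
move=> [mf [B HB]] [mg [B' HB']]; split.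
  by apply: measurable_funD => //; exact: measurable_funM.
exists (`|c| * B + B') => x xr; rewrite (le_trans (ler_normD _ _))// lerD ?HB'//.
by rewrite normrM ler_wpM2l// HB.
Qed.

Lemma fpair_bound X (r : R) : (forall i, test_function (X i)) -> (forall i x, r < `|x| -> X i x = 0) ->
  exists2 K, 0 < K & forall f e, (forall i, measurable_fun setT (f i)) -> 0 <= e ->
    {ae leb3, forall x : R3 R, `|x| <= r -> forall i, `|f i x| <= e} ->
    leb3.-integrable setT (EFin \o (fun x => \sum_(i < 4) f i x * X i x)) /\ `|fpair f X| <= K * e.
Proof.
move=> hX Xr.
have /choice[K HK] : forall i, exists K, 0 < K /\ forall (f : R3 R -> R) e, measurable_fun setT f -> 0 <= e ->
    {ae leb3, forall x : R3 R, `|x| <= r -> `|f x| <= e} ->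
    leb3.-integrable setT (EFin \o (f \* X i)) /\ `|\int[leb3]_x (f x * X i x)| <= K * e.
  move=> i; have [M M0 HM] := test_bounded (hX i).
  have [K K0 HK] := cube_functional (continuous_measurable_R3 (test_continuous (hX i))) HM (Xr i).
  by exists K.
exists (\sum_i K i).
  by rewrite sum4 !addr_gt0//; exact: (HK _).1.
move=> f e mf e0 fe.
have ae i : {ae leb3, forall x : R3 R, `|x| <= r -> `|f i x| <= e}.
  by apply: filterS fe => x h xr; exact: h.
have H i := (HK i).2 (f i) e (mf i) e0 (ae i).
have [i1 i2] := Rintegral_bigsum (index_enum 'I_4) (fun i => (H i).1).
split; first exact: i1.
rewrite /fpair i2 (le_trans (ler_norm_sum _ _ _))// mulr_suml.
by apply: ler_sum => i _; exact: (H i).2.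
Qed.

Lemma fpair_integrable X r f : (forall i, test_function (X i)) -> (forall i x, r < `|x| -> X i x = 0) ->
  (forall i, cube_bd r (f i)) -> leb3.-integrable setT (EFin \o (fun x => \sum_(i < 4) f i x * X i x)).
Proof.
move=> hX Xr fb; have [K K0 HK] := fpair_bound hX Xr.
have /choice[B HB] : forall i, exists B, forall x : R3 R, `|x| <= r -> `|f i x| <= B by move=> i; have [] := fb i.
have [] // := HK f (\sum_i `|B i|).
- by move=> i; have [] := fb i.
- by rewrite sumr_ge0.
- apply: aeW => x xr i; rewrite (le_trans (HB i x xr))// (le_trans (ler_norm _))//.
  by rewrite (bigD1 i)//= lerDl sumr_ge0.
Qed.

Lemma fpair_lin X r c f g : (forall i, test_function (X i)) -> (forall i x, r < `|x| -> X i x = 0) ->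
  (forall i, cube_bd r (f i)) -> (forall i, cube_bd r (g i)) ->
  fpair (fun i x => c * f i x + g i x) X = c * fpair f X + fpair g X.
Proof.
move=> hX Xr fb gb; have i1 := fpair_integrable hX Xr fb; have i2 := fpair_integrable hX Xr gb.
rewrite /fpair -RintegralZl// -RintegralD//.
  apply: eq_Rintegral => x _; rewrite mulr_sumr -big_split /=.
  by apply: eq_bigr => i _; rewrite mulrDl mulrA.
by have := integrableZl measurableT c i1; apply: eq_integrable.
Qed.

Lemma fpair_within_continuous X r (I : set R) (f : R -> 'I_4 -> R3 R -> R) :
  (forall i, test_function (X i)) -> (forall i x, r < `|x| -> X i x = 0) ->
  (forall t, I t -> forall i, cube_bd r (f t i)) ->
  (forall t, I t -> forall e, 0 < e -> exists2 d, 0 < d & forall s, I s -> `|s - t| < d ->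
    forall i x, `|x| <= r -> `|f s i x - f t i x| <= e) ->
  {within I, continuous (fun t => fpair (f t) X)}.
Proof.
move=> hX Xr fb fc; have [K K0 HK] := fpair_bound hX Xr.
apply/subspace_continuousP => t It; apply/cvgrPdist_le => e e0.
have [|d d0 Hd] := fc t It (e / K); first by rewrite divr_gt0.
rewrite near_withinE; exists d => //= s sd Is.
have := fpair_lin (-1) hX Xr (fb s Is) (fb t It); rewrite mulN1r addrC => <-.
have [|||_ h] := HK (fun i x => -1 * f s i x + f t i x) (e / K).
- by move=> i; have [] := cube_bd_lin (-1) (fb s Is i) (fb t It i).
- by rewrite ltW// divr_gt0.
- apply: aeW => x xr i; rewrite mulN1r addrC distrC; apply: Hd => //; by rewrite distrC.
by rewrite (le_trans h)// mulrC divfK// gt_eqF.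
Qed.

Lemma fpair_is_derive X r (f : R -> 'I_4 -> R3 R -> R) (df : 'I_4 -> R3 R -> R) (t : R) :
  (forall i, test_function (X i)) -> (forall i x, r < `|x| -> X i x = 0) ->
  (forall i, cube_bd r (f t i)) -> (forall i, cube_bd r (df i)) ->
  (forall e, 0 < e -> exists2 d, 0 < d & forall h, h != 0 -> `|h| < d ->
    (forall i, cube_bd r (f (h + t) i)) /\
    forall i x, `|x| <= r -> `|h^-1 * (f (h + t) i x - f t i x) - df i x| <= e) ->
  is_derive t 1 (fun s => fpair (f s) X) (fpair df X).
Proof.
move=> hX Xr fb dfb fd; have [K K0 HK] := fpair_bound hX Xr.
have H : h^-1 *: (fpair (f (h *: 1 + t)) X - fpair (f t) X) @[h --> (0 : R)^'] --> fpair df X.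
  apply/cvgrPdist_le => e e0.
  have [|d d0 Hd] := fd (e / K); first by rewrite divr_gt0.
  near=> h.
  have h0 : h != 0 by near: h; exact: nbhs_dnbhs_neq.
  have hd : `|h| < d by near: h; apply: nbhs_dnbhs; exists d => //= h; rewrite /= sub0r normrN.
  have [fhb Hh] := Hd h h0 hd.
  have -> : h *: 1 = h by rewrite /GRing.scale/= mulr1.
  rewrite distrC.
  pose D i x := (- h^-1) * f t i x + (-1 * df i x + 0).
  have b1 i : cube_bd r (fun x => -1 * df i x + 0).
    by apply: cube_bd_lin => //; exact: cube_bd_cst.
  have b2 i : cube_bd r (D i) by exact: cube_bd_lin.
  have E : h^-1 *: (fpair (f (h + t)) X - fpair (f t) X) - fpair df X =
      fpair (fun i x => h^-1 * f (h + t) i x + D i x) X.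
    rewrite (fpair_lin _ hX Xr)// (fpair_lin _ hX Xr)// (fpair_lin _ hX Xr)//; last first.
      by move=> i; exact: cube_bd_cst.
    have -> : fpair (fun=> fun=> 0) X = 0.
      rewrite /fpair (_ : (fun x => _) = cst 0) ?Rintegral_cst ?mul0r//.
      by apply/funext => x; rewrite big1// => i _; rewrite mul0r.
    by rewrite /GRing.scale/=; ring.
  rewrite E; have [|||_ hh] := HK (fun i x => h^-1 * f (h + t) i x + D i x) (e / K).
  - by move=> i; have [] := cube_bd_lin h^-1 (fhb i) (b2 i).
  - by rewrite ltW// divr_gt0.
  - apply: aeW => x xr i; rewrite (_ : _ + _ = h^-1 * (f (h + t) i x - f t i x) - df i x); last by rewrite /D; ring.
    exact: Hh.
  by rewrite (le_trans hh)// mulrC divfK// gt_eqF.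
split; first by apply/cvg_ex; exists (fpair df X).
exact: cvg_lim.
Unshelve. all: by end_near. Qed.

Lemma measurable_derive1_time (T : R) (f : R -> R3 R -> R) t : 0 < t < T ->
  (forall s, 0 <= s <= T -> continuous (f s)) ->
  (forall x, derivable (f^~ x) t 1) ->
  measurable_fun setT (fun x => derive1 (f^~ x) t).
Proof.
move=> /andP[t0 tT] cf df.
(* Steps backwards in time, of length at most t, stay in [0, T], where [f s] is continuous and hence
   measurable. *)
pose hn (n : nat) : R := - t * n.+1%:R^-1.
pose D n (x : R3 R) := (hn n)^-1 * (f (hn n + t) x - f t x).
have hnI n : 0 <= hn n + t <= T.
  have z0 : 0 < (n.+1%:R^-1 : R) by rewrite invr_gt0.
  have z1 : (n.+1%:R^-1 : R) <= 1 by rewrite invf_le1// ler1n.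
  rewrite /hn; move: (n.+1%:R^-1 : R) z0 z1 => z z0 z1; apply/andP; split; nra.
apply: (measurable_fun_cvg (h := D)) => [n|x _].
  apply: continuous_measurable_R3 => x; apply: cvgM; first exact: cvg_cst.
  by apply: cvgB; apply: cf => //; rewrite !ltW.
rewrite derive1E; have Hl : h^-1 *: (f (h *: 1 + t) x - f t x) @[h --> (0 : R)^'] --> 'D_1 (f^~ x) t.
  exact: (df x).
have h0 : hn n @[n --> \oo] --> (0 : R)^'.
  move=> A; rewrite /dnbhs /within /= => nA.
  have c0 : hn n @[n --> \oo] --> (0 : R).
    by rewrite -(mulr0 (- t)); apply: cvgM; [exact: cvg_cst|exact: cvg_harmonic].
  have H : \forall n \near \oo, (hn n != 0 -> A (hn n)) := c0 _ nA.
  by apply: filterS H => n; apply; rewrite mulf_neq0// ?oppr_eq0 ?gt_eqF// invr_gt0.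
have := cvg_comp _ _ h0 Hl; apply: cvg_trans; apply: near_eq_cvg; apply: nearW => n /=.
by rewrite /D (_ : hn n *: 1 = hn n)// /GRing.scale/= mulr1.
Qed.

Definition bdd (r : R) (f : R3 R -> R) := exists B, forall x : R3 R, `|x| <= r -> `|f x| <= B.

Lemma bddD r (f g : R3 R -> R) : bdd r f -> bdd r g -> bdd r (fun x => f x + g x).
Proof.
move=> [B HB] [B' HB']; exists (B + B') => x xr.
by rewrite (le_trans (ler_normD _ _))// lerD ?HB ?HB'.
Qed.

Lemma bddM r (f g : R3 R -> R) : bdd r f -> bdd r g -> bdd r (fun x => f x * g x).
Proof.
move=> [B HB] [B' HB']; exists (B * B') => x xr.
by rewrite normrM ler_pM ?HB ?HB'.
Qed.

Lemma bdd_cst r (c : R) : bdd r (fun=> c).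
Proof. by exists `|c|. Qed.

Lemma bddB r (f g : R3 R -> R) : bdd r f -> bdd r g -> bdd r (fun x => f x - g x).
Proof.
move=> bf [B HB]; apply: bddD => //; exists B => x xr; by rewrite normrN HB.
Qed.

Lemma bdd_sum r (I : Type) (s : seq I) (f : I -> R3 R -> R) : (forall i, bdd r (f i)) ->
  bdd r (fun x => \sum_(i <- s) f i x).
Proof.
move=> bf; elim: s => [|i s IH].
  by exists 0 => x _; rewrite big_nil normr0.
have [B HB] := bddD (bf i) IH; exists B => x xr.
by rewrite big_cons HB.
Qed.

Lemma continuous_bdd r (f : R3 R -> R) : continuous f -> bdd r f.
Proof. by move=> cf; have [B _ HB] := continuous_cube_bounded r cf; exists B. Qed.

Lemma partialsZ s c (f : R3 R -> R) : smooth f ->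
  partials s (fun x => c * f x) = (fun x => c * partials s f x).
Proof.
move=> sf; elim: s => [//|i s IH]; rewrite /= -/(partials s _) IH.
apply/funext => x; rewrite /partial; have := @deriveZ _ _ _ (partials s f) c x (unit_vec i).
by apply; apply: diff_derivable; exact: sf.
Qed.

Lemma testZ c (f : R3 R -> R) : test_function f -> test_function (fun x => c * f x).
Proof.
move=> [sf [r fr]]; split; last by exists r => x rx; rewrite fr ?mulr0.
move=> s x; rewrite partialsZ//; exact: (@differentiableZ _ _ _ (partials s f) c x (sf s x)).
Qed.

Lemma test_rotate Omega N X : (forall i, test_function (X i)) -> forall i, test_function (rotate Omega N X i).
Proof. by move=> hX; apply: ord4P; apply: testZ. Qed.

End weak_evolution.

(** * The time derivative of a pairing along a solution *)

Section momentum.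
Context {R : realType}.
Implicit Types (w : R3 R -> 'rV[R]_(3 + 1)) (X : 'I_4 -> R3 R -> R).

Definition flux X (U : 'I_4 -> R3 R -> R) (p : R3 R -> R) (j : 'I_3) (x : R3 R) : R :=
  \sum_(i < 4) U i x * (U (lshift 1 j) x * X i x) + p x * X (lshift 1 j) x.

Lemma partialD j (f g : R3 R -> R) x : differentiable f x -> differentiable g x ->
  partial j (fun x => f x + g x) x = partial j f x + partial j g x.
Proof. by move=> df dg; rewrite /partial; apply: deriveD; exact: diff_derivable. Qed.

Lemma differentiable_mulf (f g : R3 R -> R) x : differentiable f x -> differentiable g x ->
  differentiable (fun x => f x * g x) x.
Proof. exact: differentiableM. Qed.

Lemma differentiable_addf (f g : R3 R -> R) x : differentiable f x -> differentiable g x ->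
  differentiable (fun x => f x + g x) x.
Proof. exact: differentiableD. Qed.

Lemma partial_sum (I : Type) (s : seq I) j (f : I -> R3 R -> R) x : (forall i, differentiable (f i) x) ->
  differentiable (fun x => \sum_(i <- s) f i x) x /\
  partial j (fun x => \sum_(i <- s) f i x) x = \sum_(i <- s) partial j (f i) x.
Proof.
move=> df; elim: s => [|i s [IH1 IH2]].
  rewrite (_ : (fun x => _) = cst 0); last by apply/funext => y; rewrite big_nil.
  by split; [exact: differentiable_cst|rewrite big_nil /partial derive_cst].
rewrite (_ : (fun x => _) = (fun x => f i x + \sum_(i <- s) f i x)); last by apply/funext => y; rewrite big_cons.
by split; [exact: differentiable_addf|rewrite big_cons partialD// IH2].
Qed.

Lemma partial_flux X U p j x : (forall i, differentiable (X i) x) -> (forall i, differentiable (U i) x) ->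
  differentiable p x -> differentiable (flux X U p j) x /\ partial j (flux X U p j) x =
    \sum_(i < 4) (partial j (U i) x * (U (lshift 1 j) x * X i x) +
        U i x * (partial j (U (lshift 1 j)) x * X i x) +
        U i x * (U (lshift 1 j) x * partial j (X i) x)) +
      (partial j p x * X (lshift 1 j) x + p x * partial j (X (lshift 1 j)) x).
Proof.
move=> dX dU dp; pose G i x := U i x * (U (lshift 1 j) x * X i x).
have dG i : differentiable (G i) x by do 2?apply: differentiable_mulf.
have [d1 e1] := partial_sum (index_enum 'I_4) j dG.
split; first by apply: differentiable_addf => //; exact: differentiable_mulf.
rewrite /flux (partialD j d1 (differentiable_mulf dp (dX _))) e1; congr (_ + _); last first.
  exact: (partialM j dp (dX _)).
apply: eq_bigr => i _; rewrite (partialM j (dU i) (differentiable_mulf (dU (lshift 1 j)) (dX i))).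
by rewrite (partialM j (dU _) (dX i)) mulrDr addrA.
Qed.

(** Integrated form of [flux_identity]: the flux has the compact support of [X], so its divergence
    integrates to zero as soon as it is bounded. *)
Lemma weak_balance (Omega N r : R) X (U dt : 'I_4 -> R3 R -> R) (p : R3 R -> R) :
  (forall i, test_function (X i)) -> (forall i x, r < `|x| -> X i x = 0) ->
  (forall x, \sum_(j < 3) partial j (X (lshift 1 j)) x = 0) ->
  (forall i x, differentiable (U i) x) -> (forall i j, bdd r (partial j (U i))) ->
  (forall x, differentiable p x) -> (forall i, cube_bd r (dt i)) ->
  (forall x (i : 'I_4), dt i x + \sum_(j < 3) U (lshift 1 j) x * partial j (U i) x =
     [:: - Omega * - U 1 x; - Omega * U 0 x; N * U 3 x; - N * U 2 x]`_i -
     [:: partial 0 p x; partial 1 p x; partial 2 p x; 0]`_i) ->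
  (forall x, \sum_(j < 3) partial j (U (lshift 1 j)) x = 0) ->
  fpair dt X = fpair U (rotate Omega N X) +
    \sum_(j < 3) fpair (fun i => U i \* U (lshift 1 j)) (fun i => partial j (X i)).
Proof.
move=> hX Xr dX0 dU bU dp dtb eqn dU0.
have cU i : continuous (U i) by move=> x; apply: differentiable_continuous; exact: dU.
have cp : continuous p by move=> x; apply: differentiable_continuous; exact: dp.
have dX i x : differentiable (X i) x by have [sX _] := hX i; exact: (sX [::] x).
have bX i : bdd r (X i) by apply: continuous_bdd; exact: test_continuous.
have bdX i j : bdd r (partial j (X i)) by apply: continuous_bdd; apply: test_continuous; exact: test_partial.
have bUU i : bdd r (U i) by exact: continuous_bdd.
have bp : bdd r p by exact: continuous_bdd.
(* The pressure is only known to be differentiable. Its gradient is bounded on the cube because the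
   equation expresses it through terms that are. *)
have bdp (j : 'I_3) : bdd r (partial j p).
  pose L x : R := [:: - Omega * - U 1 x; - Omega * U 0 x; N * U 3 x; - N * U 2 x]`_(lshift 1 j).
  have bN : bdd r (fun x => - U 1 x).
    by have := bddB (bdd_cst r 0) (bUU 1); congr bdd; apply/funext => x; rewrite sub0r.
  have bL : bdd r L.
    rewrite /L; move: (lshift 1 j); apply: ord4P => /=.
    - exact: (bddM (bdd_cst r (- Omega)) bN).
    - exact: (bddM (bdd_cst r (- Omega)) (bUU 0)).
    - exact: (bddM (bdd_cst r N) (bUU 3)).
    - exact: (bddM (bdd_cst r (- N)) (bUU 2)).
  have [B HB] : bdd r (fun x => L x - (dt (lshift 1 j) x + \sum_(k < 3) U (lshift 1 k) x * partial k (U (lshift 1 j)) x)).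
    apply: bddB => //; apply: bddD; first by have [_] := dtb (lshift 1 j).
    by apply: bdd_sum => k; exact: bddM.
  exists B => x xr; have := HB x xr; rewrite eqn /L opprB addrC subrK.
  by case: (j) => [[|[|[|//]]] h] /=; congr (`|partial _ p x| <= _); exact: val_inj.
pose F1 x := \sum_(i < 4) U i x * rotate Omega N X i x.
pose F2j (j : 'I_3) x := \sum_(i < 4) (U i \* U (lshift 1 j)) x * partial j (X i) x.
pose F3j (j : 'I_3) x := partial j (flux X U p j) x.
have i1 : leb3.-integrable setT (EFin \o F1).
  apply: (fpair_integrable (r := r)) => [|i x rx|i]; first exact: test_rotate.
  - by move: i; apply: ord4P; rewrite /rotate/= Xr// mulr0.
  - exact: continuous_cube_bd.
have i2 j : leb3.-integrable setT (EFin \o F2j j).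
  apply: (fpair_integrable (r := r) (X := fun i => partial j (X i))) => [i|i x rx|i].
  - exact: test_partial.
  - by rewrite (partial_supp j (Xr i)).
  - by apply: continuous_cube_bd => x; apply: cvgM; exact: cU.
have H3 j : leb3.-integrable setT (EFin \o F3j j) /\ \int[leb3]_x F3j j x = 0.
  have df x := partial_flux j (fun i => dX i x) (fun i => dU i x) (dp x).
  have [M HM] : bdd r (F3j j).
    have : bdd r (fun x => \sum_(i < 4) (partial j (U i) x * (U (lshift 1 j) x * X i x) +
        U i x * (partial j (U (lshift 1 j)) x * X i x) +
        U i x * (U (lshift 1 j) x * partial j (X i) x)) +
      (partial j p x * X (lshift 1 j) x + p x * partial j (X (lshift 1 j)) x)).
      apply: bddD; last by apply: bddD; apply: bddM.
      apply: bdd_sum => i; apply: bddD; last by apply: bddM => //; exact: bddM.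
      by apply: bddD; apply: bddM => //; exact: bddM.
    by congr bdd; apply/funext => x; rewrite /F3j (df x).2.
  apply: (integral_partial_cube (r := r) (M := `|M|)) => //.
  - by move=> x; apply: differentiable_continuous; exact: (df x).1.
  - by move=> x; apply: diff_derivable; exact: (df x).1.
  - move=> x rx; rewrite /flux Xr// mulr0 addr0 big1// => i _.
    by rewrite Xr// !mulr0.
  - by move=> x xr; rewrite (le_trans (HM x xr))// ler_norm.
have pw x : \sum_(i < 4) dt i x * X i x = (F1 x + \sum_(j < 3) F2j j x) - \sum_(j < 3) F3j j x.
  rewrite (@flux_identity R (U^~ x) (X^~ x) _ (dt^~ x) (fun j i => partial j (U i) x)
    (fun j i => partial j (X i) x) (p x) (fun j => partial j p x) (eqn x) (dU0 x) (dX0 x)).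
  congr (_ + _ - _).
  - by rewrite /F1 !sum4 /rotate/=; ring.
  - by rewrite exchange_big.
  - apply: eq_bigr => j _.
    by rewrite /F3j (partial_flux j (fun i => dX i x) (fun i => dU i x) (dp x)).2.
have [i2s e2s] := Rintegral_bigsum (index_enum 'I_3) i2.
have [i3s e3s] := Rintegral_bigsum (index_enum 'I_3) (fun j => (H3 j).1).
have i12 : leb3.-integrable setT (EFin \o (fun x => F1 x + \sum_(j < 3) F2j j x)).
  by have := integrableD measurableT i1 i2s; apply: eq_integrable.
rewrite /fpair (_ : (fun x => _) = (fun x => (F1 x + \sum_(j < 3) F2j j x) - \sum_(j < 3) F3j j x)); last exact/funext.
rewrite (RintegralB measurableT i12 i3s) e3s [X in _ - X]big1 ?subr0; last by move=> j _; exact: (H3 j).2.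
by rewrite (RintegralD measurableT i1 i2s) e2s.
Qed.

Lemma min4 (P : 'I_4 -> R -> Prop) : (forall i d d', 0 < d' -> d' <= d -> P i d -> P i d') ->
  (forall i, exists2 d, 0 < d & P i d) -> exists2 d, 0 < d & forall i, P i d.
Proof.
move=> mono H; have /choice[d Hd'] : forall i, exists d, 0 < d /\ P i d.
  by move=> i; have [d ? ?] := H i; exists d.
have d0 i := (Hd' i).1; have Hd i := (Hd' i).2.
have m0 : 0 < Num.min (Num.min (d 0) (d 1)) (Num.min (d 2) (d 3)) by rewrite !lt_min !d0.
exists (Num.min (Num.min (d 0) (d 1)) (Num.min (d 2) (d 3))) => //.
by apply: ord4P; apply: (mono _ _ _ m0 _ (Hd _)); rewrite !ge_min lexx ?orbT.
Qed.

Lemma pairing_evolution (m : nat) (T Omega N : R) (u : R -> R3 R -> 'rV[R]_(3 + 1)) p X :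
  (6 <= m)%N -> H_C1 m `[0, T] u -> (forall t x, 0 <= t <= T -> differentiable (u t) x) ->
  (forall t x, 0 < t < T -> [/\ derivable (fun s => u s x) t 1,
     differentiable (p t) x & boussinesq_eq Omega N u p t x]) ->
  (forall i, test_function (X i)) ->
  (forall x, \sum_(j < 3) partial j (X (lshift 1 j)) x = 0) ->
  forall t, 0 < t < T -> is_derive t 1 (fun s => pairing (u s) X)
    (pairing (u t) (rotate Omega N X) + transport (u t) X).
Proof.
move=> m6 uC1 du sol hX dX t tT.
have [r r0 Xr] := test_field_supp hX.
have tT' : 0 <= t <= T by move: tT => /andP[/ltW -> /ltW ->].
have cu s i : 0 <= s <= T -> continuous (component (u s) i).
  move=> sT x; apply: differentiable_continuous; apply: differentiable_component; exact: du.
pose dt (i : 'I_4) x := derive1 (fun s : R => u s x 0 i : R) t.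
have dut x i : derivable (fun s => u s x 0 i) t 1.
  by have [/derivable_mxP h _ _] := sol t x tT; exact: h.
have unif e : 0 < e -> exists2 d, 0 < d & forall i h, h != 0 -> `|h| < d -> 0 <= h + t <= T /\
    forall x, `|x| <= r -> `|h^-1 * (u (h + t) x 0 i - u t x 0 i) - dt i x| <= e.
  move=> e0; apply: (@min4 (fun i d => forall h, h != 0 -> `|h| < d -> 0 <= h + t <= T /\
    forall x, `|x| <= r -> `|h^-1 * (u (h + t) x 0 i - u t x 0 i) - dt i x| <= e)).
    by move=> i d d' _ dd' H h h0 hd; apply: H => //; exact: lt_le_trans dd'.
  by move=> i; exact: (H_C1_cube m6 r0 uC1 (fun s sT => cu s i sT) tT (fun x => dut x i) e0).
have dtb i : cube_bd r (dt i).
  split; first exact: (measurable_derive1_time tT (fun s sT => cu s i sT) (fun x => dut x i)).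
  (* On the cube the time derivative is within 1 of a single difference quotient, which is
     continuous in space and therefore bounded there. *)
  have [d d0 Hd] := unif 1 ltr01.
  have d20 : d / 2 != 0 by rewrite gt_eqF// divr_gt0.
  have [|hT Hh] := Hd i (d / 2) d20.
    by rewrite gtr0_norm ?divr_gt0// ltr_pdivrMr//; move: d0; clear; lra.
  have cD : continuous (fun x => (d / 2)^-1 * (component (u (d / 2 + t)) i x - component (u t) i x)).
    move=> x; apply: cvgM; first exact: cvg_cst.
    by apply: cvgB; apply: cu.
  have [B _ HB] := continuous_cube_bounded r cD.
  exists (1 + B) => x xr; rewrite -(subrK ((d / 2)^-1 * (component (u (d / 2 + t)) i x - component (u t) i x)) (dt i x)).
  by rewrite (le_trans (ler_normD _ _))// lerD// ?HB// distrC; exact: Hh.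
have bal : fpair dt X = pairing (u t) (rotate Omega N X) + transport (u t) X.
  apply: (weak_balance (p := p t) hX Xr dX) => //.
  - by move=> i x; apply: differentiable_component; exact: du.
  (* Differentiability alone does not bound the gradient; the Lipschitz constant on a larger cube
     does. *)
  - move=> i j; have r10 : 0 < r + 1 by rewrite addr_gt0.
    have It : `[0, T]%classic t by rewrite /= in_itv.
    have [L _ [_ HL]] := in_H_cube m6 r10 (uC1.1 t It) (cu t i tT').
    exists L; apply: lipschitz_partial_bound HL => x.
    by apply: diff_derivable; apply: differentiable_component; exact: du.
  - by move=> x; have [_] := sol t x tT.
  - by move=> x; have [a _ c] := sol t x tT; exact: (boussinesq_components a (du t x tT') c).1.
  - by move=> x; have [a _ c] := sol t x tT; exact: (boussinesq_components a (du t x tT') c).2.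
rewrite -bal; apply: (fpair_is_derive (f := fun s => component (u s)) hX Xr) => //.
- by move=> i; apply: continuous_cube_bd; exact: cu.
- move=> e e0; have [d d0 Hd] := unif e e0; exists d => // h h0 hd; split.
    by move=> i; apply: continuous_cube_bd; apply: cu; exact: (Hd i h h0 hd).1.
  by move=> i x xr; exact: (Hd i h h0 hd).2.
Qed.

End momentum.

(** * Compactly supported wave fields *)

Section wave_fields.
Context {R : realType}.
Implicit Types (w : R3 R -> 'rV[R]_(3 + 1)) (X f : 'I_4 -> R3 R -> R).

Lemma ord3P (P : 'I_3 -> Prop) : P 0 -> P 1 -> P 2 -> forall i, P i.
Proof.
move=> P0 P1 P2 [[|[|[|//]]] hi].
- by rewrite (_ : Ordinal hi = 0)//; exact: val_inj.
- by rewrite (_ : Ordinal hi = 1)//; exact: val_inj.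
- by rewrite (_ : Ordinal hi = 2)//; exact: val_inj.
Qed.

Definition wave (c : seq R) (k : seq 'I_3) (phi : R3 R -> R) : 'I_4 -> R3 R -> R :=
  fun i x => c`_i * partial k`_i phi x.

(* The fields A, B, Y, Z of the header; d1, d2, d3 are [partial 0], [partial 1], [partial 2]. *)
Definition waveA (mu : R) := wave [:: 1; 0; -1; mu^-1] [:: 2; 2; 0; 1].
Definition waveB (mu : R) := wave [:: 0; -1; 1; mu^-1] [:: 2; 2; 1; 0].
Definition waveY (mu : R) := wave [:: 0; 1; mu^-1; - mu^-1] [:: 2; 2; 1; 0].
Definition waveZ (mu : R) := wave [:: 1; 0; mu^-1; mu^-1] [:: 2; 2; 0; 1].

Lemma test_wave c k phi : test_function phi -> forall i, test_function (wave c k phi i).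
Proof. by move=> tphi i; apply: testZ; exact: test_partial. Qed.

Lemma partial_wave c k phi i j x : test_function phi ->
  partial j (wave c k phi i) x = c`_i * partial j (partial k`_i phi) x.
Proof.
move=> tphi; have [st _] := test_partial k`_i tphi.
by have := partialsZ [:: j] c`_i st => /= ->.
Qed.

Definition commuting (phi : R3 R -> R) := forall i j, partial i (partial j phi) = partial j (partial i phi).

Lemma divergence_waveA mu phi x : test_function phi -> commuting phi ->
  \sum_(j < 3) partial j (waveA mu phi (lshift 1 j)) x = 0.
Proof.
move=> tphi cphi; rewrite sum3 lshift0 lshift1 lshift2 !partial_wave//= (cphi 0).
by rewrite mul0r addr0 mul1r mulN1r subrr.
Qed.

Lemma divergence_waveB mu phi x : test_function phi -> commuting phi ->
  \sum_(j < 3) partial j (waveB mu phi (lshift 1 j)) x = 0.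
Proof.
move=> tphi cphi; rewrite sum3 lshift0 lshift1 lshift2 !partial_wave//= (cphi 1).
by rewrite mul0r add0r mul1r mulN1r addNr.
Qed.

Lemma rotate_waveA mu N phi : mu != 0 ->
  rotate (mu * N) N (waveA mu phi) =
  (fun i x => - N * waveB mu phi i x + N * (mu - 1) * waveY mu phi i x).
Proof.
move=> mu0; apply/funext; apply: ord4P; apply/funext => x; rewrite /rotate /waveA /waveB /waveY /wave /=.
- by ring.
- by ring.
- by field.
- by field.
Qed.

Lemma rotate_waveB mu N phi : mu != 0 ->
  rotate (mu * N) N (waveB mu phi) =
  (fun i x => N * waveA mu phi i x + N * (mu - 1) * waveZ mu phi i x).
Proof.
move=> mu0; apply/funext; apply: ord4P; apply/funext => x; rewrite /rotate /waveA /waveB /waveZ /wave /=.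
- by ring.
- by ring.
- by field.
- by field.
Qed.

Lemma fpair_linr f X X' a b r : (forall i, test_function (X i)) -> (forall i, test_function (X' i)) ->
  (forall i x, r < `|x| -> X i x = 0) -> (forall i x, r < `|x| -> X' i x = 0) ->
  (forall i, cube_bd r (f i)) ->
  fpair f (fun i x => a * X i x + b * X' i x) = a * fpair f X + b * fpair f X'.
Proof.
move=> hX hX' Xr Xr' fb; have i1 := fpair_integrable hX Xr fb; have i2 := fpair_integrable hX' Xr' fb.
have i1' : leb3.-integrable setT (EFin \o (fun x => a * (\sum_(i < 4) f i x * X i x))).
  by have := integrableZl measurableT a i1; apply: eq_integrable.
have i2' : leb3.-integrable setT (EFin \o (fun x => b * (\sum_(i < 4) f i x * X' i x))).
  by have := integrableZl measurableT b i2; apply: eq_integrable.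
rewrite /fpair -RintegralZl// -RintegralZl// -(RintegralD measurableT i1' i2').
apply: eq_Rintegral => x _; rewrite !mulr_sumr -big_split /=.
by apply: eq_bigr => i _; ring.
Qed.

Lemma grad_mu_component mu (psi : R3 R -> R) (i : 'I_4) x :
  component (grad_mu mu psi) i x = [:: - partial 1 psi x; partial 0 psi x; 0; mu * partial 2 psi x]`_i.
Proof. by rewrite /component mxE. Qed.

Lemma grad_mu_orthogonal mu psi phi X (i j : 'I_3) : mu != 0 -> (forall x, differentiable psi x) ->
  (forall k, continuous (component (grad_mu mu psi) k)) -> test_function phi -> commuting phi ->
  (forall x, \sum_(l < 4) component (grad_mu mu psi) l x * X l x =
     partial i psi x * partial j phi x - partial j psi x * partial i phi x) ->
  pairing (grad_mu mu psi) X = 0.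
Proof.
move=> mu0 dpsi cg tphi cphi XE.
have c0 : continuous (partial 0 psi).
  rewrite (_ : partial 0 psi = component (grad_mu mu psi) 1); first exact: cg.
  by apply/funext => x; rewrite grad_mu_component.
have c1 : continuous (partial 1 psi).
  rewrite (_ : partial 1 psi = (fun x => - component (grad_mu mu psi) 0 x)).
    by move=> x; apply: cvgN; exact: cg.
  by apply/funext => x; rewrite grad_mu_component opprK.
have c2 : continuous (partial 2 psi).
  rewrite (_ : partial 2 psi = (fun x => mu^-1 * component (grad_mu mu psi) 3 x)).
    by move=> x; apply: cvgM; [exact: cvg_cst|exact: cg].
  by apply/funext => x; rewrite grad_mu_component /= mulKf.
have cc := @ord3P (fun k => continuous (partial k psi)) c0 c1 c2.
rewrite /pairing /fpair (_ : (fun x => _) = (fun x => partial i psi x * partial j phi x - partial j psi x * partial i phi x)); last exact/funext.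
exact: (curl_orthogonal dpsi (cc i) (cc j) tphi (cphi i j)).
Qed.

(** The entry 1/mu in the last component cancels the mu of [grad_mu], so each product becomes an
    antisymmetric expression in two partial derivatives, of the kind treated by
    [curl_orthogonal]. *)
Lemma grad_mu_waves mu psi phi : mu != 0 -> (forall x, differentiable psi x) ->
  (forall k, continuous (component (grad_mu mu psi) k)) -> test_function phi -> commuting phi ->
  [/\ pairing (grad_mu mu psi) (waveA mu phi) = 0, pairing (grad_mu mu psi) (waveB mu phi) = 0,
      pairing (grad_mu mu psi) (waveY mu phi) = 0 & pairing (grad_mu mu psi) (waveZ mu phi) = 0].
Proof.
move=> mu0 dpsi cg tphi cphi.
have wave_auxA (y0 y1 y2 z0 z1 z2 : R) : - y1 * (1 * z2) + y0 * (0 * z2) + 0 * (-1 * z0) + mu * y2 * (mu^-1 * z1) = y2 * z1 - y1 * z2 by field.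
have wave_auxB (y0 y1 y2 z0 z1 z2 : R) : - y1 * (0 * z2) + y0 * (-1 * z2) + 0 * (1 * z1) + mu * y2 * (mu^-1 * z0) = y2 * z0 - y0 * z2 by field.
have wave_auxY (y0 y1 y2 z0 z1 z2 : R) : - y1 * (0 * z2) + y0 * (1 * z2) + 0 * (mu^-1 * z1) + mu * y2 * (- mu^-1 * z0) = y0 * z2 - y2 * z0 by field.
have wave_auxZ (y0 y1 y2 z0 z1 z2 : R) : - y1 * (1 * z2) + y0 * (0 * z2) + 0 * (mu^-1 * z0) + mu * y2 * (mu^-1 * z1) = y2 * z1 - y1 * z2 by field.
split.
- apply: (grad_mu_orthogonal (i := 2) (j := 1) mu0 dpsi cg tphi cphi) => x.
  rewrite sum4 !grad_mu_component /waveA /wave /=.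
  by rewrite wave_auxA//.
- apply: (grad_mu_orthogonal (i := 2) (j := 0) mu0 dpsi cg tphi cphi) => x.
  rewrite sum4 !grad_mu_component /waveB /wave /=.
  by rewrite wave_auxB//.
- apply: (grad_mu_orthogonal (i := 0) (j := 2) mu0 dpsi cg tphi cphi) => x.
  rewrite sum4 !grad_mu_component /waveY /wave /=.
  by rewrite wave_auxY//.
- apply: (grad_mu_orthogonal (i := 2) (j := 1) mu0 dpsi cg tphi cphi) => x.
  rewrite sum4 !grad_mu_component /waveZ /wave /=.
  by rewrite wave_auxZ//.
Qed.

(** The coefficients depend on mu while the constant must not. Bounding them by 2 covers 0, 1, -1
    and, for mu >= 1/2, also 1/mu and -1/mu. *)
Lemma wave_bounds phi (k : seq 'I_3) r : test_function phi -> (forall x, r < `|x| -> phi x = 0) ->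
  exists2 K, 0 < K & forall c : seq R, (forall i : nat, `|c`_i| <= 2) ->
  (forall f e, (forall i, measurable_fun setT (f i)) -> 0 <= e ->
    {ae leb3, forall x : R3 R, `|x| <= r -> forall i, `|f i x| <= e} ->
    `|fpair f (wave c k phi)| <= K * e) /\
  (forall w e, (forall i, measurable_fun setT (component w i)) -> 0 <= e ->
    {ae leb3, forall x : R3 R, `|x| <= r -> forall i, `|component w i x| <= e} ->
    `|transport w (wave c k phi)| <= K * e ^+ 2).
Proof.
move=> tphi phir.
have tk (i : 'I_4) : test_function (partial k`_i phi) by exact: test_partial.
have rk (i : 'I_4) x : r < `|x| -> partial k`_i phi x = 0 by exact: partial_supp.
have [K K0 HK] := fpair_bound tk rk.
have /choice[L HL] : forall j : 'I_3, exists L, 0 < L /\ forall f e, (forall i, measurable_fun setT (f i)) -> 0 <= e ->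
    {ae leb3, forall x : R3 R, `|x| <= r -> forall i, `|f i x| <= e} ->
    `|fpair f (fun i => partial j (partial k`_i phi))| <= L * e.
  move=> j; have tj (i : 'I_4) : test_function (partial j (partial k`_i phi)) by exact: test_partial.
  have rj (i : 'I_4) x : r < `|x| -> partial j (partial k`_i phi) x = 0 by apply: partial_supp; exact: rk.
  have [L L0 H] := fpair_bound tj rj; exists L; split => // f e mf e0 fe.
  by have [] := H f e mf e0 fe.
have scal f (c : seq R) : (forall i : nat, `|c`_i| <= 2) -> forall e, (forall i, measurable_fun setT (f i)) -> 0 <= e ->
    {ae leb3, forall x : R3 R, `|x| <= r -> forall i, `|f i x| <= e} ->
    (forall i : 'I_4, measurable_fun setT (fun x : R3 R => c`_i * f i x)) /\
    {ae leb3, forall x : R3 R, `|x| <= r -> forall i : 'I_4, `|c`_i * f i x| <= 2 * e}.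
  move=> c2 e mf e0 fe; split; first by move=> i; exact: measurable_funM.
  apply: filterS fe => x H xr i; rewrite normrM ler_pM//; exact: H.
exists (2 * K + 2 * \sum_j L j).
  by rewrite ltr_pwDl ?mulr_gt0// mulr_ge0// sumr_ge0// => j _; apply: ltW; exact: (HL j).1.
have LS : 0 <= 2 * \sum_j L j by rewrite mulr_ge0// sumr_ge0// => j _; apply: ltW; exact: (HL j).1.
move=> c c2; split.
  move=> f e mf e0 fe.
  have -> : fpair f (wave c k phi) = fpair (fun i x => c`_i * f i x) (fun i => partial k`_i phi).
    rewrite /fpair; apply: eq_Rintegral => x _; apply: eq_bigr => i _.
    by rewrite /wave; ring.
  have [mf' fe'] := scal f c c2 e mf e0 fe.
  have e20 : 0 <= 2 * e by rewrite mulr_ge0.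
  have [_ H] := HK (fun i x => c`_i * f i x) (2 * e) mf' e20 fe'.
  apply: (le_trans H); rewrite -subr_ge0 (_ : _ - _ = (2 * \sum_j L j) * e); last by ring.
  exact: mulr_ge0.
move=> w e mw e0 we.
rewrite /transport (le_trans (ler_norm_sum _ _ _))//.
apply: (@le_trans _ _ (\sum_j L j * (2 * e ^+ 2))); last first.
  by rewrite -mulr_suml mulrA [_ * 2]mulrC ler_wpM2r ?sqr_ge0// lerDr mulr_ge0// ltW.
apply: ler_sum => j _.
have -> : fpair (fun i => component w i \* component w (lshift 1 j)) (fun i => partial j (wave c k phi i)) =
    fpair (fun i x => c`_i * (component w i \* component w (lshift 1 j)) x) (fun i => partial j (partial k`_i phi)).
  rewrite /fpair; apply: eq_Rintegral => x _; apply: eq_bigr => i _.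
  by rewrite partial_wave//=; ring.
have mf i : measurable_fun setT (component w i \* component w (lshift 1 j)) by exact: measurable_funM.
have fe : {ae leb3, forall x : R3 R, `|x| <= r -> forall i, `|(component w i \* component w (lshift 1 j)) x| <= e ^+ 2}.
  by apply: filterS we => x H xr i; rewrite /= normrM expr2 ler_pM//; exact: H.
have [mf' fe'] := scal (fun i => component w i \* component w (lshift 1 j)) c c2 (e ^+ 2) mf (sqr_ge0 e) fe.
have e20 : 0 <= 2 * e ^+ 2 by rewrite mulr_ge0// sqr_ge0.
exact: ((HL j).2 _ _ mf' e20 fe').
Qed.

End wave_fields.

(** * Averages in time under a bound on the integral of a power *)

Section time_average.
Context {R : realType}.

(* [g] need not be measurable, as the integral of a nonnegative function is a
   supremum over simple functions below it. This matters because nothing is known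
   about the measurability in time of the W^{1,oo} distance. *)
Lemma le_integral_lower (D E : set (measurableTypeR R)) (f g : R -> \bar R) : D `<=` E ->
  (forall x, D x -> (0 <= f x)%E) -> (forall x, (0 <= g x)%E) -> (forall x, D x -> (f x <= g x)%E) ->
  (\int[lebesgue_measure]_(x in D) f x <= \int[lebesgue_measure]_(x in E) g x)%E.
Proof.
move=> DE f0 g0 fg; rewrite (integral_mkcond D) (integral_mkcond E).
have F0 x : (0 <= (f \_ D) x)%E by rewrite patchE; case: ifPn => // /set_mem; exact: f0.
have G0 x : (0 <= (g \_ E) x)%E by rewrite patchE; case: ifPn.
rewrite ge0_integralTE// ge0_integralTE//; apply: ereal_sup_le => _ [h hf <-].
exists h => // x; apply: (le_trans (hf x)).
rewrite !patchE; case: ifPn => [/set_mem Dx|_]; last by case: ifPn.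
by rewrite mem_set ?fg//; exact: DE.
Qed.

(** If e > c, then e is increased by the factor (e/c)^(q-1) >= 1. A small [c] can later be absorbed,
    at a price paid in front of e^q. *)
Lemma ler_powR_split (q c e : R) : 1 <= q -> 0 < c -> 0 <= e -> e <= c + c `^ (1 - q) * e `^ q.
Proof.
move=> q1 c0 e0; have [ec|ce] := leP e c.
  by rewrite (le_trans ec)// lerDl mulr_ge0// powR_ge0.
have e1 : 0 < e by exact: lt_trans ce.
have -> : c `^ (1 - q) * e `^ q = e * ((c `^ (q - 1))^-1 * e `^ (q - 1)).
  by rewrite -(powRN c) opprB mulrCA mulr_powRB1//; lra.
have h : 1 <= (c `^ (q - 1))^-1 * e `^ (q - 1).
  rewrite ler_pdivlMl ?powR_gt0// mulr1; apply: ge0_ler_powR; rewrite ?nnegrE ?subr_ge0// ltW//.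
  by rewrite (le_trans (ler_peMr e0 h))// lerDr ltW.
Qed.

Lemma sqr_le_powR (q e : R) : 2 <= q -> 0 <= e -> e ^+ 2 <= 1 + e `^ q.
Proof.
move=> q2 e0; have [e1|e1] := leP e 1.
  by rewrite (@le_trans _ _ 1)// ?lerDl ?powR_ge0// expr_le1.
by rewrite -powR_mulrn// (@le_trans _ _ (e `^ q))// ?lerDr// ler_powR// ltW.
Qed.

Lemma average_bound (q tau T I a b : R) (W : R -> \bar R) (h : R -> R) :
  0 < q -> 0 < tau <= T -> 0 <= a -> 0 < b -> (forall t, (0 <= W t)%E) ->
  (\int[lebesgue_measure]_(t in `]0%R, T[) (W t `^ q) <= I%:E)%E ->
  {within `[0, tau], continuous h} -> (forall t, 0 <= h t) ->
  (forall t e, 0 < t < tau -> 0 <= e -> (W t <= e%:E)%E -> h t <= a + b * e `^ q) ->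
  (\int[lebesgue_measure]_(t in `[0%R, tau]) (h t)%:E <= (a * tau + b * I)%:E)%E.
Proof.
move=> q0 /andP[tau0 tauT] a0 b0 W0 WI ch h0 hW.
(* [W] may be neither measurable nor finite, so linearity of the integral is used on [k] instead: it
   is measurable because [h] is continuous, and it lies below W^q on the open interval. Only
   monotonicity is applied to W^q. *)
pose k t := Num.max 0 ((h t - a) / b).
have mh : measurable_fun `[0, tau]%classic h by apply: subspace_continuous_measurable_fun.
have mk : measurable_fun `[0, tau]%classic k.
  apply: measurable_maxr; first exact: measurable_cst.
  by apply: measurable_funM => //; exact: measurable_funB.
have k0 t : 0 <= k t by rewrite le_max lexx.
have hk t : h t <= a + b * k t.
  rewrite -lerBlDl -ler_pdivrMl// mulrC; by rewrite le_max lexx orbT.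
have sub : (`]0, tau[%classic : set R) `<=` `[0, tau]%classic by exact: subset_itv_oo_cc.
have mh' := measurable_funS (measurable_itv _) sub mh.
have mk' := measurable_funS (measurable_itv _) sub mk.
have kI : (\int[lebesgue_measure]_(t in `]0%R, tau[) (k t)%:E <= I%:E)%E.
  apply: le_trans WI; apply: le_integral_lower.
  - by apply: subset_itvl; rewrite bnd_simp.
  - by move=> t _; rewrite lee_fin.
  - by move=> t; exact: poweR_ge0.
  - move=> t; rewrite /= in_itv/= => tt; have := W0 t; have := hW t; case: (W t) => [e|//|//] H e0.
      rewrite poweR_EFin lee_fin ge_max powR_ge0/= ler_pdivrMr// lerBlDl mulrC.
      by apply: H.
    by rewrite poweRyr ?leey// gt_eqF.
rewrite (@integral_itv_bndoo R 0 tau (EFin \o h) true false)//; last exact/measurable_EFinP.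
apply: (@le_trans _ _ (\int[lebesgue_measure]_(t in `]0%R, tau[) (a%:E + b%:E * (k t)%:E))%E).
  apply: ge0_le_integral => //.
  - by move=> t _; rewrite lee_fin.
  - exact/measurable_EFinP.
  - by apply: emeasurable_funD => //; apply: measurable_funeM; exact/measurable_EFinP.
  - by move=> t _; rewrite -EFinM -EFinD lee_fin.
rewrite ge0_integralD//; last 2 first.
- by move=> t _; rewrite -EFinM lee_fin mulr_ge0// ltW.
- by apply: measurable_funeM; exact/measurable_EFinP.
rewrite ge0_integralZl//; [|exact/measurable_EFinP|by move=> t _; rewrite lee_fin|by rewrite lee_fin ltW].
rewrite integral_cst//= lebesgue_measure_itv/= lte_fin tau0 sube0 EFinD -EFinM leeD// [leRHS]EFinM.
by rewrite lee_wpmul2l// lee_fin ltW.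
Qed.

Lemma growth_bound (delta c B e x y : R) : delta * e <= delta * (c + y * x) -> e ^+ 2 <= 1 + x ->
  delta * e + (e + B) ^+ 2 <= delta * c + 2 * (1 + B ^+ 2) + (delta * y + 2) * x.
Proof. by move=> h1 h2; have h3 := sqr_ge0 (e - B); nra. Qed.

Lemma collect_bounds (D tau K c x I delta B J : R) : 0 <= tau ->
  D * tau <= (K * c + J) * tau + K * x * I ->
  J <= K * (delta * c + 2 * (1 + B ^+ 2)) * tau + K * (delta * x + 2) * I ->
  D * tau <= K * (c * tau + x * I) +
    tau * K * (delta * (c * tau + x * I) + 2 * (1 + B ^+ 2) * tau + 2 * I).
Proof.
move=> t0 h1 /(ler_wpM2r t0) h2; apply: (le_trans h1).
rewrite -subr_ge0; rewrite -subr_ge0 in h2; move: h2; congr (_ <= _); ring.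
Qed.

(** No single time is controlled, as [W] is bounded only in L^q. Therefore |D 0| <= |D t| + J, with
    J the integral of |G| over [0, tau], is averaged over t. [average_bound] is applied to |G|,
    which bounds J, and then to |D| + J. *)
Lemma oscillation_bound (q tau T I K delta B c : R) (W : R -> \bar R) (D G : R -> R) :
  2 <= q -> 0 < tau <= T -> 0 < K -> 0 <= delta -> 0 < c -> (forall t, (0 <= W t)%E) ->
  (\int[lebesgue_measure]_(t in `]0%R, T[) (W t `^ q) <= I%:E)%E ->
  {within `[0, tau], continuous D} -> {within `[0, tau], continuous G} ->
  (forall t, 0 < t < tau -> is_derive t 1 D (G t)) ->
  (forall t e, 0 < t < tau -> 0 <= e -> (W t <= e%:E)%E ->
     `|D t| <= K * e /\ `|G t| <= K * (delta * e + (e + B) ^+ 2)) ->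
  `|D 0| * tau <= K * (c * tau + c `^ (1 - q) * I) +
    tau * K * (delta * (c * tau + c `^ (1 - q) * I) + 2 * (1 + B ^+ 2) * tau + 2 * I).
Proof.
move=> q2 tauT K0 delta0 c0 W0 WI cD cG dD HW; have /andP[tau0 _] := tauT.
have q1 : 1 <= q by lra.
have q0 : 0 < q by lra.
have cp : 0 < c `^ (1 - q) by rewrite powR_gt0.
have cabs (f : R -> R) (s : R) : {within `[0, s], continuous f} -> {within `[0, s], continuous (fun t => `|f t|)}.
  by move=> /subspace_continuousP cf; apply/subspace_continuousP => x xs; apply: cvg_norm; exact: cf.
pose b2 := K * (delta * c `^ (1 - q) + 2).
have b20 : 0 < b2 by rewrite mulr_gt0// ltr_wpDl// mulr_ge0// ltW.
have HG : (\int[lebesgue_measure]_(t in `[0%R, tau]) `|G t|%:E <=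
   (K * (delta * c + 2 * (1 + B ^+ 2)) * tau + b2 * I)%:E)%E.
  apply: (average_bound q0 tauT _ b20 W0 WI (cabs _ _ cG)) => //.
    by rewrite mulr_ge0 ?(ltW K0)// addr_ge0 ?mulr_ge0 ?(ltW c0)// addr_ge0 ?sqr_ge0.
  move=> t e tt e0 We; have [_ Ge] := HW t e tt e0 We.
  apply: (le_trans Ge); rewrite /b2 -mulrA -mulrDr ler_wpM2l ?(ltW K0)//.
  have s1 := ler_powR_split q1 c0 e0; have s2 := sqr_le_powR q2 e0.
  exact: growth_bound (ler_wpM2l delta0 s1) s2.
have HD : (\int[lebesgue_measure]_(t in `[0%R, tau]) (`|D t| + fine (\int[lebesgue_measure]_(t in `[0%R, tau]) `|G t|%:E))%:E <=
   ((K * c + fine (\int[lebesgue_measure]_(t in `[0%R, tau]) `|G t|%:E)) * tau + K * c `^ (1 - q) * I)%:E)%E.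
  set J := fine _; have J0 : 0 <= J by apply: fine_ge0; apply: integral_ge0.
  apply: (average_bound q0 tauT _ _ W0 WI) => //.
  - by rewrite addr_ge0 ?mulr_ge0 ?(ltW K0) ?(ltW c0).
  - by rewrite mulr_gt0.
  - apply/subspace_continuousP => x xs; apply: cvgD; last exact: cvg_cst.
    by move/subspace_continuousP: (cabs _ _ cD); exact.
  - by move=> t; rewrite addr_ge0.
  - move=> t e tt e0 We; have [De _] := HW t e tt e0 We.
    have s1 := ler_powR_split q1 c0 e0.
    rewrite addrAC lerD2r (le_trans De)// -mulrA -mulrDr ler_wpM2l// ltW//.
have iG : lebesgue_measure.-integrable `[0, tau]%classic (fun t => `|G t|%:E).
  by apply: continuous_compact_integrable; [exact: segment_compact|exact: cabs].
have JE : (\int[lebesgue_measure]_(t in `[0%R, tau]) `|G t|%:E = (fine (\int[lebesgue_measure]_(t in `[0%R, tau]) `|G t|%:E))%:E)%E.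
  by rewrite fineK//; apply: integrable_fin_num.
move: HG HD JE; set J := fine _ => HG HD JE.
have ftc t : 0 < t < tau -> `|D 0| <= `|D t| + J.
  move=> /andP[t0 tt].
  have sub : (`[0, t]%classic : set R) `<=` `[0, tau]%classic by apply: subset_itvl; rewrite bnd_simp ltW.
  have cGt : {within `[0, t], continuous G} by exact: continuous_subspaceW cG.
  have cDt : {within `[0, t], continuous D} by exact: continuous_subspaceW cD.
  have [_ D0 Dt] := (continuous_within_itvP D t0).1 cDt.
  have dD' s : s \in `]0, t[ -> is_derive s 1 D (G s).
    by rewrite in_itv/= => /andP[s0 st]; apply: dD; rewrite s0 (lt_trans st).
  have F := @continuous_FTC2 R G D 0 t t0 cGt.
  have {}F : (\int[lebesgue_measure]_(x in `[0%R, t]) (G x)%:E = (D t)%:E - (D 0)%:E)%E.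
    apply: F; first by split => // s st; have [] := dD' s st.
    by move=> s st; rewrite derive1E; have [_] := dD' s st.
  have iGt : lebesgue_measure.-integrable `[0, t]%classic (EFin \o G).
    by apply: continuous_compact_integrable => //; exact: segment_compact.
  have mGt : measurable_fun `[0, t]%classic (EFin \o G) by case/integrableP: iGt.
  have := le_abse_integral lebesgue_measure (measurable_itv `[0, t]) mGt; rewrite F -EFinB /= => H.
  have H2 : (`|D t - D 0|%:E <= J%:E)%E.
    by rewrite -JE; apply: (le_trans H); exact: le_integral_lower.
  move: H2; rewrite lee_fin => H2.
  by rewrite -[D 0](subKr (D t)) (le_trans (ler_normB _ _))// lerD2l.
have : (\int[lebesgue_measure]_(t in `]0%R, tau[) (cst `|D 0|%:E t) <= ((K * c + J) * tau + K * c `^ (1 - q) * I)%:E)%E.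
  apply: le_trans HD; apply: le_integral_lower.
  - exact: subset_itv_oo_cc.
  - by move=> t _; rewrite lee_fin.
  - by move=> t; rewrite lee_fin addr_ge0// /J fine_ge0// integral_ge0.
  - by move=> t; rewrite /= in_itv/= lee_fin; exact: ftc.
rewrite integral_cst//= lebesgue_measure_itv/= lte_fin tau0 sube0 -EFinM lee_fin => H.
rewrite JE lee_fin in HG; exact: collect_bounds (ltW tau0) H HG.
Qed.

End time_average.

(** * The pairing D corrected by the phase, and its derivative *)

Section solution_estimates.
Context {R : realType}.
Implicit Types (w : R3 R -> 'rV[R]_(3 + 1)) (X f : 'I_4 -> R3 R -> R).

Lemma within_continuousD (A : set R) (f g : R -> R) : {within A, continuous f} ->
  {within A, continuous g} -> {within A, continuous (fun t => f t + g t)}.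
Proof.
move=> /subspace_continuousP cf /subspace_continuousP cg; apply/subspace_continuousP => x Ax.
by apply: cvgD; [exact: cf|exact: cg].
Qed.

Lemma within_continuousM (A : set R) (f g : R -> R) : {within A, continuous f} ->
  {within A, continuous g} -> {within A, continuous (fun t => f t * g t)}.
Proof.
move=> /subspace_continuousP cf /subspace_continuousP cg; apply/subspace_continuousP => x Ax.
by apply: cvgM; [exact: cf|exact: cg].
Qed.

Section fixed_solution.
Context (m : nat) (T : R) (u : R -> R3 R -> 'rV[R]_(3 + 1)).
Context (m6 : (6 <= m)%N) (uH : H_cont m `[0, T] u).
Context (du : forall t x, 0 <= t <= T -> differentiable (u t) x).

Lemma component_continuous t i : 0 <= t <= T -> continuous (component (u t) i).
Proof.
by move=> tT x; apply: differentiable_continuous; apply: differentiable_component; exact: du.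
Qed.

Lemma component_unif (r : R) : 0 < r -> forall t, `[0, T]%classic t -> forall e, 0 < e ->
  exists2 d, 0 < d & forall s, `[0, T]%classic s -> `|s - t| < d ->
    forall (i : 'I_4) x, `|x| <= r -> `|component (u s) i x - component (u t) i x| <= e.
Proof.
move=> r0 t It e e0.
have H (i : 'I_4) : exists2 d, 0 < d & forall s, `[0, T]%classic s -> `|s - t| < d ->
    forall x : R3 R, `|x| <= r -> `|component (u s) i x - component (u t) i x| <= e.
  have cu s : `[0, T]%classic s -> continuous (component (u s) i).
    by rewrite /= in_itv/=; exact: component_continuous.
  exact: (H_cont_cube m6 r0 uH cu It e0).
have [|d d0 Hd] := min4 _ H.
  by move=> i d d' _ dd' H' s Is sd; apply: H' => //; exact: lt_le_trans dd'.
by exists d => // s Is sd i x xr; exact: Hd.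
Qed.

Lemma pairing_continuous X : (forall i, test_function (X i)) ->
  {within `[0, T], continuous (fun t => pairing (u t) X)}.
Proof.
move=> hX; have [r r0 Xr] := test_field_supp hX.
apply: (fpair_within_continuous (f := fun t => component (u t)) hX Xr).
  by move=> t; rewrite /= in_itv/= => tT i; apply: continuous_cube_bd; exact: component_continuous.
exact: component_unif.
Qed.

Lemma product_unif (j : 'I_4) (r : R) : 0 < r -> forall t, `[0, T]%classic t -> forall e, 0 < e ->
  exists2 d, 0 < d & forall s, `[0, T]%classic s -> `|s - t| < d ->
    forall (i : 'I_4) x, `|x| <= r ->
      `|(component (u s) i \* component (u s) j) x - (component (u t) i \* component (u t) j) x| <= e.
Proof.
move=> r0 t It e e0; have tT : 0 <= t <= T by move: It; rewrite /= in_itv.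
have /choice[B HB] : forall i, exists B, 0 < B /\ forall x : R3 R, `|x| <= r -> `|component (u t) i x| <= B.
  move=> i; have ci : continuous (component (u t) i) by exact: component_continuous.
  by have [B B0 HB] := continuous_cube_bounded r ci; exists B.
have B0 i : 0 <= B i by apply: ltW; exact: (HB i).1.
pose S := \sum_i B i.
have S0 : 0 <= S by rewrite sumr_ge0.
have BS i : B i <= S by rewrite /S (bigD1 i)//= lerDl sumr_ge0.
have SB i x : `|x| <= r -> `|component (u t) i x| <= S by move=> xr; rewrite (le_trans ((HB i).2 x xr)).
(* A difference of products is at most e'^2 + 2 S e' when both factors move by at most e'; with e'
   <= 1 this is at most e' (2 S + 1). *)
pose e' := Num.min 1 (e / (2 * S + 1)).
have e'0 : 0 < e' by rewrite lt_min ltr01 divr_gt0// ltr_wpDl// mulr_ge0.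
have [d d0 Hd] := component_unif r0 It e'0; exists d => // s Is sd i x xr.
have h1 := Hd s Is sd i x xr; have h2 := Hd s Is sd j x xr.
have h3 := SB i x xr; have h4 := SB j x xr.
have e'1 : e' <= 1 by rewrite /e' ge_min lexx.
have e'2 : e' * (2 * S + 1) <= e.
  by rewrite -ler_pdivlMr ?ltr_wpDl ?mulr_ge0// /e' ge_min lexx orbT.
rewrite /=; move: (component (u s) i x) (component (u s) j x) (component (u t) i x) (component (u t) j x) h1 h2 h3 h4.
move=> a b c d' h1 h2 h3 h4.
have -> : a * b - c * d' = (a - c) * (b - d') + (a - c) * d' + c * (b - d') by ring.
rewrite (le_trans (ler_normD _ _))// (@le_trans _ _ (e' * 1 + e' * S + S * e'))//; last first.
  by apply: le_trans e'2; rewrite le_eqVlt; apply/orP; left; apply/eqP; ring.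
rewrite lerD// ?(le_trans (ler_normD _ _))// ?lerD// normrM ler_pM//.
exact: le_trans h2 e'1.
Qed.

Lemma transport_continuous X : (forall i, test_function (X i)) ->
  {within `[0, T], continuous (fun t => transport (u t) X)}.
Proof.
move=> hX; have [r r0 Xr] := test_field_supp hX.
have H (j : 'I_3) : {within `[0, T], continuous (fun t => fpair (fun i => component (u t) i \* component (u t) (lshift 1 j)) (fun i => partial j (X i)))}.
  apply: (@fpair_within_continuous _ (fun i => partial j (X i)) r _ (fun t i => component (u t) i \* component (u t) (lshift 1 j))).
  - by move=> i; exact: test_partial.
  - by move=> i x rx; rewrite (partial_supp j (Xr i)).
  - move=> t; rewrite /= in_itv/= => tT i; apply: continuous_cube_bd => x.
    by apply: cvgM; exact: component_continuous.
  - exact: product_unif.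
rewrite (_ : (fun t => _) = (fun t => fpair (fun i => component (u t) i \* component (u t) (lshift 1 0)) (fun i => partial 0 (X i))
   + fpair (fun i => component (u t) i \* component (u t) (lshift 1 1)) (fun i => partial 1 (X i))
   + fpair (fun i => component (u t) i \* component (u t) (lshift 1 2)) (fun i => partial 2 (X i)))).
  by apply: within_continuousD; [apply: within_continuousD|]; exact: H.
by apply/funext => t; rewrite /transport sum3.
Qed.

End fixed_solution.

Definition phase_pairing (N mu : R) phi w t : R :=
  cos (N * t) * pairing w (waveA mu phi) + sin (N * t) * pairing w (waveB mu phi).

Definition phase_rate (N mu : R) phi w t : R :=
  cos (N * t) * (N * (mu - 1) * pairing w (waveY mu phi) + transport w (waveA mu phi)) +
  sin (N * t) * (N * (mu - 1) * pairing w (waveZ mu phi) + transport w (waveB mu phi)).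

Lemma continuous_cosM (N : R) : continuous (fun t : R => cos (N * t)).
Proof.
move=> t; apply: (@continuous_comp _ _ _ (fun t : R => N * t) cos); last exact: continuous_cos.
by apply: cvgM; [exact: cvg_cst|exact: cvg_id].
Qed.

Lemma continuous_sinM (N : R) : continuous (fun t : R => sin (N * t)).
Proof.
move=> t; apply: (@continuous_comp _ _ _ (fun t : R => N * t) sin); last exact: continuous_sin.
by apply: cvgM; [exact: cvg_cst|exact: cvg_id].
Qed.

Lemma phase_continuous m T u N mu phi : (6 <= m)%N -> H_cont m `[0, T] u ->
  (forall t x, 0 <= t <= T -> differentiable (u t) x) -> test_function phi ->
  {within `[0, T], continuous (fun t => phase_pairing N mu phi (u t) t)} /\
  {within `[0, T], continuous (fun t => phase_rate N mu phi (u t) t)}.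
Proof.
move=> m6 uH du tphi.
have cc : {within `[0, T], continuous (fun t : R => cos (N * t))}.
  by apply: continuous_subspaceT; exact: continuous_cosM.
have cs : {within `[0, T], continuous (fun t : R => sin (N * t))}.
  by apply: continuous_subspaceT; exact: continuous_sinM.
have ck : {within `[0, T], continuous (fun t : R => N * (mu - 1))}.
  by apply: continuous_subspaceT => x; exact: cvg_cst.
have P X (hX : forall i, test_function (X i)) := pairing_continuous m6 uH du hX.
have Q X (hX : forall i, test_function (X i)) := transport_continuous m6 uH du hX.
have tw c k := test_wave c k tphi.
split.
  apply: within_continuousD; apply: within_continuousM => //; apply: P; exact: tw.
apply: within_continuousD; apply: within_continuousM => //; apply: within_continuousD.
- by apply: within_continuousM => //; apply: P; exact: tw.
- by apply: Q; exact: tw.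
- by apply: within_continuousM => //; apply: P; exact: tw.
- by apply: Q; exact: tw.
Qed.

(* The rotation at frequency [N] removes the O(N) coupling of the two pairings. *)
Lemma product_rule_cancel (f g a b : R -> R) (t N A B y z : R) :
  is_derive t 1 f (- g t * N) -> is_derive t 1 g (f t * N) ->
  is_derive t 1 a (- N * b t + y + A) -> is_derive t 1 b (N * a t + z + B) ->
  is_derive t 1 (fun s => f s * a s + g s * b s) (f t * (y + A) + g t * (z + B)).
Proof.
move=> df dg da db.
have d1 := is_deriveM df da; have d2 := is_deriveM dg db.
apply: (is_derive_eq (is_deriveD d1 d2)); rewrite /GRing.scale/=.
by move: (f t) (g t) (a t) (b t) => f0 g0 a0 b0; ring.
Qed.

Lemma phase_derivative m T u p N mu phi : (6 <= m)%N -> H_C1 m `[0, T] u ->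
  (forall t x, 0 <= t <= T -> differentiable (u t) x) -> mu != 0 ->
  (forall t x, 0 < t < T -> [/\ derivable (fun s => u s x) t 1,
     differentiable (p t) x & boussinesq_eq (mu * N) N u p t x]) ->
  test_function phi -> commuting phi ->
  forall t, 0 < t < T -> is_derive t 1 (fun s => phase_pairing N mu phi (u s) s) (phase_rate N mu phi (u t) t).
Proof.
move=> m6 uC1 du mu0 sol tphi cphi t tT.
have tw c k := test_wave c k tphi.
have tT' : 0 <= t <= T by move: tT => /andP[/ltW -> /ltW ->].
have [r r0 phir] : exists2 r, 0 < r & forall x, r < `|x| -> phi x = 0.
  have [r r0 H] := test_field_supp (n := 1) (X := fun=> phi) (fun=> tphi).
  by exists r => // x; exact: (H 0).
have wr c k i x : r < `|x| -> wave c k phi i x = 0.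
  by move=> rx; rewrite /wave (partial_supp k`_i phir)// mulr0.
have cb (i : 'I_4) : cube_bd r (component (u t) i).
  by apply: continuous_cube_bd => x; apply: differentiable_continuous; apply: differentiable_component; exact: du.
have EA : pairing (u t) (rotate (mu * N) N (waveA mu phi)) =
    - N * pairing (u t) (waveB mu phi) + N * (mu - 1) * pairing (u t) (waveY mu phi).
  rewrite (rotate_waveA N phi mu0).
  exact: (fpair_linr (- N) (N * (mu - 1)) (tw _ _) (tw _ _) (wr _ _) (wr _ _) cb).
have EB : pairing (u t) (rotate (mu * N) N (waveB mu phi)) =
    N * pairing (u t) (waveA mu phi) + N * (mu - 1) * pairing (u t) (waveZ mu phi).
  rewrite (rotate_waveB N phi mu0).
  exact: (fpair_linr N (N * (mu - 1)) (tw _ _) (tw _ _) (wr _ _) (wr _ _) cb).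
have dA : is_derive t 1 (fun s => pairing (u s) (waveA mu phi))
    (- N * pairing (u t) (waveB mu phi) + N * (mu - 1) * pairing (u t) (waveY mu phi) + transport (u t) (waveA mu phi)).
  rewrite -EA; exact: (pairing_evolution m6 uC1 du sol (tw _ _) (fun x => divergence_waveA mu x tphi cphi) tT).
have dB : is_derive t 1 (fun s => pairing (u s) (waveB mu phi))
    (N * pairing (u t) (waveA mu phi) + N * (mu - 1) * pairing (u t) (waveZ mu phi) + transport (u t) (waveB mu phi)).
  rewrite -EB; exact: (pairing_evolution m6 uC1 du sol (tw _ _) (fun x => divergence_waveB mu x tphi cphi) tT).
have dl : is_derive t 1 (fun s : R => N * s) N.
  have -> : (fun s : R => N * s) = N \*: id by [].
  by apply: is_derive_eq; rewrite /GRing.scale/= mulr1.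
have dc : is_derive t 1 (fun s : R => cos (N * s)) (- sin (N * t) * N).
  have := @is_derive1_comp R cos (fun s : R => N * s) t _ _ (is_derive_cos (N * t)) dl; exact.
have ds : is_derive t 1 (fun s : R => sin (N * s)) (cos (N * t) * N).
  have := @is_derive1_comp R sin (fun s : R => N * s) t _ _ (is_derive_sin (N * t)) dl; exact.
rewrite /phase_pairing /phase_rate.
exact: product_rule_cancel dc ds dA dB.
Qed.

End solution_estimates.

(** * Bounds on D and its derivative by the distance to the quasi-geostrophic flow *)

Section phase_bounds.
Context {R : realType}.
Implicit Types (w g : R3 R -> 'rV[R]_(3 + 1)) (X : 'I_4 -> R3 R -> R).

(** Selects the branch of the L^oo norm in which it is an essential supremum. *)
Lemma leb3_setT_gt0 : (0 < (leb3 : set (R3 R) -> \bar R) setT)%E.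
Proof.
pose A : set (measurableTypeR R) := [set` `]0%R, 1%R]].
have mA : measurable A by exact: measurable_itv.
have lA : (lebesgue_measure A = 1)%E.
  by rewrite /A lebesgue_measure_itv/= lte_fin ltr01 sube0.
apply: (@lt_le_trans _ _ (leb3 ((A `*` A) `*` A : set (R3 R)))).
  rewrite (_ : leb3 _ = product_lebesgue3 ((A `*` A) `*` A))//.
  have -> : product_lebesgue3 ((A `*` A) `*` A) = (lebesgue_measure A * lebesgue_measure A * lebesgue_measure A)%E.
    rewrite /product_lebesgue3 product_measure1E//; last exact: measurableX.
    by congr (_ * _)%E; exact: product_measure1E.
  by rewrite lA !mule1 lte01.
by apply: le_measure => //; rewrite inE//; apply: measurableX => //; exact: measurableX.
Qed.

Lemma component_le_enorm n (w : 'rV[R]_n) i : `|w 0 i| <= enorm w.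
Proof.
rewrite /enorm -sqrtr_sqr ler_sqrt; last by apply: sumr_ge0 => j _; exact: sqr_ge0.
by rewrite (bigD1 i)//= lerDl; apply: sumr_ge0 => j _; exact: sqr_ge0.
Qed.

Lemma W1oo_component w e : (W1oo_norm w <= e%:E)%E ->
  {ae leb3, forall x : R3 R, forall i : 'I_4, `|component w i x| <= e}.
Proof.
rewrite /W1oo_norm => h.
have {}h : ('N[leb3]_+oo[(fun x => (enorm (w x))%:E)] <= e%:E)%E.
  by apply: le_trans h; rewrite leeDl//; apply: sume_ge0 => j _; exact: Lnorm_ge0.
move: h; rewrite unlock leb3_setT_gt0 => /ess_supP.
apply: filterS => x /=; rewrite lee_fin ger0_norm ?sqrtr_ge0// => hx i.
exact: le_trans (component_le_enorm _ _) hx.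
Qed.

Lemma componentB w g (i : 'I_4) :
  component (fun x => w x - g x) i = component w i \- component g i.
Proof. by apply/funext => x; rewrite /component !mxE. Qed.

Lemma pairingB w g X r : (forall i, test_function (X i)) -> (forall i x, r < `|x| -> X i x = 0) ->
  (forall i, continuous (component w i)) -> (forall i, continuous (component g i)) ->
  pairing (fun x => w x - g x) X = pairing w X - pairing g X.
Proof.
move=> hX Xr cw cg.
have -> : pairing (fun x => w x - g x) X = fpair (fun i x => -1 * component g i x + component w i x) X.
  rewrite /pairing /fpair; apply: eq_Rintegral => x _; apply: eq_bigr => i _.
  by rewrite /component !mxE; ring.
rewrite (fpair_lin _ hX Xr) => [|i|i]; [|exact: continuous_cube_bd..].
by rewrite /pairing; ring.
Qed.

(** By orthogonality the linear pairings see only the difference from the quasi-geostrophic flow,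
    whence [e]. The quadratic term sees the whole solution, whence [e + B]. [K] is chosen before N,
    mu and the flow. *)
Lemma phase_estimates (phi : R3 R -> R) (r : R) : test_function phi -> commuting phi ->
  (forall x, r < `|x| -> phi x = 0) -> exists2 K, 0 < K &
  forall (N mu : R) w psi (e B : R), 0 < N -> 2^-1 <= mu -> (forall i, continuous (component w i)) ->
    (forall i, continuous (component (grad_mu mu psi) i)) -> (forall x, differentiable psi x) ->
    (forall i x, `|x| <= r -> `|component (grad_mu mu psi) i x| <= B) -> 0 <= B -> 0 <= e ->
    (W1oo_norm (fun x => w x - grad_mu mu psi x)%R <= e%:E)%E -> forall t,
    `|phase_pairing N mu phi w t| <= K * e /\
    `|phase_rate N mu phi w t| <= K * (N * `|mu - 1| * e + (e + B) ^+ 2).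
Proof.
move=> tphi cphi phir.
have [K1 K10 H1] := wave_bounds [:: 2; 2; 0; 1] tphi phir.
have [K2 K20 H2] := wave_bounds [:: 2; 2; 1; 0] tphi phir.
exists (K1 + K2) => [|N mu w psi e B N0 mu2 cw cg dpsi gB B0 e0 We t]; first by rewrite addr_gt0.
have mu0 : 0 < mu by apply: lt_le_trans mu2; rewrite invr_gt0.
have mun : mu != 0 by rewrite gt_eqF.
have muV : `|mu^-1| <= 2.
  by rewrite ger0_norm ?invr_ge0 ?(ltW mu0)// -[leRHS]invrK lef_pV2// posrE ?invr_gt0.
have c2 (a b c d : R) : `|a| <= 2 -> `|b| <= 2 -> `|c| <= 2 -> `|d| <= 2 -> forall i, `|[:: a; b; c; d]`_i| <= 2.
  by move=> ? ? ? ? [|[|[|[|i]]]] //=; rewrite nth_nil normr0.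
have n0 : `|0 : R| <= 2 by rewrite normr0.
have n1 : `|1 : R| <= 2 by rewrite normr1 ler1n.
have nm1 : `|-1 : R| <= 2 by rewrite normrN1 ler1n.
have muVN : `|- mu^-1| <= 2 by rewrite normrN.
have cA := c2 _ _ _ _ n1 n0 nm1 muV.
have cZ := c2 _ _ _ _ n1 n0 muV muV.
have cB := c2 _ _ _ _ n0 nm1 n1 muV.
have cY := c2 _ _ _ _ n0 n1 muV muVN.
have tw c k := test_wave c k tphi.
have wr c k i x : r < `|x| -> wave c k phi i x = 0.
  by move=> rx; rewrite /wave (partial_supp k`_i phir)// mulr0.
have [oA oB oY oZ] := grad_mu_waves mun dpsi cg tphi cphi.
have ae := W1oo_component We.
pose v x := w x - grad_mu mu psi x.
have cv i : continuous (component v i).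
  rewrite (_ : component v i = component w i \- component (grad_mu mu psi) i).
    by move=> x; apply: cvgB; [exact: cw|exact: cg].
  exact: componentB.
have mv i := continuous_measurable_R3 (cv i).
have aev : {ae leb3, forall x : R3 R, `|x| <= r -> forall i, `|component v i x| <= e}.
  by apply: filterS ae => x h _; exact: h.
have mw i := continuous_measurable_R3 (cw i).
have eB0 : 0 <= e + B by rewrite addr_ge0.
have aew : {ae leb3, forall x : R3 R, `|x| <= r -> forall i, `|component w i x| <= e + B}.
  apply: filterS ae => x h xr i.
  have -> : component w i x = component v i x + component (grad_mu mu psi) i x.
    by rewrite /component /v !mxE; ring.
  by apply: (le_trans (ler_normD _ _)); apply: lerD; [exact: (h i)|exact: gB].
have pw c k : pairing (grad_mu mu psi) (wave c k phi) = 0 -> pairing w (wave c k phi) = fpair (component v) (wave c k phi).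
  move=> o; have := pairingB (tw c k) (wr c k) cw cg; rewrite o subr0 => <- //.
have bA : `|pairing w (waveA mu phi)| <= K1 * e.
  rewrite /waveA (pw _ _ oA); exact: ((H1 _ cA).1 _ _ mv e0 aev).
have bZ : `|pairing w (waveZ mu phi)| <= K1 * e.
  rewrite /waveZ (pw _ _ oZ); exact: ((H1 _ cZ).1 _ _ mv e0 aev).
have bB : `|pairing w (waveB mu phi)| <= K2 * e.
  rewrite /waveB (pw _ _ oB); exact: ((H2 _ cB).1 _ _ mv e0 aev).
have bY : `|pairing w (waveY mu phi)| <= K2 * e.
  rewrite /waveY (pw _ _ oY); exact: ((H2 _ cY).1 _ _ mv e0 aev).
have tA : `|transport w (waveA mu phi)| <= K1 * (e + B) ^+ 2.
  exact: ((H1 _ cA).2 _ _ mw eB0 aew).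
have tB : `|transport w (waveB mu phi)| <= K2 * (e + B) ^+ 2.
  exact: ((H2 _ cB).2 _ _ mw eB0 aew).
have comb (a b x y : R) : `|cos (N * t) * a + sin (N * t) * b| <= `|a| + `|b|.
  rewrite (le_trans (ler_normD _ _))// lerD// normrM ler_piMl//.
    by rewrite ler_norml cos_geN1 cos_le1.
  by rewrite ler_norml sin_geN1 sin_le1.
have key (y z K K' : R) : 0 < K' -> `|y| <= K' * e -> `|z| <= K * (e + B) ^+ 2 ->
    `|N * (mu - 1) * y + z| <= K' * (N * `|mu - 1| * e) + K * (e + B) ^+ 2.
  move=> K'0 hy hz; rewrite (le_trans (ler_normD _ _))// lerD// 2!normrM (gtr0_norm N0).
  rewrite (_ : K' * _ = N * `|mu - 1| * (K' * e)); last by ring.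
  by rewrite ler_wpM2l// mulr_ge0// ltW.
split.
  by rewrite (le_trans (comb _ _ 0 0))// mulrDl lerD.
rewrite (le_trans (comb _ _ 0 0))//.
rewrite (le_trans (lerD (key _ _ _ _ K20 bY tA) (key _ _ _ _ K10 bZ tB)))//.
by rewrite le_eqVlt; apply/orP; left; apply/eqP; ring.
Qed.

End phase_bounds.

(** * Initial data of prescribed norm with a nonzero wave part *)

Section initial_data.
Context {R : realType}.

Lemma test_loc_integrable (f : R3 R -> R) : test_function f -> loc_integrable f.
Proof.
move=> tf; have [M _ HM] := test_bounded tf.
exact: (loc_integrable_bounded (continuous_measurable_R3 (test_continuous tf)) HM).
Qed.

Lemma test_ibp i (f g : R3 R -> R) : test_function f -> test_function g ->
  \int[leb3]_x (f x * partial i g x) = - \int[leb3]_x (partial i f x * g x).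
Proof.
move=> tf tg; have [sf [r fr]] := tf; have [sg _] := tg.
have tfi := test_partial i tf; have tgi := test_partial i tg.
have i1 := continuous_test_integrable (test_continuous tf) tgi.
have i2 := continuous_test_integrable (test_continuous tfi) tg.
have E x : partial i (f \* g) x = partial i f x * g x + f x * partial i g x.
  exact: (partialM i (sf [::] x) (sg [::] x)).
have cc : continuous (partial i (f \* g)).
  rewrite (_ : partial i _ = (fun x => partial i f x * g x + f x * partial i g x)); last exact/funext.
  by move=> x; apply: cvgD; apply: cvgM; exact: test_continuous.
have [M M0 HM] := continuous_cube_bounded r cc.
have [_ I0] : leb3.-integrable setT (EFin \o partial i (f \* g)) /\ \int[leb3]_x partial i (f \* g) x = 0.
  apply: (integral_partial_cube _ _ _ HM (ltW M0)).
  - by move=> x; apply: cvgM; exact: test_continuous.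
  - by move=> x; apply: derivableM; apply: diff_derivable; [exact: (sf [::] x)|exact: (sg [::] x)].
  - by move=> x rx; exact: (etrans (congr1 (fun z => z * g x) (fr x rx)) (mul0r _)).
apply/eqP; rewrite -addr_eq0 addrC -(RintegralD measurableT i2 i1) -I0; apply/eqP.
by apply: eq_Rintegral => x _; rewrite E.
Qed.

(** Each integration by parts takes the outermost derivative off the test function and makes it the
    next one applied to [f], so the order is reversed. *)
Lemma test_wderiv s (f : R3 R -> R) : test_function f -> is_wderiv s f (partials (rev s) f).
Proof.
move=> tf; split; [exact: test_loc_integrable|exact: test_loc_integrable (test_partials _ tf)|].
elim: s f tf => [|i s IH] f tf phi tphi; first by rewrite /= expr0 mul1r.
rewrite /= -/(partials s phi) (test_ibp i tf (test_partials s tphi)) (IH _ (test_partial i tf) _ tphi).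
by rewrite exprS mulN1r mulNr rev_cons -cats1 /partials foldr_cat.
Qed.

Lemma test_sqr_integrable (f : R3 R -> R) : test_function f ->
  leb3.-integrable setT (fun x => ((f x) ^+ 2)%:E).
Proof. by move=> tf; exact: (continuous_test_integrable (test_continuous tf) tf). Qed.

Lemma test_Lfun2 (f : R3 R -> R) : test_function f -> f \in Lfun leb3 2%:E.
Proof.
move=> tf; rewrite inE; apply/andP; split.
  by rewrite inE/=; exact: continuous_measurable_R3 (test_continuous tf).
rewrite inE /= /finite_norm unlock; apply: poweR_lty.
have := test_sqr_integrable tf => /integrableP[_]; congr (_ < _)%E.
by apply: eq_integral => x _ /=; rewrite powR_mulrn// real_normK ?num_real// ger0_norm// sqr_ge0.
Qed.

(** [wderiv] is an arbitrary choice of representative; uniqueness almost everywhere makes its norm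
    computable from any explicit weak derivative. *)
Lemma Lnorm2_wderiv s (f g : R3 R -> R) : is_wderiv s f g -> test_function g ->
  ('N[leb3]_2%:E[EFin \o wderiv s f] `^ 2 = (\int[leb3]_x ((g x) ^+ 2))%:E)%E.
Proof.
move=> d tg; have d' := is_wderiv_wderiv d.
have ae := is_wderiv_unique d' d.
have mg : measurable_fun setT g by have [_ []] := d.
have mw : measurable_fun setT (wderiv s f) by have [_ []] := d'.
rewrite poweR_Lnorm ?pnatr_eq0// /Rintegral fineK; last first.
  by apply: integrable_fin_num => //; exact: test_sqr_integrable.
transitivity (\int[leb3]_x ((wderiv s f x) ^+ 2)%:E)%E.
  by apply: eq_integral => x _ /=; rewrite powR_mulrn// real_normK ?num_real.
apply: ae_eq_integral => //; [exact: measurable_sqr|exact: measurable_sqr|].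
by apply: filterS ae => x -> _.
Qed.

Lemma in_H_test m n (w : R3 R -> 'rV[R]_n) : (forall i, test_function (component w i)) -> in_H m w.
Proof.
move=> tw i a _; exists (partials (rev (mseq a)) (component w i)); first exact: test_wderiv.
by apply: test_Lfun2; exact: test_partials.
Qed.

(** A mollifier centred at [y], bounded by some M, pairs with [f] to at least f(y)/2 and to at most
    M times the integral of [f]. *)
Lemma continuous_integral_gt0 (f : R3 R -> R) y : continuous f -> (forall x, 0 <= f x) ->
  loc_integrable f -> leb3.-integrable setT (EFin \o f) -> 0 < f y -> 0 < \int[leb3]_x f x.
Proof.
move=> cf f0 lf if_ fy; have fy2 : 0 < f y / 2 by rewrite divr_gt0.
have [eps eps01 Heps] := mollify_near y lf cf fy2.
have [rho [X [_ [_ HX]]]] := @exists_mollifier R 1 ltr01.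
have [T [mT _ _]] := HX eps eps01.
have := Heps _ _ _ (mT y.1.1) (mT y.1.2) (mT y.2).
have ct t : ctest (T t).
  have [sT _ zT _] := mT t; split => //; exists (`|t| + eps) => s hs; apply: zT.
  by move: hs; have := ler_normB s t; have := ler_normD (s - t) t; rewrite subrK; lra.
have tt := test_tensor (ct y.1.1) (ct y.1.2) (ct y.2).
have [M M0 HM] := test_bounded tt.
have iT := test_integrable lf tt.
have iM : leb3.-integrable setT (EFin \o (fun x => M * f x)).
  by have := integrableZl measurableT M if_; apply: eq_integrable.
have : 0 <= \int[leb3]_x (M * f x - (f \* tensor (T y.1.1) (T y.1.2) (T y.2)) x).
  apply: Rintegral_ge0 => x _ /=; rewrite subr_ge0 [M * _]mulrC ler_wpM2l//.
  exact: le_trans (ler_norm _) (HM x).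
rewrite (RintegralB measurableT iM iT) RintegralZl//.
set I := \int[leb3]_x (_ * _); rewrite -/I => h1 h2.
have h3 : f y / 2 <= I by have := ler_norm (f y - I); rewrite distrC in h2; lra.
by rewrite -(pmulr_rgt0 _ M0); lra.
Qed.

Lemma exists_bump : exists phi : R3 R -> R, [/\ test_function phi, commuting phi &
  0 < \int[leb3]_x (partial 2 phi x) ^+ 2].
Proof.
have [chi [tchi chi0 chi1]] := @exists_cutoff R 1 ltr01.
have [schi _] := tchi.
pose phi := tensor chi chi chi; have tphi : test_function phi by exact: test_tensor.
exists phi; split; first exact: tphi.
  move=> i j; have := @partials_tensor R [:: i; j] chi chi chi schi schi schi.
  have := @partials_tensor R [:: j; i] chi chi chi schi schi schi.
  by rewrite /= !addn0 => -> ->; congr (tensor (derive1n _ _) (derive1n _ _) (derive1n _ _)); rewrite addnC.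
have t2 := test_partial 2 tphi.
have [y hy] : exists y, partial 2 phi y != 0.
  apply: contrapT => /forallNP h; have dphi y : derivable phi y (unit_vec 2).
    by have [sphi _] := tphi; apply: diff_derivable; exact: (sphi [::] y).
  have z y : `|'D_(unit_vec 2) phi y| <= 0.
    by have := h y; move/negP; rewrite negbK => /eqP; rewrite /partial => ->; rewrite normr0.
  (* Were the third derivative zero, [phi] would be constant along the third axis; but it is 1 at
     the origin and 0 at height 4, beyond the support bound 1 + 2 of [chi]. *)
  have := lipschitz_line dphi z 0 4; rewrite mul0r normr_le0 subr_eq0 addr0 => /eqP.
  rewrite /phi /tensor /unit_vec /= !scaler0 (_ : 4 *: 1%:R = 4); last by rewrite /GRing.scale/= mulr1.
  rewrite (chi0 4); last by rewrite ger0_norm//; lra.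
  rewrite mulr0 chi1 ?normr0// !mulr1 => /eqP; by rewrite eq_sym oner_eq0.
pose f x := (partial 2 phi x) ^+ 2.
have cf : continuous f.
  by have c2 := test_continuous t2; move=> x; exact: (cvgM (c2 x) (c2 x)).
have [M M0 HM] := test_bounded t2.
apply: (@continuous_integral_gt0 f y).
- exact: cf.
- by move=> x; exact: sqr_ge0.
- apply: (loc_integrable_bounded (M := M ^+ 2) (continuous_measurable_R3 cf)) => x.
  by rewrite /f normrX lerXn2r ?nnegrE// ltW.
- exact: test_sqr_integrable.
- by rewrite /f exprn_even_gt0.
Qed.

(** The data are built with mu = 1 and kept fixed, while the test field follows mu. The integrand is
    c times a sum of squares with weights 1, 1 and 1/mu; keeping the first square alone gives a
    bound free of mu. *)
Lemma pairing_waveA_ge (phi : R3 R -> R) (u0 : R3 R -> 'rV[R]_(3 + 1)) (c mu : R) : test_function phi ->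
  (forall i x, component u0 i x = c * waveA 1 phi i x) -> 0 < c -> 0 < mu ->
  c * \int[leb3]_x (partial 2 phi x) ^+ 2 <= pairing u0 (waveA mu phi).
Proof.
move=> tphi u0E c0 mu0; have t k := test_partial k tphi.
have iu : leb3.-integrable setT (EFin \o (fun x => \sum_(i < 4) component u0 i x * waveA mu phi i x)).
  have [r r0 Xr] := test_field_supp (test_wave [:: 1; 0; -1; mu^-1] [:: 2; 2; 0; 1] tphi).
  apply: (fpair_integrable (test_wave _ _ tphi) Xr) => i; apply: continuous_cube_bd.
  rewrite (_ : component u0 i = (fun x => c * waveA 1 phi i x)); last by apply/funext => x; exact: u0E.
  by apply: test_continuous; apply: testZ; exact: test_wave.
have i2 := test_sqr_integrable (t 2).
rewrite -(RintegralZl c measurableT i2).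
apply: le_Rintegral => //; first by have := integrableZl measurableT c i2; apply: eq_integrable.
move=> x _; rewrite sum4 !u0E /waveA /wave /=.
move: (partial 2 phi x) (partial 0 phi x) (partial 1 phi x) => y z w.
rewrite -subr_ge0 (_ : _ - _ = c * (z ^+ 2 + mu^-1 * w ^+ 2)); last by rewrite invr1; ring.
by rewrite mulr_ge0 ?(ltW c0)// addr_ge0 ?sqr_ge0// mulr_ge0 ?sqr_ge0// invr_ge0 ltW.
Qed.

(** Exact homogeneity, with a finite positive factor, allows the norm of the data to be scaled to
    any prescribed [M]. *)
Lemma Hnorm_test m n (w : R3 R -> 'rV[R]_n) i0 : (forall i, test_function (component w i)) ->
  0 < \int[leb3]_x (component w i0 x) ^+ 2 -> exists2 s, 0 < s &
  forall c, 0 <= c -> Hnorm m (fun x => c *: w x) = (c * s)%:E.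
Proof.
move=> tw pos; pose E i (a : mindex m) := \int[leb3]_x (partials (rev (mseq a)) (component w i) x) ^+ 2.
have E0 i a : 0 <= E i a by apply: Rintegral_ge0 => x _; exact: sqr_ge0.
pose S := \sum_(i < n) \sum_(a : mindex m | (mlength a <= m)%N) E i a.
pose a0 : mindex m := [ffun=> ord0].
have S0 : 0 < S.
  have a00 : (mlength a0 <= m)%N by rewrite /mlength big1// => i _; rewrite ffunE.
  rewrite /S (bigD1 i0)//= (bigD1 a0)//= -addrA ltr_pwDl//.
    by rewrite /E mseq_seq3 !ffunE.
  by rewrite addr_ge0//; [apply: sumr_ge0|apply: sumr_ge0 => i _; apply: sumr_ge0].
exists (Num.sqrt S); first by rewrite sqrtr_gt0.
move=> c c0; rewrite /Hnorm.
have -> : (\sum_(i < n) \sum_(a : mindex m | (mlength a <= m)%N)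
     'N[leb3]_2%:E[EFin \o wderiv (mseq a) (component (fun x => c *: w x) i)] `^ 2 = (c ^+ 2 * S)%:E)%E.
  rewrite /S mulr_sumr -sumEFin; apply: eq_bigr => i _.
  rewrite mulr_sumr -sumEFin; apply: eq_bigr => a _.
  have cE : component (fun x => c *: w x) i = (fun x => c * component w i x).
    by apply/funext => x; rewrite /component mxE.
  have d := is_wderivZ c (test_wderiv (mseq a) (tw i)).
  have tp := test_partials (rev (mseq a)) (tw i).
  rewrite cE (Lnorm2_wderiv d (testZ c tp)); congr EFin.
  rewrite /E -(RintegralZl _ measurableT (test_sqr_integrable tp)).
  by apply: eq_Rintegral => x _; rewrite exprMn.
rewrite poweR_EFin powR12_sqrt; last by rewrite mulr_ge0 ?sqr_ge0// ltW.
by rewrite sqrtrM ?sqr_ge0// sqrtr_sqr ger0_norm.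
Qed.

Lemma exists_data m (M : R) (phi : R3 R -> R) : test_function phi -> commuting phi -> 0 < M ->
  0 < \int[leb3]_x (partial 2 phi x) ^+ 2 ->
  exists u0 c, [/\ 0 < c, forall i x, component u0 i x = c * waveA 1 phi i x, in_H m u0,
    wdiv_free (velocity u0) & Hnorm m u0 = M%:E].
Proof.
move=> tphi cphi M0 pos.
pose w x : 'rV[R]_(3 + 1) := \row_i waveA 1 phi i x.
have wE i : component w i = waveA 1 phi i by apply/funext => x; rewrite /component mxE.
have tw i : test_function (component w i) by rewrite wE; exact: test_wave.
have [|s s0 Hs] := @Hnorm_test m _ w 0 tw.
  rewrite wE (_ : (fun x => _) = (fun x => partial 2 phi x ^+ 2))//.
  by apply/funext => x; rewrite /waveA /wave /= mul1r.
pose c := M / s; have c0 : 0 < c by rewrite divr_gt0.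
pose u0 x := c *: w x.
have uE i : component u0 i = (fun x => c * waveA 1 phi i x).
  by apply/funext => x; rewrite -wE /component /u0 mxE.
have tu i : test_function (component u0 i) by rewrite uE; apply: testZ; exact: test_wave.
exists u0, c; split => //.
- by move=> i x; rewrite uE.
- exact: in_H_test.
- have vE i : component (velocity u0) i = component u0 (lshift 1 i).
    by apply/funext => x; rewrite /component /velocity mxE.
  have ae i : {ae leb3, forall x : R3 R, wderiv [:: i] (component (velocity u0) i) x = c * partial i (waveA 1 phi (lshift 1 i)) x}.
    rewrite vE; have d := test_wderiv [:: i] (tu (lshift 1 i)).
    have := is_wderiv_unique (is_wderiv_wderiv d) d; apply: filterS => x ->.
    rewrite /= uE; have [st _] := test_wave [:: 1; 0; -1; 1^-1] [:: 2; 2; 0; 1] tphi (lshift 1 i).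
    by have := partialsZ [:: i] c st => /= ->.
  rewrite /wdiv_free; move: (ae 0) (ae 1) (ae 2); apply: filterS3 => x e0 e1 e2.
  rewrite sum3 e0 e1 e2 -!mulrDr.
  by have := divergence_waveA 1 x tphi cphi; rewrite sum3 => ->; rewrite mulr0.
- by rewrite /u0 Hs ?ltW// /c divfK// gt_eqF.
Qed.

End initial_data.

(** * Choice of the frequency and the lower bound on the constant *)

Section conclusion.
Context {R : realType}.

(** [B] and [d] depend on the flow, hence on mu, without any uniformity. A bound near time 0 is
    enough because tau may be taken small once mu is fixed. *)
Lemma grad_mu_bounded m mu (psi : R -> R3 R -> R) (r : R) : (6 <= m)%N -> 0 < r ->
  H_cont m `[0, +oo[ (fun t => grad_mu mu (psi t)) ->
  (forall t i, 0 <= t -> continuous (component (grad_mu mu (psi t)) i)) ->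
  exists B d, [/\ 0 <= B, 0 < d & forall t, 0 <= t < d -> forall (i : 'I_4) x, `|x| <= r ->
    `|component (grad_mu mu (psi t)) i x| <= B].
Proof.
move=> m6 r0 gH cg.
have I0 : `[(0:R), +oo[%classic 0 by rewrite /= in_itv/= lexx.
have H (i : 'I_4) : exists2 d, 0 < d & forall s, `[0, +oo[%classic s -> `|s - 0| < d ->
    forall x : R3 R, `|x| <= r -> `|component (grad_mu mu (psi s)) i x - component (grad_mu mu (psi 0)) i x| <= 1.
  have cu s : `[0, +oo[%classic s -> continuous (component (grad_mu mu (psi s)) i).
    by rewrite /= in_itv/= andbT; exact: cg.
  exact: (H_cont_cube m6 r0 gH cu I0 ltr01).
have [|d d0 Hd] := min4 _ H.
  by move=> i d d' _ dd' H' s Is sd; apply: H' => //; exact: lt_le_trans dd'.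
have /choice[b Hb] : forall i : 'I_4, exists b, forall x : R3 R, `|x| <= r -> `|component (grad_mu mu (psi 0)) i x| <= b.
  move=> i; have ci := cg 0 i (lexx 0).
  by have [b _ hb] := continuous_cube_bounded r ci; exists b.
exists (1 + \sum_i `|b i|), d; split => //; first by rewrite addr_ge0// sumr_ge0.
move=> t /andP[t0 td] i x xr.
rewrite -(subrK (component (grad_mu mu (psi 0)) i x) (component (grad_mu mu (psi t)) i x)).
apply: (le_trans (ler_normD _ _)); apply: lerD.
  by apply: Hd => //; [rewrite /= in_itv/= t0|rewrite subr0 ger0_norm].
apply: (le_trans (Hb i x xr)); apply: (le_trans (ler_norm _)).
by rewrite (bigD1 i)//= lerDl sumr_ge0.
Qed.

Lemma W1oo_norm_ge0 n (w : R3 R -> 'rV[R]_n) : (0 <= W1oo_norm w)%E.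
Proof. by rewrite adde_ge0 ?Lnorm_ge0// sume_ge0// => j _; exact: Lnorm_ge0. Qed.

Lemma LqW1oo_norm_poweR n (q T : R) (w : R -> R3 R -> 'rV[R]_n) : 0 < q ->
  (LqW1oo_norm q T w `^ q = \int[lebesgue_measure]_(t in `]0%R, T[) (W1oo_norm (w t) `^ q))%E.
Proof.
move=> q0; rewrite /LqW1oo_norm -poweRrM mulVf ?gt_eqF// poweRe1//.
by apply: integral_ge0 => t _; exact: poweR_ge0.
Qed.

Lemma pairing_ae (u v : R3 R -> 'rV[R]_(3 + 1)) (X : 'I_4 -> R3 R -> R) :
  (forall i, measurable_fun setT (component u i)) -> (forall i, measurable_fun setT (component v i)) ->
  (forall i, test_function (X i)) -> {ae leb3, forall x : R3 R, u x = v x} -> pairing u X = pairing v X.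
Proof.
move=> mu mv hX uv.
have mX i := continuous_measurable_R3 (test_continuous (hX i)).
have m f (mf : forall i : 'I_4, measurable_fun setT (f i : R3 R -> R)) :
    measurable_fun setT (fun x => (\sum_(i < 4) f i x * X i x)%:E).
  apply/measurable_EFinP; apply: measurable_sum => i; exact: measurable_funM.
rewrite /pairing /fpair /Rintegral; congr fine; apply: ae_eq_integral => //; [exact: m|exact: m|].
by apply: filterS uv => x e _; rewrite /component e.
Qed.

(** Since N eta tau = 1, the slow term doubles the linear one. The part with [c0] then costs d/4,
    the terms with [B] and with 2 I cost d/8 each, so half of d tau is left against 2 K cq I, where
    I <= Cm / N = Cm eta tau. *)
Lemma constant_lower_bound (d K c0 cq tau eta N Cm I B S : R) : 0 < d -> 0 < K -> 0 < tau -> 0 < eta -> 0 < N ->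
  0 < cq -> 0 < Cm -> 2 * K * c0 = d / 4 -> N * eta * tau = 1 -> N <= S -> I = Cm / S ->
  16 * K * (1 + B ^+ 2) * tau <= d -> 16 * K * Cm <= d * N ->
  d * tau <= K * (c0 * tau + cq * I) +
    tau * K * (N * eta * (c0 * tau + cq * I) + 2 * (1 + B ^+ 2) * tau + 2 * I) ->
  1 / Cm <= 4 * K * cq / d * eta.
Proof.
move=> d0 K0 tau0 eta0 N0 cq0 Cm0 c0E tauE NS IE h1 h2 h.
have S0 : 0 < S by exact: lt_le_trans NS.
have IN : I * N <= Cm by rewrite IE mulrAC ler_pdivrMr// ler_wpM2l// ltW.
have I0 : 0 <= I by rewrite IE divr_ge0// ltW.
have It : I <= Cm * eta * tau.
  rewrite -(ler_pM2r N0) (le_trans IN)// (_ : _ * tau * N = Cm * (N * eta * tau)); last by ring.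
  by rewrite tauE mulr1.
have e1 : d * tau <= 2 * K * c0 * tau + 2 * K * cq * I + 2 * K * (1 + B ^+ 2) * tau * tau + 2 * K * I * tau.
  apply: (le_trans h); rewrite le_eqVlt; apply/orP; left; apply/eqP.
  rewrite (_ : tau * K * _ = (N * eta * tau) * (K * (c0 * tau + cq * I)) + tau * K * (2 * (1 + B ^+ 2) * tau + 2 * I)); last by ring.
  by rewrite tauE mul1r; ring.
have e2 : 2 * K * (1 + B ^+ 2) * tau * tau <= d / 8 * tau.
  by rewrite ler_wpM2r ?(ltW tau0)//; lra.
have e3 : 2 * K * I * tau <= d / 8 * tau.
  rewrite ler_wpM2r ?(ltW tau0)//; rewrite -(ler_pM2r N0).
  have := ler_wpM2l (ltW K0) IN; lra.
have e4 : 2 * K * cq * I <= 2 * K * cq * (Cm * eta) * tau.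
  rewrite -[leRHS]mulrA; apply: ler_wpM2l It; by rewrite !mulr_ge0 ?(ltW K0) ?(ltW cq0).
rewrite c0E in e1.
have e5 : d / 2 * tau <= 2 * K * cq * (Cm * eta) * tau by lra.
rewrite ler_pM2r// in e5.
rewrite ler_pdivrMr// mulrAC mulrAC -mulrA.
rewrite (_ : 4 * K * cq / d * (eta * Cm) = (2 * K * cq * (Cm * eta)) / (d / 2)).
  by rewrite ler_pdivlMr ?divr_gt0// mul1r.
by field; rewrite gt_eqF.
Qed.

(** With tau = 1 / (N eta) every upper bound on tau is a lower bound on N, so the sum of all
    thresholds serves as N. *)
Lemma choose_frequency (R0 B T tB d K Cm eta : R) : 0 < T -> 0 < tB -> 0 < d -> 0 < K -> 0 < Cm ->
  0 < eta -> exists N tau, [/\ 0 < N, R0 < N, 0 < tau, tau <= T & tau <= tB] /\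
    [/\ N * eta * tau = 1, 16 * K * (1 + B ^+ 2) * tau <= d & 16 * K * Cm <= d * N].
Proof.
move=> T0 tB0 d0 K0 Cm0 eta0.
have tau_le a N : 0 < N -> 0 < a -> (eta * a)^-1 <= N -> (N * eta)^-1 <= a.
  move=> N0 a0 h; rewrite -[leRHS]invrK lef_pV2 ?posrE ?mulr_gt0 ?invr_gt0//.
  by rewrite -ler_pdivrMr// -invfM [a * _]mulrC.
pose k := 16 * K * (1 + B ^+ 2) / d; pose l := 16 * K * Cm / d.
have k0 : 0 < k by rewrite divr_gt0// mulr_gt0 ?mulr_gt0// ltr_wpDr// sqr_ge0.
have l0 : 0 < l by rewrite divr_gt0// !mulr_gt0.
have p1 : 0 < (eta * T)^-1 by rewrite invr_gt0 mulr_gt0.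
have p2 : 0 < (eta * tB)^-1 by rewrite invr_gt0 mulr_gt0.
have p3 : 0 < (eta * k^-1)^-1 by rewrite invr_gt0 mulr_gt0// invr_gt0.
pose N := `|R0| + (eta * T)^-1 + (eta * tB)^-1 + (eta * k^-1)^-1 + l.
have [N0 N1 N2 N3 N4] : [/\ R0 < N, (eta * T)^-1 <= N, (eta * tB)^-1 <= N, (eta * k^-1)^-1 <= N & l <= N].
  have sum5 (y x a b c e : R) : y <= x -> 0 <= x -> 0 < a -> 0 < b -> 0 < c -> 0 < e ->
      [/\ y < x + a + b + c + e, a <= x + a + b + c + e, b <= x + a + b + c + e,
        c <= x + a + b + c + e & e <= x + a + b + c + e].
    by clear; move=> *; split; lra.
  exact: sum5 (ler_norm _) (normr_ge0 _) p1 p2 p3 l0.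
have N5 : 0 < N by exact: lt_le_trans N4.
clearbody N; exists N, (N * eta)^-1; split; split => //.
- by rewrite invr_gt0 mulr_gt0.
- exact: tau_le.
- exact: tau_le.
- by rewrite mulfV// mulf_neq0 ?gt_eqF.
- have := tau_le k^-1 N N5; rewrite invr_gt0 => /(_ k0 N3).
  by rewrite -[leRHS]div1r ler_pdivlMr// /k mulrA ler_pdivrMr// mul1r mulrC.
- by move: N4; rewrite /l ler_pdivrMr// [N * d]mulrC.
Qed.

Lemma convergence_constant_lower (m : nat) (q T M : R) : (7 <= m)%N -> 4 <= q -> 0 < T -> 0 < M ->
  exists2 L, 0 < L & forall mu R0 Cm, 2^-1 <= mu -> mu != 1 -> 0 < Cm ->
    convergence_rate m q T M mu R0 Cm -> 1 / Cm <= L * `|mu - 1|.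
Proof.
move=> m7 q4 T0 M0; have m6 : (6 <= m)%N by exact: ltnW.
(* Time difference quotients converge in H^(m-1), and the Sobolev bound takes six derivatives: this
   is the origin of m >= 7. *)
have m6' : (6 <= m.-1)%N by case: (m) m7.
have [phi [tphi cphi pos]] := @exists_bump R.
have [u0 [c [c0 uE uH udiv uM]]] := exists_data m tphi cphi M0 pos.
have [r r0 phir] : exists2 r, 0 < r & forall x, r < `|x| -> phi x = 0.
  have [r r0 H] := test_field_supp (n := 1) (X := fun=> phi) (fun=> tphi).
  by exists r => // x; exact: (H 0).
have [K K0 HK] := phase_estimates tphi cphi phir.
pose d := c * \int[leb3]_x (partial 2 phi x) ^+ 2; have d0 : 0 < d by rewrite mulr_gt0.
(* Chosen so that 2 K c1 = d/4, as [constant_lower_bound] requires; it does not depend on mu. *)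
pose c1 := d / (8 * K); have c10 : 0 < c1 by rewrite divr_gt0// mulr_gt0.
have cq0 : 0 < c1 `^ (1 - q) by rewrite powR_gt0.
exists (4 * K * c1 `^ (1 - q) / d); first by rewrite divr_gt0// !mulr_gt0.
move=> mu R0 Cm mu2 mu1 Cm0 rate.
have mu0 : 0 < mu by apply: lt_le_trans mu2; rewrite invr_gt0.
have eta0 : 0 < `|mu - 1| by rewrite normr_gt0 subr_eq0.
have [psi [gH _ dpsi _ _] Hpsi] := rate u0 uH udiv uM.
have cg t i : 0 <= t -> continuous (component (grad_mu mu (psi t)) i).
  move=> t0 x; apply: differentiable_continuous; apply: differentiable_component.
  by have [] := dpsi t x t0.
have [B [tB [B0 tB0 HB]]] := grad_mu_bounded m6 r0 gH cg.
have [N [tau [[N0 R0N tau0 tauT tautB] [tauE h1 h2]]]] := choose_frequency R0 B T0 tB0 d0 K0 Cm0 eta0.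
pose S := Num.sqrt ((mu * N) ^+ 2 + N ^+ 2).
have NS : N <= S.
  rewrite -[leLHS](ger0_norm (ltW N0)) -sqrtr_sqr ler_sqrt ?addr_ge0 ?sqr_ge0//.
  by rewrite lerDr sqr_ge0.
have R0S : R0 < S by exact: lt_le_trans NS.
have [|u [[uc uC1 du uu0 [p sol]] _ ule]] := Hpsi (mu * N) N (mulr_gt0 mu0 N0) N0 _ R0S.
  by rewrite mulfK// gt_eqF.
rewrite (LqW1oo_norm_poweR _ _ (lt_le_trans _ q4))// in ule.
have sub t : 0 <= t <= tau -> 0 <= t <= T by move=> /andP[-> h]; exact: le_trans tauT.
have [cD cG] := phase_continuous N mu m6 uc du tphi.
have subI : `[0, tau]%classic `<=` (`[0, T]%classic : set R) by apply: subset_itvl; rewrite bnd_simp.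
have q2 : 2 <= q by clear -q4; lra.
have tauT' : 0 < tau <= T by rewrite tau0.
have deta : 0 <= N * `|mu - 1| by rewrite mulr_ge0// ltW.
have osc := @oscillation_bound R q tau T (Cm / S) K (N * `|mu - 1|) B c1
  (fun t => W1oo_norm (fun x => u t x - grad_mu mu (psi t) x))
  (fun t => phase_pairing N mu phi (u t) t) (fun t => phase_rate N mu phi (u t) t)
  q2 tauT' K0 deta c10 (fun t => W1oo_norm_ge0 _) ule
  (continuous_subspaceW subI cD) (continuous_subspaceW subI cG).
have {}osc := osc _ _.
have D0 : d <= `|phase_pairing N mu phi (u 0) 0|.
  rewrite /phase_pairing mulr0 cos0 sin0 mul1r mul0r addr0.
  (* The solution takes its initial value only almost everywhere, which a pairing does not
     notice. *)
  have -> : pairing (u 0) (waveA mu phi) = pairing u0 (waveA mu phi).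
    apply: pairing_ae => //.
    - move=> i; apply: continuous_measurable_R3 => x; apply: differentiable_continuous.
      by apply: differentiable_component; apply: du; rewrite lexx ltW.
    - move=> i; rewrite (_ : component u0 i = (fun x => c * waveA 1 phi i x)); last by apply/funext => x; exact: uE.
      by apply: continuous_measurable_R3; apply: test_continuous; apply: testZ; exact: test_wave.
    - exact: test_wave.
  exact: le_trans (pairing_waveA_ge tphi uE c0 mu0) (ler_norm _).
have {}osc := le_trans (ler_wpM2r (ltW tau0) D0) (osc _ _).
apply: (constant_lower_bound d0 K0 tau0 eta0 N0 cq0 Cm0 _ tauE NS erefl h1 h2 (osc _ _)).
- by rewrite /c1; field; rewrite gt_eqF.
- by move=> t /andP[t0 tt]; apply: (phase_derivative m6' uC1 du (lt0r_neq0 mu0) sol tphi cphi); rewrite t0 (lt_le_trans tt).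
- move=> t e /andP[t0 tt] e0 We; rewrite -[N * `|mu - 1| * e]/(_ * e).
  have tT : 0 <= t <= T by rewrite (ltW t0) (ltW (lt_le_trans tt tauT)).
  apply: (HK N mu (u t) (psi t) e B N0 mu2) => //.
  + move=> i x; apply: differentiable_continuous; apply: differentiable_component; exact: du.
  + by move=> i; apply: cg; exact: ltW.
  + by move=> x; have [] := dpsi t x (ltW t0).
  + by move=> i x; apply: HB; rewrite (ltW t0) (lt_le_trans tt tautB).
Qed.

End conclusion.

Theorem corollary2p7 (R : realType) (m : nat) (q T M : R)
    (C : R -> R) (mu_ : nat -> R) :
  (7 <= m)%N -> 4 <= q -> 0 < T -> 0 < M ->
  (forall mu : R, 0 < mu -> mu != 1 ->
     0 < C mu /\
     exists2 R0 : R, 0 < R0 & convergence_rate m q T M mu R0 (C mu)) ->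
  (forall k, 0 < mu_ k) -> (forall k, mu_ k != 1) ->
  mu_ @ \oo --> (1 : R) ->
  (fun k => (1 / C (mu_ k))%R) =O_\oo (fun k => `|1 - mu_ k|).
Proof.
move=> m7 q4 T0 M0 HC mu0 mu1 cmu.
have [L L0 HL] := convergence_constant_lower m7 q4 T0 M0.
apply/eqO_exP; exists L => //.
have h0 : (0 : R) < 2^-1 by rewrite invr_gt0.
have /cvgrPdist_le/(_ _ h0) := cmu.
apply: filterS => k hk; have [C0 [R0 _ rate]] := HC _ (mu0 k) (mu1 k).
(* Eventually mu_k lies in the range where the constant [L] is uniform. *)
have mu2 : 2^-1 <= mu_ k.
  by move: hk; rewrite ler_norml => /andP[_]; lra.
have := HL _ _ _ mu2 (mu1 k) C0 rate.
have -> : `|1 / C (mu_ k)| = 1 / C (mu_ k) by rewrite ger0_norm// divr_ge0// ltW.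
by rewrite normr_id distrC.
Qed.
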